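(* Let $q(t)$, $t\in[0,T]$, be the trajectory of $\dot q(t)=\sum_{i=1}^lu_i(t)X_i(q(t))$, $q(0)=q_0$, corresponding to a control $u\in\Omega$, and let $k\in\mathbb{N}$. Then for every $k$-tuple $\vec{\Delta u}=(\Delta u^{(1)},\dots,\Delta u^{(k)})\in\Omega^k\simeq T^k_u\Omega$ the curve $$p^{(k)}(t):=(t,q^{(1)}(t,\vec{\Delta u}),\dots,q^{(k)}(t,\vec{\Delta u})),$$ where $(q^{(1)}(t,\vec{\Delta u}),\dots,q^{(k)}(t,\vec{\Delta u}))$ is the image under the transformation of adapted coordinates $\Psi^{(k)}(t)$ of the $k$-jet at $s=0$ of $s\mapsto\mathrm{End}^t[u+s\circ\vec{\Delta u}]$, is a trajectory of the control-affine system $$\dot p^{(k)}(t)=\partial_t+\sum_{r=1}^k\sum_{i=1}^l\Delta u^{(r)}_i(t)\cdot Z_i^{(k-r+1)}(p^{(k)}(t)),\qquad p^{(k)}(0)=(0,0,\dots,0),$$ where, for $j=1,\dots,k$, $Z^{(j)}_i$ is the vector field in the variables $(t,q^{(1)},\dots,q^{(k)})$ with zero $\partial_t$-component whose $(q^{(1)},\dots,q^{(k)})$-components are $$Z_i^{(j)}=\big(\underbrace{0,\dots,0}_{k-j},\,y_i^{(1)}(t),\,y_i^{(2)}(t,q^{(1)}),\dots,\,y_i^{(j)}(t,q^{(1)},\dots,q^{(j-1)})\big),$$ with the functions $y_i^{(m)}$ defined in the context.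
   Context: Control system. $M$ is a smooth $n$-dimensional manifold, $X_1,\dots,X_l$ are smooth, pointwise linearly independent vector fields on $M$, $T>0$, $q_0\in M$ is fixed, and $\Omega$ is a vector subspace of the space $\mathrm{Meas}([0,T],\mathbb{R}^l)$ of measurable maps. For $u\in\Omega$ one considers the Carathéodory solution on $[0,T]$ of $\dot q(t)=\sum_{i=1}^l u_i(t)X_i(q(t))$, $q(0)=q_0$. For $t\in[0,T]$ the end-point map is $\mathrm{End}^t:\Omega\to M$, $\mathrm{End}^t(u)=q(t)$; it is assumed to be defined on all of $\Omega$. Notation. $s\circ\vec{\Delta u}:=s\cdot\Delta u^{(1)}+s^2\cdot\Delta u^{(2)}+\dots+s^k\cdot\Delta u^{(k)}$. Jets and multi-indices. $T^k_pM$ is the space of $k$-jets at $s=0$ of curves in $M$ passing through $p$ at $s=0$; in a chart a $k$-jet is written $\vec b=(b^{(1)},\dots,b^{(k)})\in(\mathbb{R}^n)^k$, representing $p+sb^{(1)}+\dots+s^kb^{(k)}+o(s^k)$. A multi-index is $\alpha=(a_1,\dots,a_k)$ with $a_i\ge0$ integers; $|\alpha|=\sum_i a_i$, $w(\alpha)=\sum_i i\cdot a_i$, $\alpha!=a_1!\cdots a_k!$. For a $|\alpha|$-linear map $\Phi$, $\Phi[\vec b^{\,\alpha}]$ means $\Phi$ evaluated with $b^{(i)}$ inserted $a_i$ times for each $i$; similarly $\Phi[v,\vec b^{\,\alpha}]$ for a $(|\alpha|+1)$-linear map. $D^j_{q(t)}X_i$ is the $j$-th derivative of $X_i$ at $q(t)$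 in local coordinates (a symmetric $j$-linear map), with $D^0_{q(t)}X_i=X_i(q(t))$. Adapted coordinates. Choose local coordinates on $M$ along $q(t)$. For $m=1,2,\dots$ let $\Phi^{(m)}(t)=(\Phi^{(m)}_a(t))_{a=1,\dots,n}:(T_{q(t)}M)^{\times m}\to\mathbb{R}^n$, $t\in[0,T]$, be symmetric $m$-linear maps such that $\{\Phi^{(1)}_a(0)\}_{a}$ is a basis of $T^*_{q(0)}M$, the $\Phi^{(m)}(0)$ for $m\ge2$ are arbitrary, and, for all $b$, $$\dot\Phi^{(m)}(t)[\underbrace{b,\dots,b}_m]+\sum_{i=1}^l u_i(t)\Big\{\sum_{s=1}^m\binom ms\,\Phi^{(m-s+1)}(t)\big[D^s_{q(t)}X_i[\underbrace{b,\dots,b}_s],\underbrace{b,\dots,b}_{m-s}\big]\Big\}=0 .$$ The transformation of adapted coordinates of degree $k$ at time $t$ is $\Psi^{(k)}(t):T^k_{q(t)}M\ni(b^{(1)},\dots,b^{(k)})\mapsto(q^{(1)},\dots,q^{(k)})\in\mathbb{R}^{nk}$, $q^{(m)}=\sum_{w(\alpha)=m}\frac1{\alpha!}\Phi^{(|\alpha|)}(t)[\vec b^{\,\alpha}]$; it is a bijection for which $b^{(m)}$ depends only on $t,q^{(1)},\dots,q^{(m)}$. If $q([0,T])$ is not contained in one chart domain, the ODEs are understood on successive subintervals on which $q$ stays in one chart, and at a switching time the collection $(\Phi^{(m)})$ is re-expressed in the new chart so that all the maps $\Psi^{(k)}$ on $T^k_{q(t)}M$ are unchanged. The functions $y^{(m)}_i$.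 For $m=1,\dots,k$, $i=1,\dots,l$, $t\in[0,T]$, $$y_i^{(m)}(t,q^{(1)},\dots,q^{(m-1)}):=\sum_{\alpha,\beta,\ w(\alpha)+w(\beta)=m-1}\frac1{\alpha!}\cdot\frac1{\beta!}\,\Phi^{(|\alpha|+1)}(t)\Big[D^{|\beta|}_{q(t)}X_i[\vec b^{\,\beta}],\,\vec b^{\,\alpha}\Big]\in\mathbb{R}^n,\qquad \vec b=\Psi^{(k)}(t)^{-1}(q^{(1)},\dots,q^{(k)}),$$ which only involves $b^{(1)},\dots,b^{(m-1)}$, hence only $t,q^{(1)},\dots,q^{(m-1)}$. Trajectories are understood in the Carathéodory sense for $t\in[0,T]$. *)

(* Defs.v *)
From HB Require Import structures.
From mathcomp Require Import all_boot all_order all_algebra.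
From mathcomp Require Import all_classical all_reals all_analysis.
From mathcomp Require Import measurable_realfun.

Set Implicit Arguments.
Unset Strict Implicit.
Unset Printing Implicit Defensive.

Import Order.TTheory GRing.Theory Num.Theory.
Import numFieldNormedType.Exports.

Local Open Scope classical_set_scope.
Local Open Scope ring_scope.

(* [iter_derive [:: v_1; ...; v_j] f x] is D^j_x f [v_1, ..., v_j]. *)
Definition iter_derive (R : realType) (V W : normedModType R)
    (vs : seq V) (f : V -> W) : V -> W :=
  foldr (fun v g x => 'D_v g x) f vs.

Definition smooth_on (R : realType) (V W : normedModType R)
    (U : set V) (f : V -> W) : Prop :=
  forall vs x, U x -> differentiable (iter_derive vs f) x.

(* A smooth atlas on M modelled on R^n. The maps [chart_map c] and
   [chart_inv c] are total, but only their values on [chart_dom c] and on its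
   image are meaningful. *)
Record smooth_atlas (R : realType) (n : nat) (M : topologicalType) :=
  SmoothAtlas {
    chart : Type;
    chart_dom : chart -> set M;
    chart_map : chart -> M -> 'rV[R]_n;
    chart_inv : chart -> 'rV[R]_n -> M;
    atlas_cover : forall x, exists c, chart_dom c x;
    chart_dom_open : forall c, open (chart_dom c);
    chart_map_open : forall c, open (chart_map c @` chart_dom c);
    chart_mapK : forall c x, chart_dom c x -> chart_inv c (chart_map c x) = x;
    chart_map_continuous : forall c x,
      chart_dom c x -> {for x, continuous (chart_map c)};
    chart_inv_continuous : forall c v,
      (chart_map c @` chart_dom c) v -> {for v, continuous (chart_inv c)};
    transition_smooth : forall c d,
      smooth_on (chart_map c @` (chart_dom c `&` chart_dom d))
        (chart_map d \o chart_inv c)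
  }.

(* A smooth vector field is given by its components in all charts, subject to
   the transformation rule of tangent vectors. *)
Record vector_field (R : realType) (n : nat) (M : topologicalType)
    (A : smooth_atlas R n M) := VectorField {
  vf :> chart A -> 'rV[R]_n -> 'rV[R]_n;
  vf_smooth : forall c, smooth_on (chart_map c @` chart_dom c) (vf c);
  vf_change : forall c d x, chart_dom c x -> chart_dom d x ->
    'D_(vf c (chart_map c x)) (chart_map d \o chart_inv c) (chart_map c x)
      = vf d (chart_map d x)
}.

Definition pointwise_independent (R : realType) (n l : nat)
    (M : topologicalType) (A : smooth_atlas R n M)
    (X : 'I_l -> vector_field A) : Prop :=
  forall (c : chart A) x, chart_dom c x ->
    row_free (\matrix_(i < l) X i c (chart_map c x)).

Definition abs_continuous (R : realType) (V : normedModType R)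
    (a b : R) (f : R -> V) : Prop :=
  forall e : R, 0 < e -> exists2 d : R, 0 < d &
    forall s : seq (R * R),
      all (fun I => [&& a <= I.1, I.1 <= I.2 & I.2 <= b]) s ->
      pairwise (fun I J => (I.2 <= J.1) || (J.2 <= I.1)) s ->
      \sum_(I <- s) (I.2 - I.1) < d ->
      \sum_(I <- s) `|f I.2 - f I.1| < e.

Definition caratheodory_solution (R : realType) (V : normedModType R)
    (a b : R) (F : R -> V -> V) (f : R -> V) : Prop :=
  abs_continuous a b f /\
  {ae lebesgue_measure, forall t : R, t \in `[a, b] ->
     is_derive t 1 f (F t (f t))}.

Definition trajectory (R : realType) (n l : nat) (M : topologicalType)
    (A : smooth_atlas R n M) (X : 'I_l -> vector_field A) (T : R)
    (u : R -> 'rV[R]_l) (q : R -> M) : Prop :=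
  {within `[0, T], continuous q} /\
  forall (c : chart A) (a b : R), 0 <= a -> b <= T ->
    (forall t, t \in `[a, b] -> chart_dom c (q t)) ->
    caratheodory_solution a b
      (fun t x => \sum_(i < l) u t ord0 i *: X i c x) (chart_map c \o q).

(* Lebesgue (not only Borel) measurability. *)
Definition lebesgue_measurable_fun (R : realType) (D : set R) (f : R -> R)
    : Prop :=
  forall B : set R, measurable B ->
    completed_algebra_gen (@lebesgue_measure R) (D `&` f @^-1` B).

(* Controls are functions on R; only their restrictions to [0, T] matter. *)
Definition control_subspace (R : realType) (l : nat) (T : R)
    (Omega : set (R -> 'rV[R]_l)) : Prop :=
  [/\ forall u, Omega u -> forall i,
        lebesgue_measurable_fun `[0, T] (fun t => u t ord0 i),
      Omega (fun=> 0) &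
      forall (a : R) u v, Omega u -> Omega v ->
        Omega (fun t => a *: u t + v t)].

Definition endpoint_map (R : realType) (n l : nat) (M : topologicalType)
    (A : smooth_atlas R n M) (X : 'I_l -> vector_field A) (T : R) (q0 : M)
    (Omega : set (R -> 'rV[R]_l)) (End : R -> (R -> 'rV[R]_l) -> M) : Prop :=
  forall u, Omega u -> End 0 u = q0 /\ trajectory X T u (fun t => End t u).

(* s o Du; the index r : 'I_k stands for the superscript r + 1, here and for
   all k-tuples below. *)
Definition jet_variation (R : realType) (l k : nat)
    (Du : 'I_k -> R -> 'rV[R]_l) (s : R) : R -> 'rV[R]_l :=
  fun t => \sum_(r < k) s ^+ r.+1 *: Du r t.

(* A k-tuple (b^(1), ..., b^(k)) of vectors of R^n is the k x n matrix with
   rows b^(1), ..., b^(k). [jet_of c g b] says that in the chart c the k-jet at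
   s = 0 of the curve g exists and is b. Continuity of g at 0 keeps g(s) in the
   open set chart_dom c for s near 0. *)
Definition jet_of (R : realType) (n : nat) (M : topologicalType)
    (A : smooth_atlas R n M) (k : nat) (c : chart A) (g : R -> M)
    (b : 'M[R]_(k, n)) : Prop :=
  [/\ chart_dom c (g 0), {for 0, continuous g} &
      (fun s : R => chart_map c (g s) - chart_map c (g 0)
                    - \sum_(r < k) s ^+ r.+1 *: row r b)
        =o_ (0 : R) (fun s : R => s ^+ k)].

(* Multi-indices of length k. All those needed have weight at most k, so their
   entries are at most k. *)
Definition multi_index (k : nat) := {ffun 'I_k -> 'I_k.+1}.

Definition weight (k : nat) (al : multi_index k) : nat :=
  (\sum_(i < k) i.+1 * al i)%N.

Definition multi_fact (k : nat) (al : multi_index k) : nat :=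
  (\prod_(i < k) (al i)`!)%N.

(* The list of arguments b^alpha; its length is |alpha|. *)
Definition insert_powers (R : realType) (n k : nat) (b : 'M[R]_(k, n))
    (al : multi_index k) : seq 'rV[R]_n :=
  flatten [seq nseq (al i) (row i b) | i <- enum 'I_k].

(* A family of m-linear maps, m = 1, 2, ..., is encoded as one function on
   nonempty lists, whose restriction to lists of length m is the m-th map. *)
Definition symmetric_multilinear (R : realType) (n : nat)
    (F : seq 'rV[R]_n -> 'rV[R]_n) : Prop :=
  (forall vs ws, perm_eq vs ws -> F vs = F ws) /\
  (forall vs, linear (fun v => F (v :: vs))).

Definition adapted_transform (R : realType) (n k : nat)
    (F : seq 'rV[R]_n -> 'rV[R]_n) (b : 'M[R]_(k, n)) : 'M[R]_(k, n) :=
  \matrix_(m < k) \sum_(al : multi_index k | weight al == m.+1)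
     (multi_fact al)%:R^-1 *: F (insert_powers b al).

(* Adapted coordinates along q: on [tau j, tau (j + 1)], j < steps, the curve q
   stays in the domain of the chart kappa j, and Phi j t is the family
   (Phi^(m)(t))_m written in that chart. *)
Record adapted_coordinates (R : realType) (n l : nat) (M : topologicalType)
    (A : smooth_atlas R n M) (X : 'I_l -> vector_field A) (T : R)
    (u : R -> 'rV[R]_l) (q : R -> M) := AdaptedCoordinates {
  steps : nat;
  tau : nat -> R;
  kappa : nat -> chart A;
  Phi : nat -> R -> seq 'rV[R]_n -> 'rV[R]_n;
  tau_first : tau 0%N = 0;
  tau_last : tau steps = T;
  tau_lt : forall j, (j < steps)%N -> tau j < tau j.+1;
  kappa_dom : forall j, (j < steps)%N ->
    forall t, t \in `[tau j, tau j.+1] -> chart_dom (kappa j) (q t);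
  Phi_multilinear : forall j, (j < steps)%N ->
    forall t, t \in `[tau j, tau j.+1] -> symmetric_multilinear (Phi j t);
  Phi_basis : basis_of {: 'Hom('rV[R]_n, R^o)}
    [seq linfun (fun v : 'rV[R]_n => Phi 0%N 0 [:: v] ord0 a : R^o)
       | a <- enum 'I_n];
  Phi_ode : forall j, (j < steps)%N -> forall m, (0 < m)%N -> forall b,
    caratheodory_solution (tau j) (tau j.+1)
      (fun t _ => - \sum_(i < l) u t ord0 i *:
         \sum_(1 <= s < m.+1) 'C(m, s)%:R *:
           Phi j t (iter_derive (nseq s b) (X i (kappa j))
                      (chart_map (kappa j) (q t)) :: nseq (m - s) b))
      (fun t => Phi j t (nseq m b));
  Phi_switch : forall j, (j.+1 < steps)%N ->
    forall k (g : R -> M) (b b' : 'M[R]_(k, n)), g 0 = q (tau j.+1) ->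
    jet_of (kappa j) g b -> jet_of (kappa j.+1) g b' ->
    adapted_transform (Phi j (tau j.+1)) b
      = adapted_transform (Phi j.+1 (tau j.+1)) b'
}.

Section AdaptedSystem.
Variables (R : realType) (n l : nat) (M : topologicalType).
Variables (A : smooth_atlas R n M) (X : 'I_l -> vector_field A) (T : R).
Variables (u : R -> 'rV[R]_l) (q : R -> M).
Variable (C : adapted_coordinates X T u q).

(* The first subinterval containing t. At a switching time the two possible
   choices define the same maps on jets. *)
Definition piece (t : R) : nat :=
  find (fun j => t <= tau C j.+1) (iota 0 (steps C)).

Definition chart_at (t : R) : chart A := kappa C (piece t).

Definition Phi_at (t : R) : seq 'rV[R]_n -> 'rV[R]_n := Phi C (piece t) t.

Variable k : nat.

(* Psi^(k)(t), on k-jets at q(t) written in the chart [chart_at t]. *)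
Definition Psi (t : R) : 'M[R]_(k, n) -> 'M[R]_(k, n) :=
  adapted_transform (Phi_at t).

Definition Psi_inv (t : R) (Q : 'M[R]_(k, n)) : 'M[R]_(k, n) :=
  xget 0 [set b | Psi t b = Q].

(* y_i^(m) for 1 <= m <= k, as a function of t and Q = (q^(1), ..., q^(k)). *)
Definition y_field (i : 'I_l) (m : nat) (t : R) (Q : 'M[R]_(k, n)) : 'rV[R]_n :=
  let b := Psi_inv t Q in
  \sum_(ab : multi_index k * multi_index k
        | (weight ab.1 + weight ab.2 == m.-1)%N)
    ((multi_fact ab.1)%:R^-1 * (multi_fact ab.2)%:R^-1) *:
    Phi_at t (iter_derive (insert_powers b ab.2) (X i (chart_at t))
                (chart_map (chart_at t) (q t)) :: insert_powers b ab.1).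

(* Points of the extended space are pairs (t, (q^(1), ..., q^(k))). *)
Definition Z_field (i : 'I_l) (j : nat) (p : R * 'M[R]_(k, n))
    : R * 'M[R]_(k, n) :=
  (0, \matrix_(c < k) if (c < k - j)%N then 0
                      else y_field i (c.+1 - (k - j)) p.1 p.2).

(* The superscript of the r-th variation is r + 1, hence Z^(k - r). *)
Definition extended_system (Du : 'I_k -> R -> 'rV[R]_l)
    (t : R) (p : R * 'M[R]_(k, n)) : R * 'M[R]_(k, n) :=
  (1, 0) + \sum_(r < k) \sum_(i < l) Du r t ord0 i *: Z_field i (k - r) p.

End AdaptedSystem.

(* Main.v *)
(** On a time interval on which q stays in one chart, let v(s, t) be the
    difference of the perturbed and the unperturbed trajectory, and let
    E(s, t) = sum_(1 <= p <= k) 1/p! Phi^(p)(t)[v, ..., v]. The equations for the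
    maps Phi^(m) are such that in dE/dt all terms containing u cancel up to
    O(s^(k+1)), which leaves
      sum_i (s o Du)_i sum_(p, c) 1/(p! c!) Phi^(c+1)(t)[D^p X_i[v^p], v^c].
    Because of the factor s in s o Du, an expansion of v to order s^m gives by
    integration an expansion of E to order s^(m+1), and inverting Phi^(1) then
    gives an expansion of v to order s^(m+1). Starting from v = O(s), which is
    Gronwall's inequality, one finds that v has an expansion of order k. The
    coefficients of the expansion of E are the adapted coordinates of this jet,
    and by uniqueness of coefficients the integration step is the asserted
    differential equation. Where the chart changes, jets are transformed by
    Taylor's formula, and the maps Psi agree by assumption. *)

From HB Require Import structures.
Require Import Defs.
From mathcomp Require Import all_boot all_order all_algebra.
From mathcomp Require Import all_classical all_reals all_analysis.
From mathcomp Require Import measurable_realfun.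
From mathcomp Require Import ring lra zify.

Set Implicit Arguments.
Unset Strict Implicit.
Unset Printing Implicit Defensive.

Import Order.TTheory GRing.Theory Num.Theory.
Import numFieldNormedType.Exports.
Local Open Scope classical_set_scope.
Local Open Scope ring_scope.


(** * Absolutely continuous functions *)

(** Controls are merely measurable and all equations hold only almost everywhere, so the estimates
    do not come from integrating the dynamics. Instead one absolutely continuous [W], whose
    derivative [w] dominates the components of u and of all variations, serves as a clock: a
    velocity bounded by a multiple of [w] yields a bound on increments, uniformly in t. That such a
    [w] is integrable has to be earned from the independence of the fields. Three more obstacles
    shape the proof. The equation of Phi is given only for equal arguments b, off a null set
    depending on b; rational vectors and polarization produce one null set for all arguments. The
    perturbed curves are not known to stay in the chart of q, so Gronwall's estimate is proved
    together with a trapping argument, which uses that M is Hausdorff. Invertibility of Phi^(1) is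
    given only at time 0 and must be carried along by the equation and across each change of
    chart. *)

Lemma interval_induction (R : realType) (P : R -> R -> Prop) (a b : R) :
  a <= b ->
  (forall x y z, a <= x -> x <= y -> y <= z -> z <= b ->
     P x y -> P y z -> P x z) ->
  (forall t, a <= t -> t <= b -> exists2 d, 0 < d & forall x y,
     a <= x -> x <= t -> t <= y -> y <= b -> t - d < x -> y < t + d -> P x y) ->
  P a b.
Proof.
move=> ab Ptrans Ploc.
(* Real induction: the supremum of the times reached from [a] is itself reached, by the local
   hypothesis to its left, and would be passed by the one to its right. This replaces compactness of
   [a, b] in the local-to-global arguments below. *)
pose S : set R := [set t | a <= t <= b /\ P a t].
have Sa : S a.
  split; first by rewrite lexx ab.
  by have [d d0 H] := Ploc a (lexx a) ab; apply: H => //; lra.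
have hS : has_sup S.
  by split; [exists a | exists b => t [/andP[_ tb] _]].
have cub := sup_upper_bound hS.
set c := sup S in cub.
have ac : a <= c by exact: cub.
have cb : c <= b by apply: ge_sup; [exists a | move=> t [/andP[]]].
have [d d0 H] := Ploc c ac cb.
have [t [/andP[at_ tb] Pat] ct] := sup_adherent d0 hS.
have tc : t <= c by apply: cub; split => //; rewrite at_ tb.
have Pac : P a c by apply: (Ptrans a t c) => //; apply: H => //; lra.
have [->//|cltb] : b = c \/ c < b by move: cb; rewrite le_eqVlt => /orP[/eqP ->|]; auto.
exfalso.
pose y := Num.min b (c + d / 2).
have yb : y <= b by rewrite /y ge_min lexx.
have yd : y <= c + d / 2 by rewrite /y ge_min lexx orbT.
have cy : c < y by rewrite /y lt_min cltb /=; lra.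
have : S y.
  split; first by rewrite yb andbT; lra.
  apply: (Ptrans a c y) => //; first exact: ltW.
  by apply: H => //; lra.
by move/cub; rewrite leNgt cy.
Qed.

(** * Finite families of non-overlapping intervals *)

Section IntervalList.
Variable R : realType.
Implicit Type s : seq (R * R).

(** Half-open intervals make families that share endpoints genuinely disjoint, so measures and
    integrals add up exactly. *)
Definition interval_union s : set R := \big[setU/set0]_(I <- s) `]I.1, I.2]%classic.

Lemma measurable_interval_union s : measurable (interval_union s).
Proof. by apply: bigsetU_measurable => I _; exact: measurable_itv. Qed.

Lemma interval_union_cons_disjoint (I : R * R) s :
  all (fun J : R * R => (I.2 <= J.1) || (J.2 <= I.1)) s ->
  `]I.1, I.2]%classic `&` interval_union s = set0.
Proof.
rewrite /interval_union; elim: s => [|J s IH] /=; first by rewrite big_nil setI0.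
move=> /andP[IJ Is]; rewrite big_cons setIUr IH // setU0.
apply/seteqP; split => // x /=; rewrite !in_itv /= => -[/andP[a1 a2] /andP[a3 a4]].
by clear IH Is; case/orP: IJ => ?; lra.
Qed.

Lemma interval_union_additive (m : set R -> R) s :
  m set0 = 0 ->
  (forall A B, measurable A -> measurable B -> A `&` B = set0 ->
     m (A `|` B) = m A + m B) ->
  pairwise (fun I J : R * R => (I.2 <= J.1) || (J.2 <= I.1)) s ->
  m (interval_union s) = \sum_(I <- s) m `]I.1, I.2]%classic.
Proof.
move=> m0 mU; elim: s => [|I s IH] /=; first by rewrite /interval_union !big_nil m0.
move=> /andP[Is ps]; rewrite {1}/interval_union !big_cons mU.
- by rewrite -[in RHS]IH.
- exact: measurable_itv.
- exact: measurable_interval_union.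
- exact: interval_union_cons_disjoint.
Qed.

Lemma interval_union_length s :
  all (fun I => I.1 <= I.2) s ->
  pairwise (fun I J => (I.2 <= J.1) || (J.2 <= I.1)) s ->
  lebesgue_measure (interval_union s) = (\sum_(I <- s) (I.2 - I.1))%:E.
Proof.
move=> + ps; elim: s ps => [|I s IH] /=; first by rewrite /interval_union !big_nil measure0.
move=> /andP[Is ps] /andP[I12 als].
rewrite {1}/interval_union !big_cons measureU; last first.
- exact: interval_union_cons_disjoint.
- exact: measurable_interval_union.
- exact: measurable_itv.
rewrite EFinD -(IH ps als); congr (_ + _)%E.
transitivity (lebesgue_measure [set` `]I.1, I.2]]) => //.
rewrite lebesgue_measure_itv /= lte_fin; case: ltP => //= h.
by congr (_%:E); clear -h I12; lra.
Qed.

End IntervalList.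

Lemma is_derive_approx (R : realType) (V : normedModType R) (f : R -> V)
    (t : R) (d : V) :
  is_derive t 1 f d -> forall e : R, 0 < e -> exists2 r : R, 0 < r &
    forall z, `|z - t| < r -> `|f z - f t - (z - t) *: d| <= e * `|z - t|.
Proof.
move=> [df <-] e e0; have := df; rewrite /derivable => /cvgrPdist_le /(_ e e0).
rewrite /dnbhs /within /= => /nbhs_ballP[r /= r0 H]; exists r => // z ztr.
have [->|zt] := eqVneq z t; first by rewrite !subrr normr0 scale0r subr0 normr0 mulr0.
have zt0 : z - t != 0 by rewrite subr_eq0.
have := H (z - t); rewrite /ball /= sub0r normrN => /(_ ztr zt0).
rewrite /GRing.scale /= mulr1 subrK -/(GRing.scale _ _).
set D := (X in X - _) => h.
rewrite -[X in `|X - _|]scale1r -[X in X *: _](mulfV zt0) -scalerA -scalerBr normrZ mulrC.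
by rewrite ler_wpM2r // distrC.
Qed.

Lemma approx_is_derive (R : realType) (V : normedModType R) (f : R -> V)
    (t : R) (d : V) :
  (forall e : R, 0 < e -> exists2 r : R, 0 < r &
    forall z, `|z - t| < r -> `|f z - f t - (z - t) *: d| <= e * `|z - t|) ->
  is_derive t 1 f d.
Proof.
move=> H.
have C : h^-1 *: (f (h *: 1 + t) - f t) @[h --> (0:R)^'] --> d.
  apply/cvgrPdist_le => e e0; have [r r0 Hr] := H e e0.
  rewrite /dnbhs /within /=; apply/nbhs_ballP; exists r => //= h.
  rewrite /ball /= sub0r normrN => hr h0.
  have := Hr (h + t); rewrite addrK => /(_ hr).
  rewrite /GRing.scale /= mulr1 -/(GRing.scale _ _) => k.
  rewrite -[X in `|X - _|]scale1r -[X in X *: _](mulVf h0) -scalerA -scalerBr normrZ normfV.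
  by rewrite ler_pdivrMl ?normr_gt0 // distrC mulrC.
by split; [apply/cvg_ex; exists d | apply/cvg_lim].
Qed.

Lemma negligible_open_cover (R : realType) (N : set R) (d : R) :
  (@lebesgue_measure R).-negligible N -> 0 < d ->
  exists U : set R, [/\ open U, N `<=` U & (lebesgue_measure U < d%:E)%E].
Proof.
move=> /negligible_outer_measure N0 d0; have d20 : 0 < d / 2 by rewrite divr_gt0.
have [U [oU NU]] := outer_measure_open_le N d20.
rewrite N0 add0e => Ud; exists U; split => //; apply: le_lt_trans Ud _.
by rewrite lte_fin ltr_pdivrMr // ltr_pMr // ltr1n.
Qed.

(** * Comparison of increments *)

Section AbsContinuous.
Context {R : realType}.
Implicit Types (V W : normedModType R).

Lemma abs_continuousS V (a b a' b' : R) (f : R -> V) :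
  a <= a' -> b' <= b -> abs_continuous a b f -> abs_continuous a' b' f.
Proof.
move=> aa bb acf e e0; have [d d0 H] := acf e e0; exists d => // s als; apply: H.
apply: sub_all als => I /and3P[h1 h2 h3]; rewrite h2 (le_trans aa h1).
by rewrite (le_trans h3 bb).
Qed.

(* The variation of f and W over the bad set (a null set) is bounded through
   absolute continuity; off the bad set the increments compare pointwise. *)
Lemma abs_continuous_comparison V (a b : R) (f : R -> V) (W w : R -> R) :
  a <= b -> abs_continuous a b f -> abs_continuous a b W ->
  {ae lebesgue_measure, forall t : R, t \in `[a, b] ->
     exists f', [/\ is_derive t 1 f f', is_derive t 1 W (w t) & `|f'| <= w t]} ->
  `|f b - f a| <= W b - W a.
Proof.
move=> ab acf acW /= ae_fW.
pose B := [set t : R | t \in `[a, b] ->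
     exists f', [/\ is_derive t 1 f f', is_derive t 1 W (w t) & `|f'| <= w t]].
have Nneg : (@lebesgue_measure R).-negligible (~` B) by exact: ae_fW.
clear ae_fW.
(* The 2 pays for the two sums over bad intervals, one for [f] and one for [W], each less than
   [e]. *)
suff H : forall e, 0 < e -> `|f b - f a| <= W b - W a + e * (b - a + 2).
  apply/ler_addgt0Pr => e e0.
  have h : 0 < b - a + 2 by lra.
  have := H (e / (b - a + 2)) (divr_gt0 e0 h).
  by rewrite divfK // gt_eqF.
move=> e e0.
have [d1 d10 Hd1] := acf e e0.
have [d2 d20 Hd2] := acW e e0.
have d0 : 0 < Num.min d1 d2 by rewrite lt_min d10.
have [U [oU NU Ud]] := negligible_open_cover Nneg d0.
have mU : measurable U by exact: open_measurable.
(* [s] lists the intervals spent around bad points. They lie in the small open set [U], which bounds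
   their total length; concatenation of lists makes [P] transitive. *)
pose P x y := exists s : seq (R * R),
  [/\ all (fun I => [&& x <= I.1, I.1 <= I.2 & I.2 <= y]) s,
      pairwise (fun I J => (I.2 <= J.1) || (J.2 <= I.1)) s,
      forall I, I \in s -> `[I.1, I.2] `<=` U &
      `|f y - f x| <= W y - W x + e * (y - x) + \sum_(I <- s) `|f I.2 - f I.1|
         + \sum_(I <- s) `|W I.2 - W I.1|].
have [s [als ps sU Hs]] : P a b.
  apply: interval_induction => //.
  - move=> x y z ax xy yz zb [s [s1 s2 s3 s4]] [s' [s'1 s'2 s'3 s'4]].
    exists (s ++ s'); split.
    + rewrite all_cat; apply/andP; split.
        by apply: sub_all s1 => I /and3P[-> -> h] /=; exact: le_trans yz.
      by apply: sub_all s'1 => I /and3P[h -> ->] /=; rewrite andbT; exact: le_trans xy _.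
    + rewrite pairwise_cat s2 s'2 !andbT; apply/allrelP => I J Is Js /=.
      have /and3P[_ _ h] := allP s1 _ Is; have /and3P[h' _ _] := allP s'1 _ Js.
      by rewrite (le_trans h h').
    + by move=> I; rewrite mem_cat => /orP[/s3|/s'3].
    + rewrite !big_cat /=.
      have -> : f z - f x = (f z - f y) + (f y - f x) by rewrite addrA subrK.
      apply: le_trans (ler_normD _ _) _.
      by move: s4 s'4; clear; move=> s4 s'4; lra.
  - move=> t at_ tb; have [Nt|Nt] := pselect ((~` B) t).
      have /nbhs_ballP[r /= r0 rU] : nbhs t U by apply: open_nbhs_nbhs; split => //; exact: NU.
      exists r => // x y ax xt ty yb tx ytr; exists [:: (x, y)]; split => //=.
      + by rewrite !lexx (le_trans xt ty).
      + move=> I; rewrite inE => /eqP -> /= z; rewrite /= in_itv /= => /andP[xz zy].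
        by apply: rU; rewrite /ball /= ltr_norml; apply/andP; split; lra.
      + rewrite !big_seq1 /=.
        have : 0 <= e * (y - x) by apply: mulr_ge0; [exact: ltW | rewrite subr_ge0 (le_trans xt ty)].
        have := ler_norm (- (W y - W x)); rewrite normrN.
        by clear; lra.
    have [f' [df dW fw]] : exists f', [/\ is_derive t 1 f f', is_derive t 1 W (w t) & `|f'| <= w t].
      apply: contrapT => h; apply: Nt => /= k; apply: h; apply: k.
      by rewrite in_itv /= at_.
    have e20 : 0 < e / 2 by rewrite divr_gt0.
    have [r1 r10 h1] := is_derive_approx df e20.
    have [r2 r20 h2] := is_derive_approx dW e20.
    exists (Num.min r1 r2); first by rewrite lt_min r10.
    move=> x y ax xt ty yb; rewrite ltrBlDr -ltrBlDl => tx.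
    rewrite -ltrBlDl => yt; exists [::]; split => //=; rewrite !big_nil !addr0.
    move: tx yt; rewrite !lt_min => /andP[tx1 tx2] /andP[yt1 yt2].
    have nx : `|x - t| = t - x by rewrite distrC ger0_norm // subr_ge0.
    have ny : `|y - t| = y - t by rewrite ger0_norm // subr_ge0.
    have a1 := h1 x; rewrite nx in a1; have {}a1 := a1 tx1.
    have a2 := h1 y; rewrite ny in a2; have {}a2 := a2 yt1.
    have b1 := h2 x; rewrite nx in b1; have {}b1 := b1 tx2.
    have b2 := h2 y; rewrite ny in b2; have {}b2 := b2 yt2.
    move: b1 b2; rewrite /GRing.scale /= !ler_norml => /andP[b1 b1'] /andP[b2 b2'].
    have -> : f y - f x = (f y - f t - (y - t) *: f') - (f x - f t - (x - t) *: f') + (y - x) *: f'.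
      have -> : (y - x) *: f' = (y - t) *: f' - (x - t) *: f'.
        by rewrite -scalerBl opprB addrA subrK.
      rewrite [RHS]addrAC [X in _ = X - _]addrA subrK.
      by rewrite [- (_ - (_ - t) *: f')]opprB addrA subrK opprB addrA subrK.
    apply: le_trans (ler_normD _ _) _.
    have c1 : `|(y - x) *: f'| <= (y - x) * w t.
      by rewrite normrZ ger0_norm; [apply: ler_wpM2l => // | ]; rewrite subr_ge0 (le_trans xt ty).
    have := ler_normB (f y - f t - (y - t) *: f') (f x - f t - (x - t) *: f').
    move: a1 a2 b1 b1' b2 b2' c1; clear; lra.
apply: (le_trans Hs).
have ls : \sum_(I <- s) (I.2 - I.1) < Num.min d1 d2.
  rewrite -lte_fin -interval_union_length //; last first.
    by apply: sub_all als => I /and3P[].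
  apply: le_lt_trans Ud; apply: le_measure; rewrite ?inE //; first exact: measurable_interval_union.
  rewrite /interval_union; elim: s sU {als ps Hs} => [|I s IH] sU; first by rewrite big_nil.
  rewrite big_cons subUset; split; last by apply: IH => J Js; apply: sU; rewrite inE Js orbT.
  apply: subset_trans (sU I _); last by rewrite inE eqxx.
  by apply: subset_itvr; rewrite bnd_simp.
move: ls; rewrite lt_min => /andP[l1 l2].
have := Hd1 s als ps l1; have := Hd2 s als ps l2.
by clear; lra.
Qed.

End AbsContinuous.

(** * Closure properties of absolute continuity *)

Section AbsContinuousAlgebra.
Context {R : realType}.
Implicit Types (V W : normedModType R) (a b : R).

Lemma abs_continuous_modulus V a b (f : R -> V) : abs_continuous a b f ->
  forall e, 0 < e -> exists2 d, 0 < d & forall x y,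
    a <= x -> x <= b -> a <= y -> y <= b -> `|y - x| < d -> `|f y - f x| < e.
Proof.
move=> acf e e0; have [d d0 H] := acf e e0; exists d => //.
have K x y : a <= x -> x <= y -> y <= b -> y - x < d -> `|f y - f x| < e.
  move=> ax xy yb xyd.
  by have := H [:: (x, y)]; rewrite !big_seq1 /= ax xy yb /=; exact.
move=> x y ax xb ay yb; have [xy|/ltW yx] := leP x y.
  by rewrite ger0_norm ?subr_ge0 //; exact: K.
by rewrite distrC [`|f _ - _|]distrC ger0_norm ?subr_ge0 //; exact: K.
Qed.

Lemma abs_continuous_bounded V a b (f : R -> V) : abs_continuous a b f ->
  exists2 B, 0 <= B & forall t, a <= t -> t <= b -> `|f t| <= B.
Proof.
move=> acf; have [ab|ba] := leP a b; last first.
  by exists 0 => // t at_ /(le_trans at_); rewrite leNgt ba.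
have [d d0 H] := abs_continuous_modulus acf ltr01.
apply: (@interval_induction R (fun x y => exists2 B, 0 <= B &
   forall t, x <= t -> t <= y -> `|f t| <= B)) => //.
- move=> x y z ax xy yz zb [B1 B10 h1] [B2 B20 h2].
  exists (B1 + B2); first exact: addr_ge0.
  move=> t xt tz; have [ty|/ltW yt] := leP t y.
    by apply: le_trans (h1 t xt ty) _; rewrite lerDl.
  by apply: le_trans (h2 t yt tz) _; rewrite lerDr.
- move=> t at_ tb; exists d => // x y ax xt ty yb tx yd.
  exists (1 + `|f t|) => [|z xz zy]; first by rewrite addr_ge0.
  have zt : `|f z - f t| < 1.
    apply: H => //; first exact: le_trans xz. exact: le_trans yb.
    by rewrite ltr_norml; apply/andP; split; lra.
  by rewrite -(subrK (f t) (f z)) (le_trans (ler_normD _ _)) // lerD2r ltW.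
Qed.

(** The common source of the closure properties: only increments matter, and two dominating
    functions are enough for sums, products and gluing. *)
Lemma abs_continuous_dominated (V V1 V2 : normedModType R) a b (g : R -> V)
    (f1 : R -> V1) (f2 : R -> V2) (C : R) :
  abs_continuous a b f1 -> abs_continuous a b f2 ->
  (forall x y, a <= x -> x <= y -> y <= b ->
     `|g y - g x| <= C * (`|f1 y - f1 x| + `|f2 y - f2 x|)) ->
  abs_continuous a b g.
Proof.
move=> ac1 ac2 gf e e0.
have C0 : 0 < `|C| + 1 by apply: ltr_wpDl.
have e20 : 0 < e / (`|C| + 1) / 2 by rewrite !divr_gt0.
have [d1 d10 H1] := ac1 _ e20; have [d2 d20 H2] := ac2 _ e20.
exists (Num.min d1 d2) => [|s als ps]; first by rewrite lt_min d10.
rewrite lt_min => /andP[/(H1 s als ps) k1 /(H2 s als ps) k2].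
apply: (@le_lt_trans _ _ ((`|C| + 1) * (\sum_(I <- s) `|f1 I.2 - f1 I.1| +
     \sum_(I <- s) `|f2 I.2 - f2 I.1|))).
  rewrite -big_split /= mulr_sumr big_seq [leRHS]big_seq; apply: ler_sum => I Is.
  have /and3P[h1 h2 h3] := allP als _ Is.
  apply: le_trans (gf _ _ h1 h2 h3) _; apply: ler_wpM2r; first exact: addr_ge0.
  by have := ler_norm C; lra.
rewrite mulrC -ltr_pdivlMr //; move: k1 k2; set z := e / _; clear; lra.
Qed.

Lemma abs_continuous_lipschitz V W a b (f : R -> V) (g : R -> W) (C : R) :
  abs_continuous a b f ->
  (forall x y, a <= x -> x <= y -> y <= b -> `|g y - g x| <= C * `|f y - f x|) ->
  abs_continuous a b g.
Proof.
move=> acf gf; apply: (@abs_continuous_dominated W V V a b g f f `|C|) => //.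
move=> x y ax xy yb; apply: le_trans (gf x y ax xy yb) _.
apply: (@le_trans _ _ (`|C| * `|f y - f x|)); first by rewrite ler_wpM2r ?ler_norm.
by rewrite mulrDr lerDl mulr_ge0.
Qed.

Lemma abs_continuous_id a b : abs_continuous a b (id : R -> R).
Proof.
move=> e e0; exists e => // s als ps; apply: le_lt_trans.
rewrite big_seq [leRHS]big_seq; apply: ler_sum => I Is.
by have /and3P[_ h _] := allP als _ Is; rewrite ger0_norm // subr_ge0.
Qed.

Lemma abs_continuous_cst V a b (c : V) : abs_continuous a b (fun=> c : V).
Proof.
apply: (@abs_continuous_lipschitz _ _ a b _ _ 0 (@abs_continuous_id a b)) => x y _ _ _.
by rewrite subrr normr0 mul0r.
Qed.

Lemma abs_continuousD V a b (f g : R -> V) :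
  abs_continuous a b f -> abs_continuous a b g ->
  abs_continuous a b (fun t => f t + g t).
Proof.
move=> acf acg; apply: (abs_continuous_dominated (C := 1) acf acg) => x y _ _ _.
by rewrite mul1r opprD addrACA ler_normD.
Qed.

Lemma abs_continuousZ V a b (c : R) (f : R -> V) :
  abs_continuous a b f -> abs_continuous a b (fun t => c *: f t).
Proof.
move=> acf; apply: (abs_continuous_lipschitz (C := `|c|) acf) => x y _ _ _.
by rewrite -scalerBr normrZ.
Qed.

Lemma abs_continuousB V a b (f g : R -> V) :
  abs_continuous a b f -> abs_continuous a b g ->
  abs_continuous a b (fun t => f t - g t).
Proof.
move=> acf acg; apply: (abs_continuous_dominated (C := 1) acf acg) => x y _ _ _.
by rewrite mul1r opprD opprK addrACA [- g y + _]addrC -[g x - g y]opprB ler_normB.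
Qed.

Lemma abs_continuous_eq V a b (f g : R -> V) :
  (forall t, a <= t -> t <= b -> f t = g t) ->
  abs_continuous a b f -> abs_continuous a b g.
Proof.
move=> fg acf; apply: (abs_continuous_lipschitz (C := 1) acf) => x y ax xy yb.
by rewrite mul1r !fg ?(le_trans ax xy) ?(le_trans xy yb).
Qed.

Lemma abs_continuous_sum V a b (I : Type) (r : seq I) (P : pred I) (f : I -> R -> V) :
  (forall i, P i -> abs_continuous a b (f i)) ->
  abs_continuous a b (fun t => \sum_(i <- r | P i) f i t).
Proof.
move=> H; elim: r => [|i r IH].
  apply: (@abs_continuous_eq V a b (fun=> 0)); last exact: abs_continuous_cst.
  by move=> t _ _; rewrite big_nil.
case Pi : (P i); last first.
  by apply: (abs_continuous_eq _ IH) => t _ _; rewrite big_cons Pi.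
apply: (abs_continuous_eq _ (abs_continuousD (H i Pi) IH)) => t _ _.
by rewrite big_cons Pi.
Qed.

Lemma abs_continuousM V a b (h : R -> R) (f : R -> V) :
  abs_continuous a b h -> abs_continuous a b f ->
  abs_continuous a b (fun t => h t *: f t).
Proof.
move=> ach acf.
have [B1 B10 h1] := abs_continuous_bounded ach.
have [B2 B20 h2] := abs_continuous_bounded acf.
apply: (abs_continuous_dominated (C := B1 + B2) ach acf) => x y ax xy yb.
have -> : h y *: f y - h x *: f x = (h y - h x) *: f x + h y *: (f y - f x).
  by rewrite scalerBl scalerBr [RHS]addrC addrA subrK.
apply: le_trans (ler_normD _ _) _; rewrite !normrZ mulrDr; apply: lerD.
  rewrite mulrC ler_wpM2r // (le_trans (h2 x ax _)) ?lerDr //; exact: le_trans yb.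
by rewrite ler_wpM2r // (le_trans (h1 y _ yb)) ?lerDl // (le_trans ax).
Qed.

Lemma abs_continuous_glue V a b c (f : R -> V) :
  a <= b -> b <= c ->
  abs_continuous a b f -> abs_continuous b c f -> abs_continuous a c f.
Proof.
move=> ab bc ac1 ac2.
(* Clamping at [b] splits each increment of [f] into one over [a, b] and one over [b, c], so no
   interval of a list has to be cut at [b]. *)
pose p1 (t : R) := Num.min t b; pose p2 (t : R) := Num.max t b.
have acp1 : abs_continuous a c (fun t => f (p1 t)).
  move=> e e0; have [d d0 H] := ac1 e e0; exists d => // s als ps sd.
  have := H [seq (p1 i.1, p1 i.2) | i <- s]; rewrite !big_map /=; apply.
  - rewrite all_map; apply: sub_all als => I /and3P[h1 h2 h3] /=.
    rewrite /p1; case: (leP I.1 b); case: (leP I.2 b) => k1 k2; apply/and3P;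
      split; move: ab bc h1 h2 h3 k1 k2; clear; lra.
  - rewrite pairwise_map; move: ps; apply: sub_pairwise => I J /=; rewrite /p1.
    by case/orP => h; apply/orP; [left|right]; apply: le_min2 => //.
  - apply: le_lt_trans sd; rewrite big_seq [leRHS]big_seq; apply: ler_sum => I Is.
    have /and3P[h1 h2 h3] := allP als _ Is.
    by rewrite /p1; case: (leP I.1 b); case: (leP I.2 b); move: h2; clear; lra.
have acp2 : abs_continuous a c (fun t => f (p2 t)).
  move=> e e0; have [d d0 H] := ac2 e e0; exists d => // s als ps sd.
  have := H [seq (p2 i.1, p2 i.2) | i <- s]; rewrite !big_map /=; apply.
  - rewrite all_map; apply: sub_all als => I /and3P[h1 h2 h3] /=.
    rewrite /p2; case: (leP I.1 b); case: (leP I.2 b) => k1 k2; apply/and3P;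
      split; move: ab bc h1 h2 h3 k1 k2; clear; lra.
  - rewrite pairwise_map; move: ps; apply: sub_pairwise => I J /=; rewrite /p2.
    by case/orP => h; apply/orP; [left|right]; apply: le_max2 => //.
  - apply: le_lt_trans sd; rewrite big_seq [leRHS]big_seq; apply: ler_sum => I Is.
    have /and3P[h1 h2 h3] := allP als _ Is.
    by rewrite /p2; case: (leP I.1 b); case: (leP I.2 b); move: h2; clear; lra.
apply: (abs_continuous_dominated (C := 1) acp1 acp2) => x y _ xy _.
rewrite mul1r; apply: le_trans (ler_normD _ _).
rewrite le_eqVlt; apply/orP; left; apply/eqP; congr `|_|.
rewrite /p1 /p2; case: (leP x b); case: (leP y b) => h1 h2.
- by rewrite subrr addr0.
- by rewrite [RHS]addrC addrA subrK.
- by move: (lt_le_trans h2 xy); rewrite ltNge h1.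
- by rewrite subrr add0r.
Qed.

Lemma abs_continuous_mx m n a b (f : R -> 'M[R]_(m, n)) :
  (forall i j, abs_continuous a b (fun t => f t i j)) -> abs_continuous a b f.
Proof.
move=> H.
have : abs_continuous a b (fun t => \sum_i \sum_j f t i j *: delta_mx i j : 'M[R]_(m, n)).
  apply: abs_continuous_sum => i _; apply: abs_continuous_sum => j _.
  by apply: abs_continuousM => //; exact: abs_continuous_cst.
by apply: abs_continuous_eq => t _ _; rewrite -matrix_sum_delta.
Qed.

Lemma abs_continuous_coord m n a b (f : R -> 'M[R]_(m, n)) i j :
  abs_continuous a b f -> abs_continuous a b (fun t => f t i j).
Proof.
move=> acf; apply: (abs_continuous_lipschitz (C := 1) acf) => x y _ _ _.
rewrite mul1r; have -> : f y i j - f x i j = (f y - f x) i j by rewrite !mxE.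
by rewrite [leRHS]mx_normrE; apply/bigmax_geP; right; exists (i, j).
Qed.

End AbsContinuousAlgebra.

Lemma lebesgue_ae_filter (R : realType) :
  Filter (nbhs (almost_everywhere (@lebesgue_measure R))).
Proof. exact: (ae_filter_ringOfSetsType (@lebesgue_measure R)). Qed.
#[global] Hint Extern 0 (Filter (nbhs (almost_everywhere _))) =>
  (apply: lebesgue_ae_filter) : typeclass_instances.

(** * Integrability up to null sets, and primitives *)

Section AeIntegrable.
Context {R : realType}.
Local Notation mu := (@lebesgue_measure R).
Implicit Types (a b : R) (v : R -> R).

(** Stated through an integrable representative on the whole line, because [v] itself may be only
    Lebesgue measurable, or a derivative that exists only almost everywhere. *)
Definition ae_integrable v a b := exists2 F : R -> R,
  mu.-integrable [set: R] (EFin \o F) &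
  {ae mu, forall t : R, t \in `[a, b] -> v t = F t}.

(** Lebesgue's differentiation theorem gives the derivative; absolute continuity of the integral,
    applied to the union of a list of intervals, gives the modulus. *)
Lemma integrable_primitive (F : R -> R) : mu.-integrable [set: R] (EFin \o F) ->
  exists2 K : R -> R, forall a b, abs_continuous a b K &
    {ae mu, forall t : R, is_derive t 1 K (F t)}.
Proof.
move=> iF; exists (fun y => \int[mu]_(t in `]-oo, y]) F t)%R; last first.
  have h1 y : mu.-integrable `]-oo, y] (EFin \o F) by exact: integrableS iF.
  have h2 : locally_integrable [set: R] F by apply: open_integrable_locally => //; exact: openT.
  have := FTC1Ny h1 h2; apply: filterS.
  by move=> t [d <-]; rewrite derive1E; exact: derivableP.
move=> a b e e0; have [d [d0 H]] := integral_normr_continuous iF e0.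
exists d => // s als ps sd.
have als' : all (fun I => I.1 <= I.2) s by apply: sub_all als => I /and3P[].
have iN A : measurable A -> mu.-integrable A (EFin \o (fun x => `|F x|)).
  by move=> mA; apply: (@integrableS _ _ _ mu setT A _ measurableT mA) => //; exact: integrable_norm iF.
have mlt : (lebesgue_measure (interval_union s) < d%:E)%E.
  by rewrite interval_union_length // lte_fin.
have := H _ (measurable_interval_union s) mlt.
pose m (A : set R) := (\int[mu]_(x in A) `|F x|)%R.
have -> : (\int[mu]_(x in interval_union s) `|F x|)%R = \sum_(I <- s) m `]I.1, I.2]%classic.
  apply: (interval_union_additive (m := m)) => //; first exact: Rintegral_set0.
  move=> A B mA mB AB; apply: Rintegral_setU => //; last by apply/disj_setPS; rewrite AB.
  by apply: iN; exact: measurableU.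
apply: le_lt_trans; rewrite big_seq [leRHS]big_seq; apply: ler_sum => I Is.
rewrite Rintegral_itvB //.
- by rewrite /m; apply: le_normr_Rintegral => //; exact: integrableS iF.
- exact: integrableS iF.
- by rewrite bnd_simp; have /and3P[] := allP als _ Is.
Qed.

Lemma ae_integrable_primitive v a b : ae_integrable v a b ->
  exists K : R -> R, [/\ abs_continuous a b K, K a = 0 &
    {ae mu, forall t : R, t \in `[a, b] -> is_derive t 1 K (v t)}].
Proof.
move=> [F iF vF]; have [K acK dK] := integrable_primitive iF.
exists (fun t => K t - K a); split; last 1 first.
- apply: filterS2 vF dK => t vF dK tab; rewrite vF // -[F t]subr0.
  exact: is_deriveB.
- by apply: abs_continuousB; [exact: acK | exact: abs_continuous_cst].
- by rewrite subrr.
Qed.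

Lemma ae_integrable_norm v a b : ae_integrable v a b ->
  ae_integrable (fun t => `|v t|) a b.
Proof.
move=> [F iF vF]; exists (fun t => `|F t|); first exact: (integrable_norm iF).
by apply: filterS vF => t h /h ->.
Qed.

Lemma ae_integrableD v w a b : ae_integrable v a b -> ae_integrable w a b ->
  ae_integrable (fun t => v t + w t) a b.
Proof.
move=> [F iF vF] [G iG wG]; exists (fun t => F t + G t).
  exact: (integrableD _ iF iG).
by apply: filterS2 vF wG => t h1 h2 tab; rewrite h1 ?h2.
Qed.

Lemma ae_integrable_sum (I : Type) (r : seq I) (P : pred I) (v : I -> R -> R) a b :
  (forall i, P i -> ae_integrable (v i) a b) ->
  ae_integrable (fun t => \sum_(i <- r | P i) v i t) a b.
Proof.
move=> H; elim: r => [|i r [F iF vF]].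
  by exists (fun=> 0); [exact: integrable0 | apply: aeW => t _; rewrite big_nil].
case Pi : (P i); last by exists F => //; apply: filterS vF => t h /h; rewrite big_cons Pi.
have [G iG wG] := ae_integrableD (H i Pi) (ex_intro2 _ _ F iF vF).
by exists G => //; apply: filterS wG => t h /h; rewrite big_cons Pi.
Qed.

Lemma ae_integrable_eq v w a b :
  {ae mu, forall t : R, t \in `[a, b] -> v t = w t} ->
  ae_integrable v a b -> ae_integrable w a b.
Proof.
move=> vw [F iF vF]; exists F => //.
by apply: filterS2 vw vF => t h1 h2 tab; rewrite -h1 ?h2.
Qed.

Lemma integrable_restrict_itv (H : R -> R) (i : interval R) :
  mu.-integrable [set` i] (EFin \o H) ->
  mu.-integrable [set: R] (EFin \o (H \_ [set` i])).
Proof.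
move=> iH; rewrite -restrict_EFin.
have mi : measurable ([set` i] : set R) by exact: measurable_itv.
by have := @integrable_mkcond _ _ _ mu _ (EFin \o H) mi; move=> -[+ _]; exact.
Qed.

Lemma integrable_itv (H : R -> R) (i : interval R) :
  mu.-integrable [set: R] (EFin \o H) -> mu.-integrable [set` i] (EFin \o H).
Proof. exact: integrableS. Qed.

Lemma ae_integrable_glue v a b c : ae_integrable v a b -> ae_integrable v b c ->
  ae_integrable v a c.
Proof.
move=> [F iF vF] [G iG vG].
exists (fun t => (F \_ `[a, b]) t + (G \_ `]b, c]) t).
  exact: (integrableD _ (integrable_restrict_itv (integrable_itv _ iF)) (integrable_restrict_itv (integrable_itv _ iG))).
apply: filterS2 vF vG => t h1 h2; rewrite in_itv /= => /andP[at_ tc].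
rewrite !patchE !mem_setE !in_itv /= at_ tc andbT.
have [tb|bt] := leP t b; first by rewrite addr0 h1 // in_itv /= at_.
by rewrite add0r h2 // in_itv /= ltW.
Qed.

Lemma ae_integrable_local v a b : a <= b ->
  (forall t, a <= t -> t <= b -> exists2 d, 0 < d & forall x y,
     a <= x -> x <= t -> t <= y -> y <= b -> t - d < x -> y < t + d ->
     ae_integrable v x y) -> ae_integrable v a b.
Proof.
move=> ab H; apply: (@interval_induction R (ae_integrable v)) => //.
by move=> x y z _ _ _ _; exact: ae_integrable_glue.
Qed.

Lemma ae_integrable_mul (h : R -> R) v a b : {within `[a, b], continuous h} ->
  ae_integrable v a b -> ae_integrable (fun t => h t * v t) a b.
Proof.
move=> ch [F iF vF].
exists (fun t => ((fun t => h t * F t) \_ `[a, b]) t); last first.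
  by apply: filterS vF => t vF tab; rewrite patchE mem_setE tab vF.
apply: integrable_restrict_itv.
have mh : measurable_fun `[a, b] h.
  by apply: subspace_continuous_measurable_fun => //.
have bh : [bounded h x | x in `[a, b]].
  have : compact (h @` `[a, b]) by apply: continuous_compact => //; exact: segment_compact.
  move=> /compact_bounded [M [Mr HM]]; exists M; split => // N MN x xab.
  by apply: HM => //; exists x.
have := @integrableMr _ _ _ mu `[a, b]%classic (measurable_itv _) h (EFin \o F) mh bh.
by apply; exact: integrable_itv.
Qed.

End AeIntegrable.

(** * Integrability of derivatives of absolutely continuous functions *)

Section DerivativeIntegrable.
Context {R : realType}.
Local Notation mu := (@lebesgue_measure R).
Implicit Types (x y : R) (f v : R -> R).

Definition grid x y n (i : nat) : R := x + i%:R * ((y - x) / n.+1%:R).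

Definition grid_slope f x y n (t : R) : R :=
  \sum_(i < n.+1) (f (grid x y n i.+1) - f (grid x y n i))
     / ((y - x) / n.+1%:R) * \1_`[grid x y n i, grid x y n i.+1[ t.

Lemma gridS x y n i : grid x y n i.+1 - grid x y n i = (y - x) / n.+1%:R.
Proof. by rewrite /grid -(natr1 i) mulrDl mul1r addrA [X in X - _]addrC addrK. Qed.

Lemma grid0 x y n : grid x y n 0 = x.
Proof. by rewrite /grid mul0r addr0. Qed.

Lemma gridn x y n : grid x y n n.+1 = y.
Proof. by rewrite /grid mulrCA mulfV ?mulr1 ?pnatr_eq0 // addrC subrK. Qed.

Lemma grid_le x y n i j : x <= y -> (i <= j)%N -> grid x y n i <= grid x y n j.
Proof.
move=> xy ij; rewrite /grid lerD2l ler_wpM2r ?ler_nat // divr_ge0 //.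
by rewrite subr_ge0.
Qed.

Lemma grid_find x y n t : x <= t -> t < y ->
  exists2 i : 'I_n.+1, grid x y n i <= t & t < grid x y n i.+1.
Proof.
move=> xt ty.
have : exists m, t < grid x y n m by exists n.+1; rewrite gridn.
move=> /ex_minnP[[|m]]; first by rewrite grid0 ltNge xt.
move=> tm mmin.
have mn : (m < n.+1)%N by apply: mmin; rewrite gridn.
exists (Ordinal mn) => //=; rewrite leNgt; apply/negP => /mmin.
by rewrite ltnn.
Qed.

Lemma grid_slopeE f x y n t (i : 'I_n.+1) : x < y ->
  grid x y n i <= t -> t < grid x y n i.+1 ->
  grid_slope f x y n t =
    (f (grid x y n i.+1) - f (grid x y n i)) / ((y - x) / n.+1%:R).
Proof.
move=> xy it ti; rewrite /grid_slope (bigD1 i) //= big1 ?addr0 => [|j ji].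
  by rewrite indicE mem_setE in_itv /= it ti mulr1.
rewrite indicE mem_setE in_itv /=.
have [ij|ij] := ltnP j i.
  have := grid_le n (ltW xy) ij => h.
  by rewrite [t < _]ltNge (le_trans h it) andbF mulr0.
have {}ij : (i < j)%N by rewrite ltn_neqAle ij andbT eq_sym; exact: ji.
have := grid_le n (ltW xy) ij => h.
by rewrite [_ <= t]leNgt (lt_le_trans ti h) mulr0.
Qed.

(** The cell [p, q[ containing t satisfies (q - t) + (t - p) = q - p, so the first-order errors at
    its two ends add up to at most [e] times its length. *)
Lemma grid_slope_cvg f x y (t d : R) : x < y -> x <= t -> t < y ->
  is_derive t 1 f d -> grid_slope f x y n t @[n --> \oo] --> d.
Proof.
move=> xy xt ty df; apply/cvgrPdist_le => e e0.
have [r r0 Hr] := is_derive_approx df e0.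
have yx0 : 0 < y - x by rewrite subr_gt0.
near=> n.
have hr : (y - x) / n.+1%:R < r.
  rewrite ltr_pdivrMr // mulrC -ltr_pdivrMr //.
  near: n; exists (Num.bound ((y - x) / r)) => // m /= bm.
  apply: (lt_le_trans (archi_boundP _)); first by rewrite divr_ge0 // ltW.
  by rewrite ler_nat (leq_trans bm).
have [i it ti] := grid_find n xt ty.
have h0 : 0 < (y - x) / n.+1%:R by rewrite divr_gt0.
rewrite (grid_slopeE f xy it ti).
have gS := gridS x y n i; move: hr h0 gS.
move: (grid x y n i) (grid x y n i.+1) it ti => p q it ti; set h := _ / _ => hr h0 gS.
have := Hr q; rewrite ger0_norm; last by rewrite subr_ge0 ltW.
move=> /(_ _) h1; have {}h1 := h1 (ltac:(lra)).
have := Hr p; rewrite distrC ger0_norm; last by rewrite subr_ge0.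
move=> /(_ _) h2; have {}h2 := h2 (ltac:(lra)).
rewrite distrC; have -> : (f q - f p) / h - d = (f q - f p - h * d) / h.
  by rewrite [RHS]mulrBl [h * d / h]mulrAC divff ?mul1r // gt_eqF.
rewrite normrM normfV (gtr0_norm h0) ler_pdivrMr //.
have -> : f q - f p - h * d = (f q - f t - (q - t) *: d) - (f p - f t - (p - t) *: d).
  by rewrite /GRing.scale /= -gS; ring.
apply: le_trans (ler_normB _ _) _.
have := lerD h1 h2; rewrite -mulrDr => /le_trans; apply.
by apply: ler_wpM2l; [exact: ltW | rewrite addrA subrK gS].
Unshelve. all: by end_near. Qed.

Lemma grid_slope_measurable f x y n D : measurable_fun D (grid_slope f x y n).
Proof.
by apply: measurable_sum => i; apply: measurable_funM.
Qed.

Lemma grid_slope_integral f x y n : x < y ->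
  (\int[mu]_(t in `[x, y]) (`|grid_slope f x y n t|)%:E <=
   (\sum_(i < n.+1) `|f (grid x y n i.+1) - f (grid x y n i)|)%:E)%E.
Proof.
move=> xy.
have h0 : 0 < (y - x) / n.+1%:R by rewrite divr_gt0 // subr_gt0.
pose c (i : 'I_n.+1) : R := `|f (grid x y n i.+1) - f (grid x y n i)| / ((y - x) / n.+1%:R).
have c0 i : 0 <= c i by rewrite /c divr_ge0 // ltW.
pose g (i : 'I_n.+1) (t : R) : \bar R := ((c i)%:E * (\1_`[grid x y n i, grid x y n i.+1[ t)%:E)%E.
have mI i : measurable_fun `[x, y]%classic
    (fun t : R => (\1_`[grid x y n i, grid x y n i.+1[ t)%:E).
  by apply/measurable_EFinP; apply: measurable_indic; exact: measurable_itv.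
have mg i : measurable_fun `[x, y]%classic (g i) by exact: measurable_funeM.
apply: (@le_trans _ _ (\int[mu]_(t in `[x, y]) \sum_(i < n.+1) g i t)%E).
  apply: ge0_le_integral => //.
  - apply/measurable_EFinP; apply: measurableT_comp => //; exact: grid_slope_measurable.
  - exact: emeasurable_sum.
  - move=> t _; rewrite sumEFin lee_fin; apply: le_trans (ler_norm_sum _ _ _) _.
    by apply: ler_sum => i _; rewrite !normrM normfV (gtr0_norm h0) (@ger0_norm _ (\1_ _ _)).
rewrite ge0_integral_sum; [|exact: measurable_itv|exact: mg|]; last first.
  by move=> i t _; rewrite mule_ge0 // lee_fin.
rewrite -sumEFin; apply: lee_sum => i _.
rewrite /g ge0_integralZl_EFin; [|exact: measurable_itv| |exact: mI|exact: c0]; last first.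
  by move=> t _; rewrite lee_fin.
rewrite integral_indic //.
apply: (@le_trans _ _ ((c i)%:E * mu `[grid x y n i, grid x y n i.+1[%classic)%E).
  apply: lee_wpmul2l; first by rewrite lee_fin.
  apply: (@le_measure _ _ _ (@lebesgue_measure R)); rewrite ?inE; [|exact: measurable_itv|by move=> z []].
  by apply: measurableI; exact: measurable_itv.
have mE : mu `[grid x y n i, grid x y n i.+1[%classic = ((y - x) / n.+1%:R)%:E.
  rewrite lebesgue_measure_itv /= lte_fin -subr_gt0 gridS h0.
  by rewrite -EFinB gridS.
by rewrite mE -EFinM lee_fin /c divfK // gt_eqF.
Qed.

(* By Fatou, applied to the difference quotients of f on finer and finer grids,
   which are bounded in L^1 because f has bounded variation. *)
Lemma ae_integrable_derivative f v a b : a <= b ->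
  abs_continuous a b f ->
  {ae mu, forall t : R, t \in `[a, b] -> is_derive t 1 f (v t)} ->
  ae_integrable v a b.
Proof.
move=> ab acf aed; have [d d0 H] := acf 1 ltr01.
(* On intervals shorter than [d] the variation is at most 1, which is the L^1 bound that Fatou's
   lemma needs; so the claim is proved locally. *)
apply: ae_integrable_local => // t at_ tb; exists (d / 2); first by rewrite divr_gt0.
move=> x y ax xt ty yb tx yt.
have yxd : y - x < d by lra.
have [xy|yx] := ltP x y; last first.
  exists (fun=> 0); first exact: integrable0.
  exists [set x]; split => //; first exact: lebesgue_measure_set1.
  move=> z /= hz; apply: contrapT => zx; apply: hz; rewrite in_itv /= => /andP[xz zy].
  by exfalso; apply: zx; apply/eqP; rewrite eq_le xz (le_trans zy yx).
have var1 n : \sum_(i < n.+1) `|f (grid x y n i.+1) - f (grid x y n i)| <= 1.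
  rewrite ltW //.
  have := H [seq (grid x y n i, grid x y n i.+1) | i <- index_iota 0 n.+1].
  rewrite !big_map !big_mkord; apply.
  - apply/allP => _ /mapP[i + ->] /=; rewrite mem_index_iota /= => ni.
    apply/and3P; split; last 2 first.
    + exact: grid_le (ltW xy) (leqnSn i).
    + apply: le_trans yb; rewrite -{2}(gridn x y n); exact: grid_le (ltW xy) ni.
    by apply: le_trans ax _; rewrite -{1}(grid0 x y n); exact: grid_le (ltW xy) (leq0n i).
  - rewrite pairwise_map; have := iota_ltn_sorted 0 (n.+1 - 0).
    rewrite (sorted_pairwise ltn_trans); apply: sub_pairwise => i j /= ij.
    by apply/orP; left; exact: grid_le (ltW xy) ij.
  - under eq_bigr do rewrite gridS.
    by rewrite sumr_const card_ord -[X in X < _]mulr_natr divfK // pnatr_eq0.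
have Icc : measurable (`[x, y]%classic : set R) by exact: measurable_itv.
(* The upper limit is measurable and defined everywhere; where the slopes converge, its finite part
   is [v]. *)
pose G t := limn_esup (fun n => (grid_slope f x y n t)%:E).
have mG : measurable_fun setT G.
  apply: measurable_fun_limn_esup => n.
  by apply/measurable_EFinP; exact: grid_slope_measurable.
pose F t := fine (G t).
have mF : measurable_fun setT F by apply: measurableT_comp mG => //; exact: fine_measurable.
have aecv : {ae mu, forall z : R, z \in `[x, y] -> grid_slope f x y n z @[n --> \oo] --> v z}.
  have aey : {ae mu, forall z : R, z != y}.
    exists [set y]; split => //; first exact: lebesgue_measure_set1.
    by move=> z /= /negP; rewrite negbK => /eqP.
  apply: filterS2 aed aey => z hz zy; rewrite in_itv /= => /andP[xz zy'].
  apply: grid_slope_cvg => //; first by rewrite lt_neqAle zy.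
  by apply: hz; rewrite in_itv /= (le_trans ax xz) (le_trans zy' yb).
have vF : {ae mu, forall z : R, z \in `[x, y] -> v z = F z}.
  apply: filterS aecv => z /[apply] hz; rewrite /F /G.
  have hz' : (grid_slope f x y n z)%:E @[n --> \oo] --> (v z)%:E by apply: cvg_EFin => //; exact: nearW.
  by rewrite (cvg_limn_einf_sup hz').2.
exists (F \_ `[x, y]); last first.
  by apply: filterS vF => z hz zxy; rewrite patchE mem_setE zxy hz.
apply: integrable_restrict_itv; apply/integrableP; split.
  by apply/measurable_EFinP; exact: measurable_funTS.
apply: (@le_lt_trans _ _ 1%E); last exact: ltry.
have Fe : (\int[mu]_(z in `[x, y]) `|(EFin \o F) z| =
   \int[mu]_(z in `[x, y]) limn_einf (fun n => (`|grid_slope f x y n z|)%:E))%E.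
  apply: ge0_ae_eq_integral => //.
  - by apply: measurableT_comp => //; apply/measurable_EFinP; exact: measurable_funTS.
  - rewrite (_ : (fun z => _) = (fun z => - limn_esup (fun n => - (`|grid_slope f x y n z|)%:E))%E).
      apply: measurableT_comp => //; apply: measurable_fun_limn_esup => n.
      apply: measurableT_comp => //; apply/measurable_EFinP.
      by apply: measurableT_comp => //; exact: grid_slope_measurable.
    by apply/funext => z; rewrite limn_esupN oppeK.
  - move=> z _; rewrite limn_einf_lim; apply: lime_ge; first exact: is_cvg_einfs.
    by apply: nearW => n; apply: le_ereal_inf_tmp => _ [m _ <-]; rewrite lee_fin.
  - apply: filterS2 aecv vF => z h1 h2 zxy; have {}h1 := h1 zxy; have {}h2 := h2 zxy.
    have hz' : (`|grid_slope f x y n z|)%:E @[n --> \oo] --> (`|v z|)%:E.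
      by apply: cvg_EFin; [exact: nearW | exact: cvg_norm].
    by rewrite (cvg_limn_einf_sup hz').1 /= h2.
rewrite Fe; apply: le_trans (fatou mu Icc _ _) _ => //.
- move=> n; apply/measurable_EFinP.
  by apply: measurableT_comp => //; exact: grid_slope_measurable.
- rewrite limn_einf_lim; apply: lime_le; first exact: is_cvg_einfs.
  apply: nearW => n; apply: ge_ereal_inf; exists (\int[mu]_(z in `[x, y]) (`|grid_slope f x y n z|)%:E)%E.
    by exists n => /=.
  by apply: le_trans (grid_slope_integral _ _ _) _ => //; rewrite lee_fin.
Qed.

End DerivativeIntegrable.

(** * Iterated derivatives and multilinear maps *)

Section Approx.
Context {R : realType}.
Implicit Types V W : normedModType R.

Lemma near_approx V (x : V) (P : V -> Prop) : (\forall y \near x, P y) <->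
  exists2 d : R, 0 < d & forall y, `|y - x| < d -> P y.
Proof.
split=> [/nbhs_normP[d d0 H]|[d d0 H]].
  by exists d => // y yx; apply: H; rewrite /ball_ /= distrC.
by apply/nbhs_normP; exists d => // y; rewrite /ball_ /= distrC; exact: H.
Qed.

Lemma open_approx V (U : set V) x : open U -> U x ->
  exists2 d : R, 0 < d & forall y, `|y - x| < d -> U y.
Proof. by move=> oU Ux; apply/near_approx; exact: open_nbhs_nbhs. Qed.

Lemma continuous_approx V W (g : V -> W) x : {for x, continuous g} ->
  forall e : R, 0 < e -> exists2 d : R, 0 < d & forall y, `|y - x| < d -> `|g y - g x| < e.
Proof.
move=> cg e e0; apply/near_approx.
have := cg; rewrite /prop_for /continuous_at => /cvgrPdist_lt /(_ e e0).
by apply: filterS => y; rewrite distrC.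
Qed.

Lemma approx_continuous V W (g : V -> W) x :
  (forall e : R, 0 < e -> exists2 d : R, 0 < d & forall y, `|y - x| < d -> `|g y - g x| < e) ->
  {for x, continuous g}.
Proof.
move=> H; apply/cvgrPdist_lt => e e0; have /near_approx := H e e0.
by apply: filterS => y; rewrite distrC.
Qed.

End Approx.

Section IterDerive.
Context {R : realType}.

Lemma is_derive_line (V W : normedModType R) (g : V -> W) (y v : V) (r : R) :
  derivable g (y + r *: v) v ->
  is_derive r 1 (fun r => g (y + r *: v)) ('D_v g (y + r *: v)).
Proof.
move=> dg.
have E : (fun h : R => h^-1 *: (g (y + (h *: (1 : R) + r) *: v) - g (y + r *: v))) =
         (fun h : R => h^-1 *: (g (h *: v + (y + r *: v)) - g (y + r *: v))).
  apply/funext => h; have -> : h *: (1 : R) = h by rewrite /GRing.scale /= mulr1.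
  by rewrite scalerDl addrCA.
by split; rewrite ?/derivable ?/derive /=; rewrite E.
Qed.

(* Unification otherwise unfolds derivatives down to limits and does not
   terminate in reasonable time. *)
#[local] Opaque derive.

Lemma derive_coord (V : normedModType R) m n (g : V -> 'M[R]_(m, n)) x v i j :
  derivable g x v ->
  derivable (fun y => g y i j) x v /\ 'D_v (fun y => g y i j) x = ('D_v g x) i j.
Proof.
move=> dg; have dij := (derivable_mxP g x v).1 dg i j; split => //.
by rewrite derive_mx // mxE.
Qed.

(** Two mean values: along [v] for the difference of [g] in direction [w], then along [w] for the
    derivative of [g] in direction [v]. *)
Lemma second_difference (V : normedModType R) (g : V -> R) (x v w : V) (h : R) :
  0 < h ->
  (forall r q, 0 <= r <= h -> 0 <= q <= h ->
     derivable g (x + r *: v + q *: w) v /\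
     derivable ('D_v g) (x + r *: v + q *: w) w) ->
  exists r q, [/\ 0 <= r <= h, 0 <= q <= h &
    g (x + h *: v + h *: w) - g (x + h *: v) - g (x + h *: w) + g x =
    'D_w ('D_v g) (x + r *: v + q *: w) * h ^+ 2].
Proof.
move=> h0 H.
have h00 : (0 : R) <= 0 <= h by rewrite lexx ltW.
have hh : 0 <= h <= h by rewrite lexx ltW.
pose phi r := g (x + h *: w + r *: v) - g (x + r *: v).
have dphi r : 0 <= r <= h ->
    is_derive r 1 phi ('D_v g (x + r *: v + h *: w) - 'D_v g (x + r *: v)).
  move=> rh; apply: is_deriveB.
    rewrite addrAC; apply: is_derive_line; rewrite addrAC.
    exact: (H r h rh hh).1.
  by apply: is_derive_line; have := (H r 0 rh h00).1; rewrite scale0r addr0.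
have [r rh phiE] : exists2 r, r \in `[0, h] & phi h - phi 0 =
    ('D_v g (x + r *: v + h *: w) - 'D_v g (x + r *: v)) * (h - 0).
  apply: MVT_segment; first exact: ltW.
    move=> r; rewrite in_itv /= => /andP[r0 rh]; apply: dphi; by rewrite !ltW.
  apply: derivable_within_continuous => r; rewrite in_itv /= => rh.
  by have [] := dphi r rh.
rewrite in_itv /= in rh.
pose psi q := 'D_v g (x + r *: v + q *: w).
have dpsi q : 0 <= q <= h -> is_derive q 1 psi ('D_w ('D_v g) (x + r *: v + q *: w)).
  by move=> qh; apply: is_derive_line; exact: (H _ _ rh qh).2.
have [q qh psiE] : exists2 q, q \in `[0, h] & psi h - psi 0 =
    'D_w ('D_v g) (x + r *: v + q *: w) * (h - 0).
  apply: MVT_segment; first exact: ltW.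
    move=> q; rewrite in_itv /= => /andP[q0 qh]; apply: dpsi; by rewrite !ltW.
  apply: derivable_within_continuous => q; rewrite in_itv /= => qh.
  by have [] := dpsi q qh.
exists r, q; split => //.
move: phiE psiE; rewrite /phi /psi !scale0r !addr0 !subr0 => phiE psiE.
rewrite expr2 mulrA -psiE -phiE [x + h *: v + _]addrAC; ring.
Qed.

(** Schwarz's theorem. The second difference is symmetric in [v] and [w], hence equals [h ^+ 2]
    times either mixed derivative at some point near [x]. *)
Lemma deriveC_scalar (V : normedModType R) (U : set V) (g : V -> R) (x v w : V) :
  open U -> U x ->
  (forall y, U y -> [/\ derivable g y v, derivable g y w,
     derivable ('D_v g) y w & derivable ('D_w g) y v]) ->
  {for x, continuous ('D_w ('D_v g))} -> {for x, continuous ('D_v ('D_w g))} ->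
  'D_w ('D_v g) x = 'D_v ('D_w g) x.
Proof.
move=> oU Ux dg c1 c2; apply/eqP; rewrite -subr_eq0 -normr_le0.
apply/ler_addgt0Pr => e e0; rewrite add0r.
have e20 : 0 < e / 2 by rewrite divr_gt0.
have [d0 d00 HU] := open_approx oU Ux.
have [d1 d10 H1] := continuous_approx c1 e20.
have [d2 d20 H2] := continuous_approx c2 e20.
pose d := Num.min d0 (Num.min d1 d2).
have dP : 0 < d by rewrite !lt_min d00 d10.
have Hd y : `|y - x| < d -> [/\ U y,
    `|'D_w ('D_v g) y - 'D_w ('D_v g) x| < e / 2 &
    `|'D_v ('D_w g) y - 'D_v ('D_w g) x| < e / 2].
  move=> yd; have /and3P[k0 k1 k2] : [&& `|y - x| < d0, `|y - x| < d1 & `|y - x| < d2].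
    by move: yd; rewrite /d; set z := `|y - x|; rewrite lt_min; rewrite lt_min.
  exact: And3 (HU y k0) (H1 y k1) (H2 y k2).
(* With this [h] the whole parallelogram with sides [h *: v] and [h *: w] stays within [d] of [x];
   the 1 covers vanishing vectors. *)
pose h := d / 2 / (`|v| + `|w| + 1).
have vw0 : 0 < `|v| + `|w| + 1 by rewrite ltr_wpDl // addr_ge0.
have h0 : 0 < h by rewrite /h divr_gt0 // divr_gt0.
have near_h r q : 0 <= r <= h -> 0 <= q <= h -> `|x + r *: v + q *: w - x| < d.
  move=> /andP[r0 rh] /andP[q0 qh]; rewrite -(addrA x) [x + _]addrC addrK.
  apply: le_lt_trans (ler_normD _ _) _; rewrite !normrZ !ger0_norm //.
  apply: (@le_lt_trans _ _ (h * (`|v| + `|w| + 1))).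
    by rewrite !mulrDr mulr1; apply: ler_wpDr; [exact: ltW|apply: lerD; rewrite ler_wpM2r].
  by rewrite /h divfK ?gt_eqF // ltr_pdivrMr // ltr_pMr // ltr1n.
have [r [q [rh qh E1]]] : exists r q, [/\ 0 <= r <= h, 0 <= q <= h &
    g (x + h *: v + h *: w) - g (x + h *: v) - g (x + h *: w) + g x =
    'D_w ('D_v g) (x + r *: v + q *: w) * h ^+ 2].
  apply: (second_difference h0) => r q rh qh.
  have [Uy _ _] := Hd _ (near_h r q rh qh); have [k1 k2 k3 k4] := dg _ Uy.
  exact: conj k1 k3.
have [r' [q' [rh' qh' E2]]] : exists r q, [/\ 0 <= r <= h, 0 <= q <= h &
    g (x + h *: w + h *: v) - g (x + h *: w) - g (x + h *: v) + g x =
    'D_v ('D_w g) (x + r *: w + q *: v) * h ^+ 2].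
  apply: (second_difference h0) => r' q' rh' qh'.
  have [Uy _ _] := Hd _ (near_h q' r' qh' rh'); have [k1 k2 k3 k4] := dg _ Uy.
  rewrite addrAC; exact: conj k2 k4.
have h20 : h ^+ 2 != 0 by rewrite expf_neq0 // gt_eqF.
have [_ + _] := Hd _ (near_h r q rh qh).
have [_ _ +] := Hd _ (near_h q' r' qh' rh').
rewrite (addrAC x (r' *: w)) in E2.
move: E1 E2; rewrite (addrAC x (h *: w)).
move: ('D_w ('D_v g) (x + r *: v + q *: w)) ('D_v ('D_w g) (x + q' *: v + r' *: w)).
move: ('D_w ('D_v g) x) ('D_v ('D_w g) x) (g (x + h *: v + h *: w)) (g (x + h *: v)) (g (x + h *: w)) (g x).
move=> A B c1' c2' c3' c4' A' B' E1 E2 a1 a2.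
have E : A' = B'.
  by apply: (mulIf h20); rewrite -E1 -E2 [X in X + _ = _]addrAC.
rewrite -E in a1; have -> : A - B = (A' - B) - (A' - A) by ring.
by apply: le_trans (ler_normB _ _) _; move: a1 a2; clear; lra.
Qed.

(** Mean values exist only for scalar functions, so the scalar case is applied entry by entry; the
    work is to identify entries of derivatives with derivatives of entries near [x]. *)
Lemma deriveC (V : normedModType R) m n (U : set V) (g : V -> 'M[R]_(m, n)) (x v w : V) :
  open U -> U x ->
  (forall y, U y -> [/\ differentiable g y, differentiable ('D_v g) y & differentiable ('D_w g) y]) ->
  {for x, continuous ('D_w ('D_v g))} -> {for x, continuous ('D_v ('D_w g))} ->
  'D_w ('D_v g) x = 'D_v ('D_w g) x.
Proof.
move=> oU Ux dg c1 c2; apply/matrixP => i j.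
pose gij y := g y i j.
have comm v1 z : U z -> (forall y, U y -> derivable g y v1) -> 'D_v1 gij z = ('D_v1 g z) i j.
  by move=> Uz dg1; exact: (derive_coord i j (dg1 z Uz)).2.
have nearc v1 y : U y -> (forall y, U y -> derivable g y v1) ->
    \forall z \near y, ('D_v1 g z) i j = 'D_v1 gij z.
  move=> Uy dg1; apply/near_approx; have [d d0 Hd] := open_approx oU Uy.
  by exists d => // z /Hd Uz; rewrite comm.
have dgv y : U y -> derivable g y v.
  by move=> Uy; have [k1 k2 k3] := dg y Uy; exact: (@diff_derivable _ _ _ _ _ v k1).
have dgw y : U y -> derivable g y w.
  by move=> Uy; have [k1 k2 k3] := dg y Uy; exact: (@diff_derivable _ _ _ _ _ w k1).
have dgvw y : U y -> derivable ('D_v g) y w.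
  by move=> Uy; have [k1 k2 k3] := dg y Uy; exact: (@diff_derivable _ _ _ _ _ w k2).
have dgwv y : U y -> derivable ('D_w g) y v.
  by move=> Uy; have [k1 k2 k3] := dg y Uy; exact: (@diff_derivable _ _ _ _ _ v k3).
have comm2 v1 w1 y : U y -> (forall y, U y -> derivable g y v1) ->
    (forall y, U y -> derivable ('D_v1 g) y w1) ->
    derivable ('D_v1 gij) y w1 /\ 'D_w1 ('D_v1 gij) y = ('D_w1 ('D_v1 g) y) i j.
  move=> Uy dg1 dg2; have [k1 k2] := derive_coord i j (dg2 y Uy).
  have nc := nearc v1 y Uy dg1; split.
    exact: (near_eq_derivable nc k1).
  by rewrite -k2; apply/esym; exact: near_eq_derive.
apply: etrans (esym (comm2 v w x Ux dgv dgvw).2) _.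
apply: etrans _ (comm2 w v x Ux dgw dgwv).2.
have cont v1 w1 : (forall y, U y -> derivable g y v1) ->
    (forall y, U y -> derivable ('D_v1 g) y w1) ->
    {for x, continuous ('D_w1 ('D_v1 g))} -> {for x, continuous ('D_w1 ('D_v1 gij))}.
  move=> dg1 dg2 c; apply: approx_continuous => e e0.
  have [d d0 Hd] := continuous_approx c e0.
  have [d' d'0 HU] := open_approx oU Ux.
  exists (Num.min d d'); first by rewrite lt_min d0.
  move=> y; rewrite lt_min => /andP[/Hd h1 /HU Uy].
  rewrite (comm2 v1 w1 y Uy dg1 dg2).2 (comm2 v1 w1 x Ux dg1 dg2).2.
  apply: le_lt_trans h1; move: ('D_w1 ('D_v1 g) y) ('D_w1 ('D_v1 g) x) => a b.
  have -> : a i j - b i j = (a - b) i j by rewrite !mxE.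
  by rewrite [leRHS]mx_normrE; apply/bigmax_geP; right; exists (i, j).
apply: (@deriveC_scalar V U gij x v w oU Ux).
- move=> y Uy; split.
  + exact: (derive_coord i j (dgv y Uy)).1.
  + exact: (derive_coord i j (dgw y Uy)).1.
  + exact: (comm2 v w y Uy dgv dgvw).1.
  + exact: (comm2 w v y Uy dgw dgwv).1.
- exact: cont.
- exact: cont.
Qed.

End IterDerive.

Section IterDeriveSymmetric.
Context {R : realType} {n : nat}.
Variables (U : set 'rV[R]_n) (f : 'rV[R]_n -> 'rV[R]_n).
Hypotheses (oU : open U) (sf : smooth_on U f).
Implicit Types (vs ws : seq 'rV[R]_n) (v w x : 'rV[R]_n).

Lemma iter_derive_swap v w vs x : U x ->
  iter_derive (v :: w :: vs) f x = iter_derive (w :: v :: vs) f x.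
Proof.
move=> Ux; apply: (deriveC (U := U) oU Ux).
- move=> y Uy; split; [exact: sf|exact: (sf (w :: vs))|exact: (sf (v :: vs))].
- by apply: differentiable_continuous; exact: (sf [:: v, w & vs]).
- by apply: differentiable_continuous; exact: (sf [:: w, v & vs]).
Qed.

Lemma iter_derive_congr v vs ws : (forall x, U x -> iter_derive vs f x = iter_derive ws f x) ->
  forall x, U x -> iter_derive (v :: vs) f x = iter_derive (v :: ws) f x.
Proof.
move=> E x Ux; apply: near_eq_derive; apply/near_approx.
by have [d d0 H] := open_approx oU Ux; exists d => // y /H /E.
Qed.

Lemma iter_derive_perm vs ws : perm_eq vs ws ->
  forall x, U x -> iter_derive vs f x = iter_derive ws f x.
Proof.
elim: vs ws => [|v vs IH] ws pvw x Ux.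
  by move: pvw; rewrite perm_sym => /perm_nilP ->.
have : v \in ws by rewrite -(perm_mem pvw) mem_head.
move=> /path.splitPr wsE; case: ws / wsE pvw => ws1 ws2.
have pC : perm_eq (ws1 ++ v :: ws2) (v :: ws1 ++ ws2).
  by rewrite -(cat1s v ws2) perm_catCA.
move=> /perm_trans/(_ pC); rewrite perm_cons => pvw.
transitivity (iter_derive (v :: ws1 ++ ws2) f x).
  exact: (iter_derive_congr v (fun y Uy => IH _ pvw y Uy)).
elim: ws1 {pvw pC} x Ux => [|w ws1 IHw] // x Ux.
rewrite cat_cons iter_derive_swap //.
exact: (iter_derive_congr w IHw).
Qed.

Lemma iter_derive_linear vs x : U x -> linear (fun v => iter_derive (v :: vs) f x).
Proof.
move=> Ux a v w; have df : differentiable (iter_derive vs f) x by exact: sf.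
have dE u : iter_derive (u :: vs) f x = 'd (iter_derive vs f) x u by exact: deriveE.
by rewrite !dE linearP.
Qed.

Lemma iter_derive_symmetric x : U x -> symmetric_multilinear (fun vs => iter_derive vs f x).
Proof.
move=> Ux; split; first by move=> vs ws pvw; exact: iter_derive_perm.
by move=> vs; exact: iter_derive_linear.
Qed.

End IterDeriveSymmetric.

(** * Symmetric multilinear families on lists *)

Section Multilinear.
Context {R : realType} {n : nat}.
Local Notation V := 'rV[R]_n.
Implicit Types (F : seq V -> V).

Definition basis_word (w : seq 'I_n) : seq V := [seq delta_mx ord0 i | i <- w].

Lemma symmetric_multilinear_cons F v : symmetric_multilinear F ->
  symmetric_multilinear (fun vs => F (v :: vs)).
Proof.
move=> [sF lF]; split; first by move=> vs ws pvw; apply: sF; rewrite perm_cons.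
move=> vs a x y; have sw z : F [:: v, z & vs] = F [:: z, v & vs].
  by apply: sF; rewrite -cat1s -(cat1s z) perm_catCA.
by rewrite !sw lF.
Qed.

Lemma multilinear_sum F vs (I : Type) (r : seq I) (P : pred I) (c : I -> R) (v : I -> V) :
  symmetric_multilinear F ->
  F (\sum_(i <- r | P i) c i *: v i :: vs) = \sum_(i <- r | P i) c i *: F (v i :: vs).
Proof.
move=> [_ lF]; elim: r => [|i r IH].
  by rewrite !big_nil; have := lF vs (-1) 0 0; rewrite scaler0 addr0 scaleN1r addNr.
by rewrite !big_cons; case: (P i); rewrite ?lF ?IH.
Qed.

Lemma multilinear_expand F v vs : symmetric_multilinear F ->
  F (v :: vs) = \sum_i v ord0 i *: F (delta_mx ord0 i :: vs).
Proof. by move=> sF; rewrite -multilinear_sum // -row_sum_delta. Qed.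

Lemma multilinearZ F c v vs : symmetric_multilinear F ->
  F (c *: v :: vs) = c *: F (v :: vs).
Proof.
move=> sF; have := @multilinear_sum F vs unit [:: tt] xpredT (fun=> c) (fun=> v) sF.
by rewrite !big_seq1.
Qed.

Lemma multilinearB F v w vs : symmetric_multilinear F ->
  F (v - w :: vs) = F (v :: vs) - F (w :: vs).
Proof.
move=> sF; have [_ /(_ vs (-1) w v)] := sF.
by rewrite !scaleN1r => E; rewrite [v - w]addrC E addrC.
Qed.

(** One induction for derivability, continuity and absolute continuity of t ->
    F(t)[v_1(t), ..., v_p(t)]: it is a sum of products of coordinates, of kind [PS], with values on
    basis vectors, of kind [PV]. The list [js] holds labels, so that the arguments may move while
    their number stays fixed. *)
Lemma multilinear_closure (T J : Type) (D : set T) (PV : (T -> V) -> Prop)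
    (PS : (T -> R) -> Prop) :
  (forall f g, (forall t, D t -> f t = g t) -> PV f -> PV g) ->
  PV (fun=> 0) ->
  (forall f g, PV f -> PV g -> PV (fun t => f t + g t)) ->
  (forall c f, PS c -> PV f -> PV (fun t => c t *: f t)) ->
  forall (js : seq J) (F : T -> seq V -> V) (v : J -> T -> V),
  (forall t, D t -> symmetric_multilinear (F t)) ->
  (forall w, size w = size js -> PV (fun t => F t (basis_word w))) ->
  (forall j i, PS (fun t => v j t ord0 i)) ->
  PV (fun t => F t [seq v j t | j <- js]).
Proof.
move=> Pext P0 PD PZ js F v; elim: js F => [|j js IH] F mF Fw Pv /=; first exact: (Fw [::]).
apply: (Pext (fun t => \sum_i v j t ord0 i *: F t (delta_mx ord0 i :: [seq v j t | j <- js]))).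
  by move=> t Dt; rewrite -multilinear_expand //; exact: mF.
elim: (index_enum _) => [|i r IHr].
  by apply: (Pext (fun=> 0)) => // t _; rewrite big_nil.
apply: (Pext (fun t => v j t ord0 i *: F t (delta_mx ord0 i :: [seq v j t | j <- js]) +
   \sum_(i <- r) v j t ord0 i *: F t (delta_mx ord0 i :: [seq v j t | j <- js]))).
  by move=> t _; rewrite big_cons.
apply: PD => //; apply: PZ => //.
apply: (IH (fun t vs => F t (delta_mx ord0 i :: vs))) => //.
  by move=> t /mF; exact: symmetric_multilinear_cons.
by move=> w ws; apply: (Fw (i :: w)); rewrite /= ws.
Qed.

Lemma rV_coord_le (v : V) i : `|v ord0 i| <= `|v|.
Proof. by rewrite [leRHS]mx_normrE; apply/bigmax_geP; right; exists (ord0, i). Qed.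

Definition multibounded (T : Type) (D : set T) (F : T -> seq V -> V) (p : nat) :=
  exists2 C, 0 <= C & forall t vs, D t -> size vs = p ->
    `|F t vs| <= C * \prod_(v <- vs) `|v|.

Lemma multibounded_words (T : Type) (D : set T) (F : T -> seq V -> V) p :
  (forall t, D t -> symmetric_multilinear (F t)) ->
  (forall w, size w = p -> exists C, forall t, D t -> `|F t (basis_word w)| <= C) ->
  multibounded D F p.
Proof.
elim: p F => [|p IH] F mF Fw.
  have [C HC] := Fw [::] erefl; exists `|C| => // t vs Dt /size0nil ->.
  by rewrite big_nil mulr1 (le_trans (HC t Dt)) ?ler_norm.
have Hi i : exists C, 0 <= C /\ forall t vs, D t -> size vs = p ->
    `|F t (delta_mx ord0 i :: vs)| <= C * \prod_(v <- vs) `|v|.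
  have [||C C0 HC] := IH (fun t vs => F t (delta_mx ord0 i :: vs)).
  - by move=> t /mF; exact: symmetric_multilinear_cons.
  - by move=> w ws; apply: (Fw (i :: w)); rewrite /= ws.
  by exists C.
have [C HC] := choice Hi.
exists (\sum_i C i); first by apply: sumr_ge0 => i _; have [] := HC i.
move=> t [//|v vs] Dt [vsp]; rewrite multilinear_expand; last exact: mF.
apply: le_trans (ler_norm_sum _ _ _) _; rewrite mulr_suml; apply: ler_sum => i _.
rewrite normrZ big_cons mulrCA; apply: ler_pM => //; first exact: rV_coord_le.
by have [_] := HC i; exact.
Qed.

(** Telescoping: the copies of [w] are replaced by [v] one at a time. *)
Lemma multilinear_nseqB F p v w : symmetric_multilinear F ->
  F (nseq p v) - F (nseq p w) =
  \sum_(i < p) F (v - w :: nseq i v ++ nseq (p.-1 - i) w).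
Proof.
move=> sF; have [pF _] := sF.
pose G i := F (nseq i v ++ nseq (p - i) w).
rewrite (_ : F (nseq p v) = G p); last by rewrite /G subnn cats0.
rewrite (_ : F (nseq p w) = G 0); last by rewrite /G subn0.
rewrite -(telescope_sumr _ (leq0n p)) big_mkord; apply: eq_bigr => i _.
rewrite multilinearB //; congr (_ - _); rewrite /G; last first.
  have -> : (p - i = (p.-1 - i).+1)%N by have := ltn_ord i; lia.
  by apply: pF; rewrite /= -cat1s perm_sym -cat1s perm_catCA.
by rewrite subnS predn_sub.
Qed.

End Multilinear.

(** * Multi-indices *)

Section MultiIndex.
Context {k : nat}.
Implicit Types (al ga : multi_index k) (r : 'I_k).

Definition mdeg al : nat := (\sum_(i < k) al i)%N.

(** Entries are bounded by [k], so this raises the entry [r] only when [al r < k]; on overflow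
    [inord] yields 0, which the positivity test in [mi_incr_overflow] detects. *)
Definition mi_incr r al : multi_index k := [ffun i => inord (al i + (i == r))].
Definition mi_decr r al : multi_index k := [ffun i => inord (al i - (i == r))].

Lemma mi_incrE r al i : (al r < k)%N -> (mi_incr r al i = al i + (i == r) :> nat)%N.
Proof.
move=> alr; rewrite ffunE inordK //; case: eqP => [->|_]; last by rewrite addn0.
by rewrite addn1.
Qed.

Lemma mi_decrE r al i : (mi_decr r al i = al i - (i == r) :> nat)%N.
Proof. by rewrite ffunE inordK // ltnS (leq_trans (leq_subr _ _)) // -ltnS. Qed.

Lemma mi_incrK r al : (al r < k)%N -> mi_decr r (mi_incr r al) = al.
Proof.
by move=> alr; apply/ffunP => i; apply/val_inj; rewrite /= mi_decrE mi_incrE // addnK.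
Qed.

Lemma mi_decrK r al : (0 < al r)%N -> mi_incr r (mi_decr r al) = al.
Proof.
move=> al0; have dlt : (mi_decr r al r < k)%N.
  by rewrite mi_decrE eqxx subn1 prednK // -ltnS.
apply/ffunP => i; apply/val_inj; rewrite /= mi_incrE // mi_decrE subnK //.
by case: eqP => // ->.
Qed.

Lemma mi_incr_overflow r al : (0 < mi_incr r al r)%N -> (al r < k)%N.
Proof.
have := ltn_ord (al r); rewrite ltnS leq_eqVlt => /orP[/eqP alk|//].
rewrite ffunE eqxx alk addn1 /inord /insubd insubF ?ltnn //.
Qed.

Lemma mdeg_incr r al : (al r < k)%N -> mdeg (mi_incr r al) = (mdeg al).+1.
Proof.
move=> alr; rewrite /mdeg (eq_bigr (fun i => al i + (i == r))%N); last first.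
  by move=> i _; rewrite mi_incrE.
by rewrite big_split /= -[X in (_ + X)%N]big_mkcond /= big_pred1_eq addn1.
Qed.

Lemma mdeg_coord_le al i : (al i <= mdeg al)%N.
Proof. by rewrite /mdeg (bigD1 i) //= leq_addr. Qed.

Lemma weight_ge_mdeg al : (mdeg al <= weight al)%N.
Proof. by apply: leq_sum => i _; rewrite leq_pmull. Qed.

Lemma mdeg0_eq al : mdeg al = 0%N -> al = [ffun=> ord0].
Proof.
move=> al0; apply/ffunP => i; apply/val_inj; rewrite ffunE /=.
by apply/eqP; rewrite -leqn0 -al0 mdeg_coord_le.
Qed.

Lemma multi_fact_incr r al : (al r < k)%N ->
  multi_fact (mi_incr r al) = ((al r).+1 * multi_fact al)%N.
Proof.
move=> alr; rewrite /multi_fact (bigD1 r) //= [in RHS](bigD1 r) //= mulnA.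
rewrite mi_incrE // eqxx addn1 factS; congr (_ * _)%N.
by apply: eq_bigr => i /negPf ir; rewrite mi_incrE // ir addn0.
Qed.

Lemma insert_powers_incr (R : realType) n (b : 'M[R]_(k, n)) r al : (al r < k)%N ->
  perm_eq (insert_powers b (mi_incr r al)) (row r b :: insert_powers b al).
Proof.
move=> alr; rewrite /insert_powers.
have := enum_uniq 'I_k; have := mem_enum 'I_k r.
rewrite inE => /path.splitPr[s1 s2].
rewrite cat_uniq /= => /and3P[_ /norP[r1 _] /andP[r2 _]].
have E s : r \notin s -> [seq nseq (mi_incr r al i) (row i b) | i <- s] =
                         [seq nseq (al i) (row i b) | i <- s].
  move=> rs; apply/eq_in_map => i si; rewrite mi_incrE //.
  by case: eqP => [ir|_]; [rewrite -ir si in rs|rewrite addn0].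
rewrite !map_cat !flatten_cat /= !E // mi_incrE // eqxx addn1 /=.
by rewrite -cat1s perm_catCA.
Qed.

Lemma insert_powers0 (R : realType) n (b : 'M[R]_(k, n)) :
  insert_powers b [ffun=> ord0] = [::].
Proof.
rewrite /insert_powers; elim: (enum _) => [|i s IH] //=.
by rewrite ffunE.
Qed.

Lemma size_insert_powers (R : realType) n (b : 'M[R]_(k, n)) al :
  size (insert_powers b al) = mdeg al.
Proof.
rewrite size_flatten /shape -map_comp sumnE big_map /mdeg big_enum /=.
by apply: eq_bigr => i _; rewrite size_nseq.
Qed.

End MultiIndex.

(** * The multinomial formula *)

Section Multinomial.
Context {R : realType} {n k : nat}.
Local Notation V := 'rV[R]_n.
Variable b : 'M[R]_(k, n).

Definition mcoef (c : 'I_k -> R) (al : multi_index k) : R :=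
  (multi_fact al)%:R^-1 * \prod_(r < k) c r ^+ al r.

Lemma mcoef_incr (c : 'I_k -> R) (r : 'I_k) (al : multi_index k) : (al r < k)%N ->
  (mi_incr r al r)%:R * mcoef c (mi_incr r al) = c r * mcoef c al.
Proof.
move=> alr.
have HP : \prod_(i < k) c i ^+ mi_incr r al i = c r * \prod_(i < k) c i ^+ al i.
  rewrite (bigD1 r) //= [in RHS](bigD1 r) //= mi_incrE // eqxx addn1 exprS mulrA.
  congr (_ * _).
  by apply: eq_bigr => i /negPf ir; rewrite mi_incrE // ir addn0.
rewrite /mcoef HP multi_fact_incr // mi_incrE // eqxx addn1 natrM invfM.
by rewrite -mulrA mulVKf ?pnatr_eq0 // mulrCA.
Qed.

(** Induction on [p]. Multiplied by [p.+1], the degree, the term of [al] splits into [al r] copies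
    for each [r], and lowering the entry [r] turns these into the expansion of [F (row r b :: _)].
    The bound [p <= k] ensures that no entry overflows. *)
Lemma multinomial (F : seq V -> V) (c : 'I_k -> R) p : (p <= k)%N ->
  symmetric_multilinear F ->
  (p`!)%:R^-1 *: F (nseq p (\sum_(r < k) c r *: row r b)) =
  \sum_(al : multi_index k | mdeg al == p) mcoef c al *: F (insert_powers b al).
Proof.
elim: p F => [|p IH] F pk sF.
  rewrite invr1 scale1r (big_pred1 [ffun=> ord0]) /= => [|al]; last first.
    apply/eqP/eqP => [/mdeg0_eq //|->]; rewrite /mdeg big1 // => i _.
    by rewrite ffunE.
  rewrite insert_powers0 /mcoef /multi_fact !big1 ?invr1 ?mulr1 ?scale1r // => i _.
    by rewrite ffunE expr0.
  by rewrite ffunE.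
have p1 : p.+1%:R != 0 :> R by rewrite pnatr_eq0.
apply: (scalerI p1); rewrite factS natrM invfM !scalerA mulrA mulfV // mul1r.
rewrite /= multilinear_sum // scaler_sumr.
transitivity (\sum_(al : multi_index k | mdeg al == p.+1) \sum_(r < k)
    (al r)%:R *: (mcoef c al *: F (insert_powers b al))); last first.
  rewrite scaler_sumr; apply: eq_bigr => al /eqP alp.
  by rewrite -scaler_suml -natr_sum -/(mdeg al) alp.
rewrite exchange_big /=; apply: eq_bigr => r _.
rewrite scalerA mulrC -scalerA (IH (fun vs => F (row r b :: vs))) 1?ltnW //; last first.
  exact: symmetric_multilinear_cons.
rewrite [RHS](bigID (fun al : multi_index k => 0 < al r)%N) /= [X in _ = _ + X]big1 ?addr0; last first.
  by move=> al /andP[_]; rewrite -leqNgt leqn0 => /eqP ->; rewrite scale0r.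
rewrite [RHS](reindex_onto (mi_incr r) (mi_decr r)) /=; last first.
  by move=> al /andP[_]; exact: mi_decrK.
rewrite scaler_sumr; apply: eq_big => [al|al /eqP alp].
  apply/eqP/andP => [alp|[/andP[/eqP d1 d2] _]].
    have alr : (al r < k)%N by apply: leq_ltn_trans (mdeg_coord_le al r) _; rewrite alp.
    by rewrite mdeg_incr // alp eqxx mi_incrE // eqxx addn1 mi_incrK // eqxx.
  have alr := mi_incr_overflow d2.
  by move: d1; rewrite mdeg_incr // => -[].
have alr : (al r < k)%N by apply: leq_ltn_trans (mdeg_coord_le al r) _; rewrite alp.
rewrite !scalerA mcoef_incr //; congr (_ *: _).
by have [pF _] := sF; apply: pF; rewrite perm_sym; exact: insert_powers_incr.
Qed.

Definition jet_poly (s : R) : V := \sum_(r < k) s ^+ r.+1 *: row r b.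

Lemma mcoef_jet (s : R) (al : multi_index k) :
  mcoef (fun r => s ^+ r.+1) al = (multi_fact al)%:R^-1 * s ^+ weight al.
Proof.
rewrite /mcoef; congr (_ * _); rewrite /weight.
elim/big_ind2: _ => [|x1 x2 y1 y2 -> ->|r _]; first by rewrite expr0.
  by rewrite exprD.
by rewrite exprM.
Qed.

Lemma multinomial_jet (F : seq V -> V) s : symmetric_multilinear F ->
  \sum_(p < k.+1) (p`!)%:R^-1 *: F (nseq p (jet_poly s)) =
  \sum_(al : multi_index k | (mdeg al <= k)%N)
    s ^+ weight al *: ((multi_fact al)%:R^-1 *: F (insert_powers b al)).
Proof.
move=> sF.
rewrite (partition_big (fun al : multi_index k => inord (mdeg al) : 'I_k.+1) xpredT) //=.
apply: eq_bigr => p _; rewrite multinomial //; last by rewrite -ltnS.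
apply: eq_big => [al|al _]; last by rewrite mcoef_jet scalerA mulrC.
apply/eqP/andP => [alp|[alk /eqP <-]]; last by rewrite inordK.
by rewrite alp -ltnS ltn_ord; split => //; apply/eqP/val_inj; rewrite /= inordK.
Qed.

End Multinomial.

(** * Polarization *)

Section Polarization.
Context {R : realType} {n : nat}.
Local Notation V := 'rV[R]_n.

Lemma binomial_multilinear (F : seq V -> V) (b w : V) (c : R) d :
  symmetric_multilinear F ->
  F (nseq d (b + c *: w)) =
  \sum_(i < d.+1) c ^+ i *: ('C(d, i)%:R *: F (nseq i w ++ nseq (d - i) b)).
Proof.
elim: d F => [|d IH] F sF.
  by rewrite big_ord_recl big_ord0 addr0 expr0 bin0 !scale1r.
have [pF lF] := sF.
pose G i := F (nseq i w ++ nseq (d.+1 - i) b).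
have GE i : F (nseq i w ++ nseq (d.+1 - i) b) = G i by [].
have -> : F (nseq d.+1 (b + c *: w)) =
    F (b :: nseq d (b + c *: w)) + c *: F (w :: nseq d (b + c *: w)).
  by rewrite /= [b + _]addrC lF addrC.
rewrite (IH (fun vs => F (b :: vs))) ?(IH (fun vs => F (w :: vs)));
  [|exact: symmetric_multilinear_cons..].
have -> : \sum_(i < d.+1) c ^+ i *: ('C(d, i)%:R *: F (b :: nseq i w ++ nseq (d - i) b)) =
    \sum_(i < d.+2) c ^+ i *: ('C(d, i)%:R *: G i).
  rewrite [RHS]big_ord_recr /= bin_small // scale0r scaler0 addr0.
  apply: eq_bigr => i _; congr (_ *: (_ *: _)); apply: pF.
  by rewrite subSn ?leq_ord //= -cat1s perm_catCA.
rewrite scaler_sumr [X in X + _ = _]big_ord_recl [RHS]big_ord_recl /=.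
rewrite !bin0 -addrA; congr (_ + _); rewrite -big_split /=; apply: eq_bigr => i _.
rewrite binS natrD scalerDl scalerDr; congr (_ + _).
by rewrite scalerA -exprS.
Qed.

(** A column of the inverse Vandermonde matrix at the nodes 0, ..., d recovers one coefficient of a
    polynomial of degree at most d from its values. *)
Lemma interpolation_coefs d (l : 'I_d.+1) : exists lam : 'I_d.+1 -> R,
  forall i : 'I_d.+1, \sum_(c < d.+1) lam c * c%:R ^+ i = (i == l)%:R.
Proof.
pose W : 'M[R]_d.+1 := Vandermonde d.+1 (\row_(c < d.+1) c%:R).
have uW : W \in unitmx.
  rewrite unitmxE det_Vandermonde unitfE; apply/prodf_neq0 => i _.
  apply/prodf_neq0 => j ij; rewrite !mxE subr_eq0 eqr_nat; apply/negP => /eqP ji.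
  by rewrite ji ltnn in ij.
exists (fun c => (invmx W) c l) => i.
have := mulmxV uW; move=> /matrixP /(_ i l); rewrite !mxE => <-.
by apply: eq_bigr => c _; rewrite !mxE mulrC.
Qed.

Lemma symmetric_multilinear_cat (F : seq V -> V) us : symmetric_multilinear F ->
  symmetric_multilinear (fun vs => F (us ++ vs)).
Proof.
move=> [pF lF]; split; first by move=> vs ws pvw; apply: pF; rewrite perm_cat2l.
move=> vs a x y; have E v : F (us ++ v :: vs) = F (v :: us ++ vs).
  by apply: pF; rewrite -(cat1s v vs) perm_catCA.
by rewrite !E lF.
Qed.

(** The coefficient of c in F[(b + c w)^(j+1)] is (j + 1) F[w, b^j], and interpolation writes it as
    a combination of values on equal arguments. Only natural numbers c occur, so [B] may be the
    countable set of rational vectors. *)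
Lemma polarization_closure (T : Type) (D : set T) (PV : (T -> V) -> Prop) (B : set V) :
  (forall f g, (forall t, D t -> f t = g t) -> PV f -> PV g) ->
  PV (fun=> 0) ->
  (forall f g, PV f -> PV g -> PV (fun t => f t + g t)) ->
  (forall (c : R) f, PV f -> PV (fun t => c *: f t)) ->
  B 0 -> (forall b w (c : nat), B b -> B w -> B (b + c%:R *: w)) ->
  forall (F : T -> seq V -> V) p,
  (forall t, D t -> symmetric_multilinear (F t)) ->
  (forall b, B b -> PV (fun t => F t (nseq p b))) ->
  forall vs, size vs = p -> (forall v, v \in vs -> B v) -> PV (fun t => F t vs).
Proof.
move=> Pext P0 PD PZ B0 BB F p mF Fp vs vsp Bvs.
suff H us : forall j, (j + size us = p)%N -> (forall v, v \in us -> B v) ->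
    forall b, B b -> PV (fun t => F t (nseq j b ++ us)).
  by have := H vs 0 vsp Bvs 0 B0.
elim: us => [|w us IH] j jp Bus b Bb.
  by apply: Pext (Fp b Bb) => t _; rewrite cats0 -jp addn0.
have Bw : B w by apply: Bus; rewrite inE eqxx.
have {}IH c : PV (fun t => F t (nseq j.+1 (b + c%:R *: w) ++ us)).
  apply: IH; last exact: BB; first by rewrite -jp /= addSnnS.
  by move=> v vus; apply: Bus; rewrite inE vus orbT.
have [lam Hlam] := @interpolation_coefs j.+1 (inord 1).
have PVsum (r : seq 'I_j.+2) (f : 'I_j.+2 -> T -> V) : (forall i, PV (f i)) ->
    PV (fun t => \sum_(i <- r) f i t).
  move=> Pf; elim: r => [|i r IHr].
    by apply: Pext P0 => t _; rewrite big_nil.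
  by apply: Pext (PD _ _ (Pf i) IHr) => t _; rewrite big_cons.
have Pall : PV (fun t => j.+1%:R^-1 *: \sum_(c < j.+2) lam c *: F t (nseq j.+1 (b + c%:R *: w) ++ us)).
  by apply: (PZ _ _ _); apply: PVsum => c; apply: (PZ _ _ _); exact: IH.
apply: Pext Pall => t Dt.
have [pF _] := mF t Dt.
pose G vs' := F t (us ++ vs').
have sG : symmetric_multilinear G.
  exact: symmetric_multilinear_cat (mF t Dt).
have GE vs' : F t (vs' ++ us) = G vs' by apply: pF; rewrite perm_catC.
have -> : F t (nseq j b ++ w :: us) = G (w :: nseq j b).
  by apply: pF; rewrite perm_catC cat_cons perm_sym -(cat1s w (nseq j b)) perm_catCA.
transitivity (j.+1%:R^-1 *: \sum_(i < j.+2) \sum_(c < j.+2) (lam c * c%:R ^+ i) *: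
   ('C(j.+1, i)%:R *: G (nseq i w ++ nseq (j.+1 - i) b))).
  congr (_ *: _); rewrite exchange_big; apply: eq_bigr => c _.
  rewrite GE (binomial_multilinear b w _ j.+1 sG) scaler_sumr.
  by apply: eq_bigr => i _; rewrite scalerA.
rewrite (bigD1 (inord 1)) //= [X in _ + X]big1 => [|i i1].
  by rewrite -scaler_suml Hlam eqxx scale1r addr0 inordK // bin1 scalerA mulVf
     ?pnatr_eq0 // scale1r subn1.
by rewrite -scaler_suml Hlam (negPf i1) scale0r.
Qed.

End Polarization.

(** * Differentiation along curves *)

Section MatrixCurves.
Context {R : realType}.

Lemma is_derive_mxP m n (f : R -> 'M[R]_(m, n)) (t : R) (d : 'M[R]_(m, n)) :
  is_derive t 1 f d <-> forall i j, is_derive t 1 (fun z => f z i j) (d i j).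
Proof.
split=> [[df <-] i j|H].
  by have [h1 h2] := derive_coord i j df; split.
have df : derivable f t 1 by apply/derivable_mxP => i j; have [] := H i j.
split => //; rewrite derive_mx //; apply/matrixP => i j; rewrite mxE.
by have [] := H i j.
Qed.

Lemma is_derive_scale m n (c : R -> R) (f : R -> 'M[R]_(m, n)) (t : R) (c' : R) (f' : 'M[R]_(m, n)) :
  is_derive t 1 c c' -> is_derive t 1 f f' ->
  is_derive t 1 (fun z => c z *: f z) (c' *: f t + c t *: f').
Proof.
move=> dc /is_derive_mxP df; apply/is_derive_mxP => i j.
have -> : (fun z => (c z *: f z) i j) = c * (fun z => f z i j).
  by apply/funext => z; rewrite mxE.
apply: is_derive_eq (is_deriveM dc (df i j)) _.
by rewrite !mxE addrC /GRing.scale /= [f t i j * c']mulrC.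
Qed.

Lemma is_derive_sum_fun (W : normedModType R) (I : Type) (r : seq I) (f : I -> R -> W)
    (t : R) (f' : I -> W) :
  (forall i, is_derive t 1 (f i) (f' i)) ->
  is_derive t 1 (fun z => \sum_(i <- r) f i z) (\sum_(i <- r) f' i).
Proof.
move=> H; elim: r => [|i r IH].
  rewrite big_nil (_ : (fun z => _) = cst 0); last by apply/funext => z; rewrite big_nil.
  exact: is_derive_cst.
rewrite big_cons (_ : (fun z => _) = f i + (fun z => \sum_(i <- r) f i z)).
  exact: is_deriveD.
by apply/funext => z; rewrite big_cons.
Qed.

Lemma is_derive_near_eq (W : normedModType R) (f g : R -> W) (t : R) (r : R) (d : W) :
  0 < r -> (forall z, `|z - t| < r -> f z = g z) ->
  is_derive t 1 f d -> is_derive t 1 g d.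
Proof.
by move=> r0 fg; apply: near_eq_is_derive; apply/near_approx; exists r.
Qed.

End MatrixCurves.

Lemma perm_swap2 (T : eqType) (a b : T) s : perm_eq [:: a, b & s] [:: b, a & s].
Proof. by rewrite -cat1s -(cat1s b) perm_catCA. Qed.

Section MultilinearCurve.
Context {R : realType} {n : nat}.
Local Notation V := 'rV[R]_n.
Implicit Types (F : R -> seq V -> V).

Lemma derivable_multilinear F (t0 r : R) p : 0 < r ->
  (forall t, `|t - t0| < r -> symmetric_multilinear (F t)) ->
  (forall w, size w = p -> derivable (fun t => F t (basis_word w)) t0 1) ->
  forall vs, size vs = p -> derivable (fun t => F t vs) t0 1.
Proof.
move=> r0 mF Fw vs vsp.
have -> : (fun t => F t vs) = (fun t => F t [seq v | v <- vs]) by rewrite map_id.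
apply: (@multilinear_closure R n R V [set t | `|t - t0| < r]
  (fun f => derivable f t0 1) (fun c => exists a, c = fun=> a) _ _ _ _ vs F (fun v t => v)).
- move=> f g fg; apply: near_eq_derivable; apply/near_approx; by exists r.
- exact: derivable_cst.
- by move=> f g df dg; exact: derivableD.
- by move=> _ f [a ->] df; exact: derivableZ.
- by [].
- by rewrite vsp.
- by move=> v i; exists (v ord0 i).
Qed.

(** Product rule, by expanding one argument in coordinates at a time; symmetry collects the [p]
    terms containing [v'], and the derivative of [F] itself appears with [v] frozen at [t0]. *)
Lemma is_derive_multilinear_curve F (t0 r : R) p (v : R -> V) (v' : V) : 0 < r ->
  (forall t, `|t - t0| < r -> symmetric_multilinear (F t)) ->
  (forall w, size w = p -> derivable (fun t => F t (basis_word w)) t0 1) ->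
  is_derive t0 1 v v' ->
  is_derive t0 1 (fun t => F t (nseq p (v t)))
    ('D_1 (fun t => F t (nseq p (v t0))) t0 + p%:R *: F t0 (v' :: nseq p.-1 (v t0))).
Proof.
move=> r0 + + dv; elim: p F => [|p IH] F mF Fw.
  by rewrite scale0r addr0; apply: derivableP; exact: (Fw [::]).
have mF0 : symmetric_multilinear (F t0) by apply: mF; rewrite subrr normr0.
have [pF0 _] := mF0.
pose Fi i t vs := F t (delta_mx ord0 i :: vs).
have mFi i t : `|t - t0| < r -> symmetric_multilinear (Fi i t).
  by move=> /mF; exact: symmetric_multilinear_cons.
have Fiw i w : size w = p -> derivable (fun t => Fi i t (basis_word w)) t0 1.
  by move=> wp; apply: (Fw (i :: w)); rewrite /= wp.
have dvi i : is_derive t0 1 (fun t => v t ord0 i) (v' ord0 i).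
  exact: ((is_derive_mxP v t0 v').1 dv).
apply: (@is_derive_near_eq _ _ (fun t => \sum_i v t ord0 i *: Fi i t (nseq p (v t))) _ t0 r) => //.
  by move=> t tr; rewrite /= -multilinear_expand //; exact: mF.
have := is_derive_sum_fun (index_enum 'I_n) (fun i => is_derive_scale (dvi i) (IH (Fi i) (mFi i) (Fiw i))).
move=> H; apply: (is_derive_eq H); rewrite big_split /= -multilinear_expand //.
clear H.
have dnp i : derivable (fun t => Fi i t (nseq p (v t0))) t0 1.
  by apply: (derivable_multilinear r0 (mFi i) (Fiw i)); rewrite size_nseq.
have E1 : 'D_1 (fun t => F t (nseq p.+1 (v t0))) t0 =
    \sum_i v t0 ord0 i *: 'D_1 (fun t => Fi i t (nseq p (v t0))) t0.
  have [_ <-] : is_derive t0 1 (fun t => \sum_i v t0 ord0 i *: Fi i t (nseq p (v t0)))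
      (\sum_i v t0 ord0 i *: 'D_1 (fun t => Fi i t (nseq p (v t0))) t0).
    apply: is_derive_sum_fun => i; apply: is_deriveZ; exact: derivableP.
  apply: near_eq_derive; apply/near_approx; exists r => // t tr.
  by rewrite -multilinear_expand //; exact: mF.
rewrite E1; under eq_bigr do rewrite scalerDr.
rewrite big_split /= addrCA; congr (_ + _).
have E2 : \sum_i v t0 ord0 i *: (p%:R *: Fi i t0 (v' :: nseq p.-1 (v t0))) =
    p%:R *: F t0 (v' :: nseq p (v t0)).
  under eq_bigr do rewrite scalerA mulrC -scalerA.
  rewrite -scaler_sumr -multilinear_expand //.
  case: p {IH Fw Fi mFi Fiw dnp E1} => [|p]; first by rewrite !scale0r.
  congr (_ *: _); apply: pF0.
  exact: perm_swap2.
by rewrite E2 -(natr1 p) scalerDl scale1r addrC.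
Qed.

End MultilinearCurve.

(** * Continuity and Taylor estimates along a curve *)

Section ContinuousOn.
Context {R : realType}.
Implicit Types (V W : normedModType R) (a b : R).

Definition cont_on V a b (f : R -> V) := forall t, a <= t -> t <= b ->
  forall e : R, 0 < e -> exists2 d : R, 0 < d & forall z, a <= z -> z <= b ->
    `|z - t| < d -> `|f z - f t| < e.

Lemma abs_continuous_cont_on V a b (f : R -> V) : abs_continuous a b f -> cont_on a b f.
Proof.
move=> /abs_continuous_modulus H t at_ tb e e0; have [d d0 Hd] := H e e0.
by exists d => // z az zb; exact: Hd.
Qed.

Lemma cont_onP V a b (f : R -> V) : cont_on a b f <-> {within `[a, b], continuous f}.
Proof.
split=> [cf|/subspace_continuousP cf t at_ tb e e0].
  apply/subspace_continuousP => t; rewrite /= in_itv /= => /andP[at_ tb].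
  apply/cvgrPdist_lt => e e0; have [d d0 H] := cf t at_ tb e e0.
  rewrite /within /=; suff : \forall z \near t, z \in `[a, b] -> `|f t - f z| < e by [].
  apply: (near_approx _ _).2; exists d => // z zt.
  by rewrite in_itv /= => /andP[az zb]; rewrite distrC; exact: H.
have tab : `[a, b]%classic t by rewrite /= in_itv /= at_.
have := cf t tab; move=> /cvgrPdist_lt /(_ e e0); rewrite /within /= => H.
have {}H : \forall z \near t, z \in `[a, b] -> `|f t - f z| < e by [].
have [d d0 {}H] := (near_approx _ _).1 H.
by exists d => // z az zb /H; rewrite in_itv /= az zb distrC; exact.
Qed.

Lemma cont_on_ext V a b (f g : R -> V) : (forall t, a <= t -> t <= b -> f t = g t) ->
  cont_on a b f -> cont_on a b g.
Proof.
move=> fg cf t at_ tb e e0; have [d d0 H] := cf t at_ tb e e0.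
by exists d => // z az zb; rewrite -!fg //; exact: H.
Qed.

Lemma cont_on_cst V a b (c : V) : cont_on a b (fun=> c).
Proof. by move=> t _ _ e e0; exists 1 => // z _ _ _; rewrite subrr normr0. Qed.

Lemma cont_onD V a b (f g : R -> V) : cont_on a b f -> cont_on a b g ->
  cont_on a b (fun t => f t + g t).
Proof.
move=> cf cg t at_ tb e e0; have e20 : 0 < e / 2 by rewrite divr_gt0.
have [d d0 H] := cf t at_ tb _ e20; have [d' d'0 H'] := cg t at_ tb _ e20.
exists (Num.min d d') => [|z az zb]; first by rewrite lt_min d0.
rewrite lt_min => /andP[/(H z az zb) h1 /(H' z az zb) h2].
rewrite opprD addrACA (le_lt_trans (ler_normD _ _)) //.
by move: h1 h2; clear; lra.
Qed.

Lemma cont_onZ V a b (c : R -> R) (f : R -> V) : cont_on a b c -> cont_on a b f ->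
  cont_on a b (fun t => c t *: f t).
Proof.
move=> /cont_onP /subspace_continuousP cc /cont_onP /subspace_continuousP cf.
apply/cont_onP/subspace_continuousP => t tab.
by apply: cvgZ; [exact: cc|exact: cf].
Qed.

Lemma cont_on_sum V a b (I : Type) (r : seq I) (P : pred I) (f : I -> R -> V) :
  (forall i, P i -> cont_on a b (f i)) ->
  cont_on a b (fun t => \sum_(i <- r | P i) f i t).
Proof.
move=> cf; elim: r => [|i r IH].
  by apply: (cont_on_ext _ (@cont_on_cst V a b 0)) => t _ _; rewrite big_nil.
case Pi : (P i); last by apply: (cont_on_ext _ IH) => t _ _; rewrite big_cons Pi.
by apply: (cont_on_ext _ (cont_onD (cf i Pi) IH)) => t _ _; rewrite big_cons Pi.
Qed.

Lemma cont_on_coord m n a b (f : R -> 'M[R]_(m, n)) i j :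
  cont_on a b f -> cont_on a b (fun t => f t i j).
Proof.
move=> cf t at_ tb e e0; have [d d0 H] := cf t at_ tb e e0.
exists d => // z az zb /(H z az zb); apply: le_lt_trans.
have -> : f z i j - f t i j = (f z - f t) i j by rewrite !mxE.
by rewrite [leRHS]mx_normrE; apply/bigmax_geP; right; exists (i, j).
Qed.

Lemma cont_on_bounded V a b (f : R -> V) : cont_on a b f ->
  exists2 C, 0 <= C & forall t, a <= t -> t <= b -> `|f t| <= C.
Proof.
move=> cf; have [ab|ba] := leP a b; last first.
  by exists 0 => // t at_ /(le_trans at_); rewrite leNgt ba.
apply: (@interval_induction R (fun x y => exists2 B, 0 <= B &
   forall t, x <= t -> t <= y -> `|f t| <= B)) => //.
- move=> x y z ax xy yz zb [B1 B10 h1] [B2 B20 h2].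
  exists (B1 + B2); first exact: addr_ge0.
  move=> t xt tz; have [ty|/ltW yt] := leP t y.
    by apply: le_trans (h1 t xt ty) _; rewrite lerDl.
  by apply: le_trans (h2 t yt tz) _; rewrite lerDr.
- move=> t at_ tb; have [d d0 H] := cf t at_ tb 1 ltr01.
  exists d => // x y ax xt ty yb tx yd.
  exists (1 + `|f t|) => [|z xz zy]; first by rewrite addr_ge0.
  have zt : `|f z - f t| < 1.
    apply: H => //; first exact: le_trans xz. exact: le_trans yb.
    by rewrite ltr_norml; apply/andP; split; move: xz zy tx yd; clear; lra.
  by rewrite -(subrK (f t) (f z)) (le_trans (ler_normD _ _)) // lerD2r ltW.
Qed.

Lemma cont_on_comp V W a b (x : R -> V) (g : V -> W) : cont_on a b x ->
  (forall t, a <= t -> t <= b -> {for x t, continuous g}) ->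
  cont_on a b (fun t => g (x t)).
Proof.
move=> cx cg t at_ tb e e0; have [d d0 H] := continuous_approx (cg t at_ tb) e0.
have [d' d'0 H'] := cx t at_ tb d d0; exists d' => // z az zb zt.
by apply: H; exact: H'.
Qed.

Lemma cont_onS V a b a' b' (f : R -> V) : a <= a' -> b' <= b ->
  cont_on a b f -> cont_on a' b' f.
Proof.
move=> aa bb cf t at_ tb e e0.
have [d d0 H] := cf t (le_trans aa at_) (le_trans tb bb) e e0.
by exists d => // z az zb; apply: H; [exact: le_trans az|exact: le_trans bb].
Qed.

End ContinuousOn.

(** * Taylor's formula, uniformly along a curve *)

Section Taylor.
Context {R : realType}.

(** Induction on [k]: the derivative of the remainder is the remainder of [phi 1], and the mean
    value theorem transfers its bound. Only the order matters later, so the factorial is not kept in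
    the bound. *)
Lemma taylor_scalar (phi : nat -> R -> R) k (C : R) :
  (forall p (r : R), (p < k)%N -> 0 <= r <= 1 -> is_derive r 1 (phi p) (phi p.+1 r)) ->
  (forall r : R, 0 <= r <= 1 -> `|phi k r| <= C) ->
  forall r : R, 0 <= r <= 1 ->
    `|phi 0 r - \sum_(p < k) (p`!)%:R^-1 * (r ^+ p * phi p 0)| <= C.
Proof.
elim: k phi => [|k IH] phi dphi Cphi r r01.
  by rewrite big_ord0 subr0; exact: Cphi.
have {}IH (z : R) : 0 <= z <= 1 ->
    `|phi 1 z - \sum_(p < k) (p`!)%:R^-1 * (z ^+ p * phi p.+1 0)| <= C.
  by apply: (IH (fun p => phi p.+1)) => [p s pk|s s01]; [exact: dphi|exact: Cphi].
have C0 : 0 <= C by apply: le_trans (Cphi r r01).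
pose g (z : R) := phi 0 z - \sum_(p < k.+1) (p`!)%:R^-1 * (z ^+ p * phi p 0).
have dg (z : R) : 0 <= z <= 1 -> is_derive z 1 g
    (phi 1 z - \sum_(p < k) (p`!)%:R^-1 * (z ^+ p * phi p.+1 0)).
  move=> z01; apply: is_deriveB; first exact: dphi.
  pose h (p : 'I_k.+1) (z : R) := (p`!)%:R^-1 * phi p 0 * z ^+ p.
  have dh (p : 'I_k.+1) : is_derive z 1 (h p) ((p`!)%:R^-1 * phi p 0 * (p%:R * z ^+ p.-1)).
    have hE : h p = ((p`!)%:R^-1 * phi p 0) *: (fun z : R => z ^+ p) by apply/funext.
    have dX : is_derive z 1 (fun z : R => z ^+ p) (p%:R * z ^+ p.-1).
      split; first exact: exprn_derivable.
      by rewrite exp_derive /GRing.scale /= mulr1.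
    by rewrite hE; exact: is_deriveZ.
  have := is_derive_sum_fun (index_enum 'I_k.+1) dh.
  have -> : (fun z => \sum_(i <- index_enum 'I_k.+1) h i z) =
            (fun z => \sum_(p < k.+1) (p`!)%:R^-1 * (z ^+ p * phi p 0)).
    by apply/funext => y; apply: eq_bigr => p _; rewrite /h -mulrA [phi _ _ * _]mulrC.
  move=> H; apply: (is_derive_eq H); rewrite big_ord_recl mul0r mulr0 add0r; apply: eq_bigr => p _.
  rewrite /= (_ : bump 0 p = p.+1) // factS natrM invfM.
  have p1 : p.+1%:R != 0 :> R by rewrite pnatr_eq0.
  move: p1; move: (p.+1%:R) (p`!%:R^-1) (phi p.+1 0) (z ^+ p) => P Q a c P0.
  by field.
have r0 : 0 <= r by case/andP: r01.
have [c] : exists2 c, c \in `[0, r] & g r - g 0 =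
    (phi 1 c - \sum_(p < k) (p`!)%:R^-1 * (c ^+ p * phi p.+1 0)) * (r - 0).
  apply: MVT_segment => //.
    move=> z; rewrite in_itv /= => /andP[z0 zr]; apply: dg; rewrite (ltW z0) /=.
    by case/andP: r01 => _; apply: le_trans; exact: ltW.
  apply: derivable_within_continuous => z; rewrite in_itv /= => /andP[z0 zr].
  have z01 : 0 <= z <= 1 by rewrite z0 /=; case/andP: r01 => _; exact: le_trans.
  by have [] := dg z z01.
rewrite in_itv /= => /andP[c0 cr].
have -> : g 0 = 0.
  rewrite /g big_ord_recl /= fact0 invr1 expr0 !mul1r big1 ?addr0 ?subrr // => p _.
  by rewrite expr0n /= mul0r mulr0.
rewrite !subr0 => gE; rewrite -/(g r) gE normrM (ger0_norm r0).
have c01 : 0 <= c <= 1 by rewrite c0 /=; case/andP: r01 => _; exact: le_trans.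
apply: le_trans (ler_pM _ _ (IH c c01) (proj2 (andP r01))) _ => //.
by rewrite mulr1.
Qed.

Context {n : nat}.
Local Notation V := 'rV[R]_n.

Lemma taylor_bound (U : set V) (f : V -> V) (x v : V) k (C : R) : 0 <= C ->
  smooth_on U f -> (forall r : R, 0 <= r <= 1 -> U (x + r *: v)) ->
  (forall r : R, 0 <= r <= 1 -> `|iter_derive (nseq k v) f (x + r *: v)| <= C) ->
  `|f (x + v) - \sum_(p < k) (p`!)%:R^-1 *: iter_derive (nseq p v) f x| <= C.
Proof.
move=> C0 sf Ur Cr; rewrite [leLHS]mx_normrE; apply: bigmax_le => // -[i j] _ /=.
pose phi p (r : R) := (iter_derive (nseq p v) f (x + r *: v)) i j.
have := @taylor_scalar phi k C _ _ 1 _.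
rewrite /phi !scale1r /= !mxE summxE.
have -> : \sum_(p < k) (p`!)%:R^-1 * (1 ^+ p * (iter_derive (nseq p v) f (x + 0 *: v)) i j) =
    \sum_(p < k) ((p`!)%:R^-1 *: iter_derive (nseq p v) f x) i j.
  by apply: eq_bigr => p _; rewrite mxE expr1n mul1r scale0r addr0.
apply; last by rewrite ler01 lexx.
  move=> p r _ /Ur Uxr.
  apply: ((is_derive_mxP (fun r => iter_derive (nseq p v) f (x + r *: v)) r _).1).
  apply: is_derive_line; apply: diff_derivable; exact: sf.
move=> r /Cr; apply: le_trans.
by rewrite [leRHS]mx_normrE; apply/bigmax_geP; right; exists (i, j).
Qed.

(** There are finitely many basis words of length [p], so continuity of these derivatives at [x]
    gives one common radius. *)
Lemma iter_derive_locally_bounded (U : set V) (f : V -> V) (x : V) p :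
  open U -> smooth_on U f -> U x ->
  exists2 r : R, 0 < r & U `&` [set z | `|z - x| < r] = [set z | `|z - x| < r] /\
    multibounded [set z | `|z - x| < r] (fun z vs => iter_derive vs f z) p.
Proof.
move=> oU sf Ux.
have [r0 r00 HU] := open_approx oU Ux.
have /near_approx[r1 r10 H1] : \forall y \near x, forall w : p.-tuple 'I_n,
    `|iter_derive (basis_word w) f y - iter_derive (basis_word w) f x| < 1.
  apply: (@filter_forall V _ (fun (w : p.-tuple 'I_n) y =>
    `|iter_derive (basis_word w) f y - iter_derive (basis_word w) f x| < 1) (nbhs x) (nbhs_filter x)) => w.
  apply: (near_approx x (fun y =>
    `|iter_derive (basis_word w) f y - iter_derive (basis_word w) f x| < 1)).2.
  exact: (continuous_approx (differentiable_continuous (sf (basis_word w) x Ux)) ltr01).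
exists (Num.min r0 r1); first by rewrite lt_min r00.
split.
  apply/seteqP; split => [z []//|z zr]; split => //; apply: HU.
  by move: zr; rewrite /= lt_min => /andP[].
apply: (@multibounded_words R n V [set z | `|z - x| < Num.min r0 r1]
    (fun z vs => iter_derive vs f z) p).
  move=> z; rewrite /= lt_min => /andP[/HU Uz _]; exact: (iter_derive_symmetric oU sf).
move=> w wp; exists (1 + `|iter_derive (basis_word w) f x|) => z /=.
rewrite lt_min => /andP[_ /H1].
have wpE : size w == p by rewrite wp.
move=> /(_ (Tuple wpE)) /= /ltW h.
by rewrite -(subrK (iter_derive (basis_word w) f x) (iter_derive _ f z)) (le_trans (ler_normD _ _)) // lerD2r.
Qed.

(** [interval_induction] spreads the local bounds over the curve, with one radius and one constant
    for all times. *)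
Lemma tube_bounded (U : set V) (f : V -> V) (x : R -> V) (a b : R) p :
  open U -> smooth_on U f -> cont_on a b x -> (forall t, a <= t -> t <= b -> U (x t)) ->
  exists2 r : R, 0 < r & exists2 C, 0 <= C & forall t z, a <= t -> t <= b ->
    `|z - x t| < r -> U z /\ forall vs, size vs = p ->
    `|iter_derive vs f z| <= C * \prod_(v <- vs) `|v|.
Proof.
move=> oU sf cx Ux; have [ab|ba] := leP a b; last first.
  by exists 1 => //; exists 0 => // t z at_ /(le_trans at_); rewrite leNgt ba.
apply: (@interval_induction R (fun y y' => exists2 r : R, 0 < r &
  exists2 C, 0 <= C & forall t z, y <= t -> t <= y' ->
    `|z - x t| < r -> U z /\ forall vs, size vs = p ->
    `|iter_derive vs f z| <= C * \prod_(v <- vs) `|v|)) => //.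
- move=> y y' y'' _ _ _ _ [r1 r10 [C1 C10 H1]] [r2 r20 [C2 C20 H2]].
  exists (Num.min r1 r2); first by rewrite lt_min r10.
  exists (C1 + C2) => [|t z yt ty]; first exact: addr_ge0.
  rewrite lt_min => /andP[z1 z2]; have [ty'|/ltW y't] := leP t y'.
    have [Uz Hz] := H1 t z yt ty' z1; split => // vs vsp.
    apply: le_trans (Hz vs vsp) _; rewrite ler_wpM2r ?lerDl //.
    by apply: prodr_ge0 => v _.
  have [Uz Hz] := H2 t z y't ty z2; split => // vs vsp.
  apply: le_trans (Hz vs vsp) _; rewrite ler_wpM2r ?lerDr //.
  by apply: prodr_ge0 => v _.
- move=> t at_ tb; have [r r0 [HU [C C0 HC]]] := iter_derive_locally_bounded p oU sf (Ux t at_ tb).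
  have r20 : 0 < r / 2 by rewrite divr_gt0.
  have [d d0 Hd] := cx t at_ tb _ r20.
  exists d => // y y' ay yt ty y'b ty1 y't1.
  exists (r / 2) => //; exists C => // t' z yt' t'y' zt'.
  have zr : `|z - x t| < r.
    rewrite -(subrK (x t') z) -addrA (le_lt_trans (ler_normD _ _)) //.
    have : `|x t' - x t| < r / 2.
      apply: Hd; [exact: le_trans yt'|exact: le_trans y'b|].
      by rewrite ltr_norml; apply/andP; split; move: yt' t'y' ty1 y't1; clear; lra.
    by move: zt'; clear; lra.
  split.
    have : (U `&` [set z | `|z - x t| < r]) z by rewrite HU.
    by case.
  by move=> vs vsp; exact: HC.
Qed.

Lemma taylor_tube (U : set V) (f : V -> V) (x : R -> V) (a b : R) k :
  open U -> smooth_on U f -> cont_on a b x -> (forall t, a <= t -> t <= b -> U (x t)) ->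
  exists2 r : R, 0 < r & exists2 C, 0 <= C & forall t v, a <= t -> t <= b -> `|v| < r ->
    U (x t + v) /\
    `|f (x t + v) - \sum_(p < k) (p`!)%:R^-1 *: iter_derive (nseq p v) f (x t)|
       <= C * `|v| ^+ k.
Proof.
move=> oU sf cx Ux; have [r r0 [C C0 H]] := tube_bounded k oU sf cx Ux.
exists r => //; exists C => // t v at_ tb vr.
have zr (c : R) : 0 <= c <= 1 -> `|x t + c *: v - x t| < r.
  move=> /andP[c0 c1]; rewrite addrAC subrr add0r normrZ ger0_norm //.
  by apply: le_lt_trans vr; rewrite ler_piMl.
split.
  have := H t (x t + v) at_ tb; rewrite addrAC subrr add0r => h.
  exact: (h vr).1.
apply: (taylor_bound (U := U)).
- by rewrite mulr_ge0 // exprn_ge0.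
- exact: sf.
- by move=> c c01; have [] := H t _ at_ tb (zr c c01).
- move=> c c01; have [_ /(_ (nseq k v))] := H t _ at_ tb (zr c c01).
  by rewrite size_nseq big_nseq iter_mulr_1 => /(_ erefl).
Qed.

End Taylor.

(** * Expansions in powers of s *)

Section UniformAsymptotics.
Context {R : realType} {T : Type}.
Implicit Types (V W : normedModType R) (D : set T).

(** The parameter type is arbitrary: besides time it is [unit] when a single jet is considered, and
    a pair when a second small quantity is frozen. *)
Definition unif_O V D (m : nat) (h : R -> T -> V) := exists2 C : R, 0 <= C &
  exists2 d : R, 0 < d & forall s t, `|s| < d -> D t -> `|h s t| <= C * `|s| ^+ m.

Definition unif_o V D (m : nat) (h : R -> T -> V) := forall e : R, 0 < e ->
  exists2 d : R, 0 < d & forall s t, `|s| < d -> D t -> `|h s t| <= e * `|s| ^+ m.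

Lemma unif_O_o V D m (h : R -> T -> V) : unif_O D m.+1 h -> unif_o D m h.
Proof.
move=> [C C0 [d d0 H]] e e0.
have C1 : 0 < C + 1 by apply: ltr_wpDl.
exists (Num.min d (e / (C + 1))); first by rewrite lt_min d0 divr_gt0.
move=> s t; rewrite lt_min => /andP[sd se] Dt; apply: le_trans (H s t sd Dt) _.
rewrite exprS mulrA ler_wpM2r ?exprn_ge0 //.
apply: (@le_trans _ _ ((C + 1) * `|s|)); first by rewrite ler_wpM2r // lerDl.
by rewrite mulrC -ler_pdivlMr // ltW.
Qed.

Lemma unif_o_weaken V D m m' (h : R -> T -> V) : (m' <= m)%N -> unif_o D m h -> unif_o D m' h.
Proof.
move=> mm H e e0; have [d d0 {}H] := H e e0; exists (Num.min d 1).
  by rewrite lt_min d0 ltr01.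
move=> s t; rewrite lt_min => /andP[sd s1] Dt; apply: le_trans (H s t sd Dt) _.
by apply: ler_wpM2l; [exact: ltW|apply: ler_wiXn2l => //; exact: ltW].
Qed.

Lemma unif_O_weaken V D m m' (h : R -> T -> V) : (m' <= m)%N -> unif_O D m h -> unif_O D m' h.
Proof.
move=> mm [C C0 [d d0 H]]; exists C => //; exists (Num.min d 1).
  by rewrite lt_min d0 ltr01.
move=> s t; rewrite lt_min => /andP[sd s1] Dt; apply: le_trans (H s t sd Dt) _.
by apply: ler_wpM2l => //; apply: ler_wiXn2l => //; exact: ltW.
Qed.

Lemma unif_o_eq V D m (h g : R -> T -> V) :
  (exists2 d : R, 0 < d & forall s t, `|s| < d -> D t -> h s t = g s t) ->
  unif_o D m h -> unif_o D m g.
Proof.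
move=> [d d0 hg] H e e0; have [d' d'0 {}H] := H e e0.
exists (Num.min d d') => [|s t]; first by rewrite lt_min d0.
by rewrite lt_min => /andP[sd sd'] Dt; rewrite -hg //; exact: H.
Qed.

Lemma unif_o_ext V D m (h g : R -> T -> V) :
  (forall s t, D t -> h s t = g s t) -> unif_o D m h -> unif_o D m g.
Proof.
by move=> hg; apply: unif_o_eq; exists 1 => // s t _; exact: hg.
Qed.

Lemma unif_oD V D m (h g : R -> T -> V) : unif_o D m h -> unif_o D m g ->
  unif_o D m (fun s t => h s t + g s t).
Proof.
move=> H G e e0; have e20 : 0 < e / 2 by rewrite divr_gt0.
have [d d0 {}H] := H _ e20; have [d' d'0 {}G] := G _ e20.
exists (Num.min d d') => [|s t]; first by rewrite lt_min d0.
rewrite lt_min => /andP[sd sd'] Dt; apply: le_trans (ler_normD _ _) _.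
have := H s t sd Dt; have := G s t sd' Dt; set z := _ ^+ m; clear; lra.
Qed.

Lemma unif_oN V D m (h : R -> T -> V) : unif_o D m h -> unif_o D m (fun s t => - h s t).
Proof.
move=> H e e0; have [d d0 {}H] := H e e0; exists d => // s t.
by rewrite normrN; exact: H.
Qed.

Lemma unif_oB V D m (h g : R -> T -> V) : unif_o D m h -> unif_o D m g ->
  unif_o D m (fun s t => h s t - g s t).
Proof. by move=> H G; apply: unif_oD => //; exact: unif_oN. Qed.

Lemma unif_o0 V D m : unif_o D m (fun (_ : R) (_ : T) => 0 : V).
Proof.
move=> e e0; exists 1 => // s t _ _; rewrite normr0 mulr_ge0 ?exprn_ge0 //.
exact: ltW.
Qed.

Lemma unif_o_dominated V W D m (h : R -> T -> V) (g : R -> T -> W) (C : R) :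
  (exists2 d : R, 0 < d & forall s t, `|s| < d -> D t -> `|h s t| <= C * `|g s t|) ->
  unif_o D m g -> unif_o D m h.
Proof.
move=> [d d0 hg] G e e0.
have C0 : 0 < `|C| + 1 by apply: ltr_wpDl.
have [d' d'0 {}G] := G (e / (`|C| + 1)) (divr_gt0 e0 C0).
exists (Num.min d d') => [|s t]; first by rewrite lt_min d0.
rewrite lt_min => /andP[sd sd'] Dt; apply: le_trans (hg s t sd Dt) _.
apply: (@le_trans _ _ ((`|C| + 1) * `|g s t|)).
  by rewrite ler_wpM2r // (le_trans (ler_norm C)) // lerDl.
by rewrite -ler_pdivlMl // mulrA [_^-1 * e]mulrC; exact: G.
Qed.

Lemma unif_o_sum V D m (I : Type) (r : seq I) (P : pred I) (h : I -> R -> T -> V) :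
  (forall i, P i -> unif_o D m (h i)) ->
  unif_o D m (fun s t => \sum_(i <- r | P i) h i s t).
Proof.
move=> H; elim: r => [|i r IH].
  by apply: (unif_o_ext _ (@unif_o0 V D m)) => s t _; rewrite big_nil.
case Pi : (P i); last by apply: (unif_o_ext _ IH) => s t _; rewrite big_cons Pi.
by apply: (unif_o_ext _ (unif_oD (H i Pi) IH)) => s t _; rewrite big_cons Pi.
Qed.

Lemma unif_oZ V D m (c : R) (h : R -> T -> V) : unif_o D m h ->
  unif_o D m (fun s t => c *: h s t).
Proof.
apply: (unif_o_dominated (C := `|c|)); exists 1 => // s t _ _.
by rewrite normrZ.
Qed.

Lemma unif_OD V D m (h g : R -> T -> V) : unif_O D m h -> unif_O D m g ->
  unif_O D m (fun s t => h s t + g s t).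
Proof.
move=> [C C0 [d d0 H]] [C' C'0 [d' d'0 G]]; exists (C + C'); first exact: addr_ge0.
exists (Num.min d d') => [|s t]; first by rewrite lt_min d0.
rewrite lt_min => /andP[sd sd'] Dt; apply: le_trans (ler_normD _ _) _.
by rewrite mulrDl lerD ?H ?G.
Qed.

Lemma unif_O_sum V D m (I : Type) (r : seq I) (P : pred I) (h : I -> R -> T -> V) :
  (forall i, P i -> unif_O D m (h i)) ->
  unif_O D m (fun s t => \sum_(i <- r | P i) h i s t).
Proof.
move=> H; elim: r => [|i r [C C0 [d d0 IH]]].
  exists 0 => //; exists 1 => // s t _ _.
  by rewrite big_nil normr0 mul0r.
case Pi : (P i); last by exists C => //; exists d => // s t sd Dt; rewrite big_cons Pi; exact: IH.
have [|C' C'0 [d' d'0 G]] := unif_OD (H i Pi) (_ : unif_O D m (fun s t => \sum_(i <- r | P i) h i s t)).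
  by exists C => //; exists d.
by exists C' => //; exists d' => // s t sd Dt; rewrite big_cons Pi; exact: G.
Qed.

Lemma unif_O_pow V D m c (g : T -> V) : (m <= c)%N ->
  (exists C : R, forall t, D t -> `|g t| <= C) -> unif_O D m (fun s t => s ^+ c *: g t).
Proof.
move=> mc [C HC]; exists `|C| => //; exists 1 => // s t s1 Dt.
rewrite normrZ normrX mulrC; apply: ler_pM => //.
- by apply: le_trans (HC t Dt) _; exact: ler_norm.
- by apply: ler_wiXn2l => //; exact: ltW.
Qed.

End UniformAsymptotics.

(** Letting s tend to 0 kills the constant coefficient, then one divides by s. With [k] coefficients
    the top degree is [k.-1], hence the exponent of the allowed error. *)
Lemma poly_coef_unique (R : realType) (V : normedModType R) k (c : nat -> V) :
  (forall e : R, 0 < e -> exists2 d : R, 0 < d & forall s, 0 < s -> s < d ->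
     `|\sum_(m < k) s ^+ m *: c m| <= e * s ^+ k.-1) ->
  forall m, (m < k)%N -> c m = 0.
Proof.
elim: k c => [|k IH] c H m //.
pose M := \sum_(m < k) `|c m.+1|.
have M0 : 0 <= M by apply: sumr_ge0.
have c0 : c 0 = 0.
  apply/eqP; rewrite -normr_le0; apply/ler_addgt0Pr => e e0; rewrite add0r.
  have e20 : 0 < e / 2 by rewrite divr_gt0.
  have [d d0 {}H] := H _ e20.
  have M1 : 0 < M + 1 by apply: ltr_wpDl.
  pose s := Num.min (Num.min (d / 2) 1) (e / 2 / (M + 1)).
  have s0 : 0 < s by rewrite !lt_min divr_gt0 // ltr01 divr_gt0.
  have sd : s < d by rewrite /s !gt_min ltr_pdivrMr // ltr_pMr // ltr1n.
  have s1 : s <= 1 by rewrite /s !ge_min lexx orbT.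
  have se : s * (M + 1) <= e / 2 by rewrite -ler_pdivlMr // /s ge_min lexx orbT.
  have := H s s0 sd; rewrite big_ord_recl expr0 scale1r => h.
  set S := \sum_(i < k) _ in h.
  have hS : `|S| <= s * M.
    rewrite /S mulr_sumr; apply: le_trans (ler_norm_sum _ _ _) _; apply: ler_sum => i _.
    rewrite normrZ ger0_norm ?exprn_ge0 ?(ltW s0) // (_ : lift ord0 i = i.+1 :> nat) //.
    rewrite ler_wpM2r // exprS; apply: ler_piMr; first exact: ltW.
    by apply: exprn_ile1 => //; exact: ltW.
  have sk : e / 2 * s ^+ k <= e / 2.
    by apply: ler_piMr; [exact: ltW|apply: exprn_ile1 => //; exact: ltW].
  have -> : c 0 = (c 0 + S) - S by rewrite addrK.
  apply: le_trans (ler_normB _ _) _.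
  have : s * M <= s * (M + 1) by rewrite ler_wpM2l ?ltW // ltrDl.
  by move: h hS sk se; rewrite /=; clear; lra.
case: m => [//|m] mk; apply: (IH (fun m => c m.+1)) mk => e e0.
have [d d0 {}H] := H e e0; exists d => // s s0 sd.
have := H s s0 sd; rewrite big_ord_recl /= c0 scaler0 add0r.
have -> : \sum_(i < k) s ^+ lift ord0 i *: c (lift ord0 i) = s *: \sum_(i < k) s ^+ i *: c i.+1.
  rewrite scaler_sumr; apply: eq_bigr => i _; rewrite scalerA -exprS.
  by rewrite (_ : lift ord0 i = i.+1 :> nat).
case: k {IH M M0 H} => [|k]; first by rewrite !big_ord0 normr0 mulr1 => _; exact: ltW.
rewrite normrZ (gtr0_norm s0) exprS mulrCA ler_pM2l //.
Qed.

(** * Taylor sums evaluated on jets *)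

Section JetExpansion.
Context {R : realType} {n k : nat}.
Local Notation V := 'rV[R]_n.

Lemma nseq_lipschitz (F : seq V -> V) p (C M : R) (v w : V) :
  symmetric_multilinear F -> 0 <= C ->
  (forall vs, size vs = p -> `|F vs| <= C * \prod_(z <- vs) `|z|) ->
  `|v| <= M -> `|w| <= M ->
  `|F (nseq p v) - F (nseq p w)| <= C * p%:R * M ^+ p.-1 * `|v - w|.
Proof.
move=> sF C0 HF vM wM; rewrite multilinear_nseqB //.
have M0 : 0 <= M by exact: le_trans vM.
apply: le_trans (ler_norm_sum _ _ _) _.
have -> : C * p%:R * M ^+ p.-1 * `|v - w| = \sum_(i < p) (C * (`|v - w| * M ^+ p.-1)).
  by rewrite sumr_const card_ord -mulr_natr; ring.
apply: ler_sum => i _.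
have ip : (i <= p.-1)%N by have := ltn_ord i; lia.
apply: le_trans (HF _ _) _.
  by rewrite /= size_cat !size_nseq subnKC // prednK //; have := ltn_ord i; lia.
rewrite big_cons big_cat /= !big_nseq !iter_mulr_1 ler_wpM2l // ler_wpM2l //.
rewrite -(subnKC ip) exprD addKn; apply: ler_pM;
  rewrite ?exprn_ge0 // lerXn2r // nnegrE //.
Qed.

(** For [c <= k], the coefficient of [s ^+ c] in [taylor_sum F (jet_poly b s)]; the rows of
    [adapted_transform F b] are those with c = 1, ..., k. *)
Definition jet_coef (c : nat) (F : seq V -> V) (b : 'M[R]_(k, n)) : V :=
  \sum_(al : multi_index k | weight al == c)
    (multi_fact al)%:R^-1 *: F (insert_powers b al).

Definition taylor_sum (F : seq V -> V) (v : V) : V :=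
  \sum_(p < k.+1) (p`!)%:R^-1 *: F (nseq p v).

Context {T : Type}.
Implicit Types (D : set T) (F : T -> seq V -> V) (B : T -> 'M[R]_(k, n)).

Lemma bounded_insert_powers D F B al :
  (forall p, (p <= k)%N -> multibounded D F p) -> (mdeg al <= k)%N ->
  (exists2 C : R, 0 <= C & forall t, D t -> `|B t| <= C) ->
  exists C : R, forall t, D t -> `|F t (insert_powers (B t) al)| <= C.
Proof.
move=> bF alk [C C0 HC]; have [CF CF0 HF] := bF _ alk.
exists (CF * C ^+ mdeg al) => t Dt.
apply: le_trans (HF t _ Dt (size_insert_powers _ _)) _; rewrite ler_wpM2l //.
rewrite -(size_insert_powers (B t)).
have : all (fun v : V => `|v| <= C) (insert_powers (B t) al).
  rewrite /insert_powers; elim: (enum _) => [|i r IH] //=.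
  rewrite all_cat IH andbT all_nseq; apply/orP; right; apply: le_trans (HC t Dt).
  rewrite [leLHS]mx_normrE; apply: bigmax_le => // -[i' j] _ /=; rewrite mxE.
  by rewrite [leRHS]mx_normrE; apply/bigmax_geP; right; exists (i, j).
elim: (insert_powers _ _) => [|v vs IH] /=; first by rewrite big_nil.
by move=> /andP[vC /IH h]; rewrite big_cons exprS; apply: ler_pM => //; exact: prodr_ge0.
Qed.

Lemma taylor_sum_jet D F B : (forall t, D t -> symmetric_multilinear (F t)) ->
  (forall p, (p <= k)%N -> multibounded D F p) ->
  (exists2 C : R, 0 <= C & forall t, D t -> `|B t| <= C) ->
  unif_O D k.+1 (fun s t => taylor_sum (F t) (jet_poly (B t) s) -
     \sum_(c < k.+1) s ^+ c *: jet_coef c (F t) (B t)).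
Proof.
move=> sF bF bB.
have H : unif_O D k.+1 (fun s t =>
    \sum_(al : multi_index k | (mdeg al <= k)%N && (k < weight al)%N)
    s ^+ weight al *: ((multi_fact al)%:R^-1 *: F t (insert_powers (B t) al))).
  apply: unif_O_sum => al /andP[alk kw]; apply: unif_O_pow => //.
  have [C HC] := bounded_insert_powers bF alk bB.
  exists (`|(multi_fact al)%:R^-1| * C) => t Dt; rewrite normrZ ler_wpM2l //.
  exact: HC.
have [C C0 [d d0 {}H]] := H; exists C => //; exists d => // s t sd Dt.
have := H s t sd Dt; congr (`|_| <= _).
rewrite /taylor_sum multinomial_jet; last exact: sF.
rewrite [X in _ = X - _](bigID (fun al : multi_index k => (weight al <= k)%N)) /=.
apply/eqP; rewrite eq_sym subr_eq addrC; apply/eqP; congr (_ + _).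
  by apply: eq_bigl => al; rewrite -ltnNge.
rewrite (partition_big (fun al : multi_index k => inord (weight al) : 'I_k.+1) xpredT) //=.
apply: eq_bigr => c _; rewrite /jet_coef scaler_sumr; apply: eq_big.
  move=> al; apply/andP/eqP => [[/andP[_ wk] /eqP <-]|wc]; first by rewrite inordK.
  have wk : (weight al <= k)%N by rewrite wc -ltnS.
  rewrite wk (leq_trans (weight_ge_mdeg al) wk); split => //.
  by apply/eqP/val_inj; rewrite /= inordK.
by move=> al /andP[/andP[_ wk] /eqP <-]; rewrite inordK.
Qed.

(** In the telescoped difference of the p-linear terms one argument is [v - w] and the other p - 1
    are O(s). If [F] vanishes on lists shorter than [q], every surviving term thus gains at least
    [q.-1] orders. *)
Lemma taylor_sum_lipschitz D F (v w : R -> T -> V) q m :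
  (forall t, D t -> symmetric_multilinear (F t)) ->
  (forall p, (p <= k)%N -> multibounded D F p) ->
  (forall t vs, D t -> (size vs < q)%N -> F t vs = 0) ->
  unif_O D 1 v -> unif_O D 1 w -> unif_o D m (fun s t => v s t - w s t) ->
  unif_o D (m + q.-1) (fun s t => taylor_sum (F t) (v s t) - taylor_sum (F t) (w s t)).
Proof.
move=> sF bF Fq [Cv Cv0 [dv dv0 Hv]] [Cw Cw0 [dw dw0 Hw]] vw.
apply: (@unif_o_ext _ _ _ _ _ (fun s t => \sum_(p < k.+1)
    (p`!)%:R^-1 *: (F t (nseq p (v s t)) - F t (nseq p (w s t))))).
  move=> s t _; rewrite /taylor_sum -sumrB; apply: eq_bigr => p _.
  by rewrite scalerBr.
apply: unif_o_sum => p _; apply: unif_oZ.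
have [C C0 HC] := bF p (ltn_ord p).
have [pq|qp] := ltnP p q.
  apply: (unif_o_ext _ (@unif_o0 R T V D (m + q.-1))) => s t Dt.
  by rewrite !Fq ?size_nseq // subrr.
pose M := Cv + Cw.
have M0 : 0 <= M by exact: addr_ge0.
move=> e e0.
have K0 : 0 < C * p%:R * M ^+ p.-1 + 1 by apply: ltr_wpDl; rewrite // !mulr_ge0 ?exprn_ge0.
have [d d0 Hd] := vw _ (divr_gt0 e0 K0).
exists (Num.min d (Num.min (Num.min dv dw) 1)).
  by rewrite !lt_min d0 dv0 dw0 ltr01.
move=> s t; rewrite !lt_min => /and3P[sd /andP[sv sw] s1] Dt.
have vM : `|v s t| <= M * `|s|.
  by apply: le_trans (Hv s t sv Dt) _; rewrite expr1 ler_wpM2r // lerDl.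
have wM : `|w s t| <= M * `|s|.
  by apply: le_trans (Hw s t sw Dt) _; rewrite expr1 ler_wpM2r // lerDr.
apply: le_trans (nseq_lipschitz (sF t Dt) C0 (fun vs => HC t vs Dt) vM wM) _.
have h := Hd s t sd Dt.
rewrite exprMn [`|s| ^+ (m + _)]exprD.
have qp1 : (q.-1 <= p.-1)%N by rewrite -!subn1 leq_sub2r.
have sq : `|s| ^+ p.-1 <= `|s| ^+ q.-1 by apply: ler_wiXn2l; [exact: normr_ge0|exact: ltW|].
have a0 : 0 <= C * p%:R * M ^+ p.-1 by rewrite !mulr_ge0 ?exprn_ge0.
have S0 : 0 <= `|s| ^+ p.-1 by rewrite exprn_ge0.
have sm0 : 0 <= `|s| ^+ m by rewrite exprn_ge0.
have sq0 : 0 <= `|s| ^+ q.-1 by rewrite exprn_ge0.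
rewrite mulrA; move: a0 K0 h S0 sq sm0 sq0.
set a := C * _ * _; set S := `|s| ^+ p.-1; set x := `|v s t - w s t|.
set sm := `|s| ^+ m; set sq' := `|s| ^+ q.-1 => a0 K0 h S0 sq sm0 sq0.
apply: (@le_trans _ _ (a * (sq' * (e / (a + 1) * sm)))).
  by rewrite -mulrA ler_wpM2l // ler_pM // /x.
have -> : a * (sq' * (e / (a + 1) * sm)) = (a / (a + 1)) * (e * (sm * sq')) by ring.
apply: ler_piMl; first by rewrite !mulr_ge0 // ltW.
by rewrite ler_pdivrMr // mul1r lerDl.
Qed.

End JetExpansion.

(** * Regularity of the maps Phi *)

Lemma continuous_atD (R : realType) (V W : normedModType R) (f g : V -> W) (x : V) :
  {for x, continuous f} -> {for x, continuous g} ->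
  {for x, continuous (fun t => f t + g t)}.
Proof. by move=> cf cg; rewrite /prop_for /continuous_at; exact: (cvgD cf cg). Qed.

Lemma continuous_atZ (R : realType) (V W : normedModType R) (c : V -> R) (f : V -> W) (x : V) :
  {for x, continuous c} -> {for x, continuous f} ->
  {for x, continuous (fun t => c t *: f t)}.
Proof. by move=> cf cg; rewrite /prop_for /continuous_at; exact: (cvgZ cf cg). Qed.

Lemma continuous_at_comp (R : realType) (U V W : normedModType R) (f : U -> V) (g : V -> W)
    (x : U) :
  {for x, continuous f} -> {for f x, continuous g} ->
  {for x, continuous (fun t => g (f t))}.
Proof. by move=> cf cg; exact: (continuous_comp cf cg). Qed.

Section RationalVectors.
Context {R : realType} {n : nat}.
Local Notation V := 'rV[R]_n.

Definition ratV (r : 'rV[rat]_n) : V := map_mx ratr r.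

Lemma ratV_dense (v : V) (e : R) : 0 < e -> exists r, `|ratV r - v| < e.
Proof.
move=> e0.
have H i : exists q : rat, `|ratr q - v ord0 i| < e.
  have vv : v ord0 i - e < v ord0 i + e by lra.
  have [q] := rat_in_itvoo vv; rewrite in_itv /= => /andP[q1 q2].
  by exists q; rewrite ltr_norml; apply/andP; split; lra.
have [q Hq] := choice H; exists (\row_i q i).
rewrite [ltLHS]mx_normrE; apply: bigmax_lt => // -[i j] _ /=.
by rewrite !mxE (ord1 i).
Qed.

Lemma ae_all_countable (I : countType) (P : I -> R -> Prop) :
  (forall r, {ae lebesgue_measure, forall t : R, P r t}) ->
  {ae lebesgue_measure, forall t : R, forall r, P r t}.
Proof.
move=> H.
pose Q (m : nat) (t : R) := if @unpickle I m is Some r then P r t else True.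
have HQ m : {ae lebesgue_measure, forall t : R, Q m t}.
  by rewrite /Q; case: unpickle => [r|]; [exact: H|exact: aeW].
have := ae_foralln HQ; apply: filterS => t Ht r.
by have := Ht (pickle r); rewrite /Q pickleK.
Qed.

Lemma eq_on_rat (f g : V -> V) : continuous f -> continuous g ->
  (forall r, f (ratV r) = g (ratV r)) -> forall v, f v = g v.
Proof.
move=> cf cg fg v; apply/eqP; rewrite -subr_eq0 -normr_le0.
apply/ler_addgt0Pr => e e0; rewrite add0r.
have e20 : 0 < e / 2 by rewrite divr_gt0.
have [d d0 Hd] := continuous_approx (cf v) e20.
have [d' d'0 Hd'] := continuous_approx (cg v) e20.
have dd : 0 < Num.min d d' by rewrite lt_min d0.
have [r] := ratV_dense v dd; rewrite lt_min => /andP[/Hd h1 /Hd' h2].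
have -> : f v - g v = (g (ratV r) - g v) - (f (ratV r) - f v).
  by rewrite fg opprB [RHS]addrC addrA subrK.
apply: le_trans (ler_normB _ _) _; move: h1 h2; clear; lra.
Qed.

Lemma continuous_multilinear (F : seq V -> V) (z : V -> V) c : symmetric_multilinear F ->
  continuous z -> continuous (fun v => F (z v :: nseq c v)).
Proof.
move=> sF cz v0.
have -> : (fun v => F (z v :: nseq c v)) =
    (fun v => F [seq (if j then id else z) v | j <- false :: nseq c true]).
  by apply/funext => v; rewrite /= map_nseq.
apply: (@multilinear_closure R n V bool setT (fun f => {for v0, continuous f})
  (fun f => {for v0, continuous f}) _ _ _ _ _ (fun _ => F) (fun j : bool => if j then id else z)).
- by move=> f g fg; rewrite (_ : g = f) //; apply/funext => t; rewrite fg.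
- exact: cst_continuous.
- by move=> f g; exact: continuous_atD.
- by move=> f g; exact: continuous_atZ.
- by [].
- by move=> w _; exact: cst_continuous.
- move=> [] i; first exact: coord_continuous.
  by apply: (continuous_at_comp (g := fun v : V => v ord0 i) (cz v0)); exact: coord_continuous.
Qed.

Lemma continuous_multilinear_nseq (F : seq V -> V) c : symmetric_multilinear F ->
  continuous (fun v => F (nseq c v)).
Proof.
case: c => [|c] sF; first by move=> v; exact: cst_continuous.
apply: (@continuous_multilinear F (fun v => v) c sF) => v.
by apply: approx_continuous => e e0; exists e.
Qed.

End RationalVectors.

Section PhiRegularity.
Context {R : realType} {n : nat}.
Local Notation V := 'rV[R]_n.
Variables (a b : R) (Phi : R -> seq V -> V) (rhs : nat -> V -> R -> V).
Hypothesis sPhi : forall t, a <= t -> t <= b -> symmetric_multilinear (Phi t).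
Hypothesis rhs_cont : forall m t, (0 < m)%N -> a <= t -> t <= b -> continuous (fun v => rhs m v t).
Hypothesis Phi_sol : forall m, (0 < m)%N -> forall v,
  caratheodory_solution a b (fun t _ => rhs m v t) (fun t => Phi t (nseq m v)).

Lemma Phi_abs_continuous vs : (0 < size vs)%N -> abs_continuous a b (fun t => Phi t vs).
Proof.
move=> vs0.
apply: (@polarization_closure R n R [set t | a <= t <= b] (fun f => abs_continuous a b f) setT
  _ _ _ _ _ _ Phi (size vs)) => //.
- by move=> f g fg; apply: abs_continuous_eq => t at_ tb; apply: fg; rewrite /= at_.
- exact: abs_continuous_cst.
- by move=> f g; exact: abs_continuousD.
- by move=> c f; exact: abs_continuousZ.
- by move=> t /andP[at_ tb]; exact: sPhi.
- by move=> v _; have [] := Phi_sol vs0 v.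
Qed.

Lemma ae_interior : {ae lebesgue_measure, forall t : R, t \in `[a, b] -> a < t < b}.
Proof.
have ne (c : R) : {ae lebesgue_measure, forall t : R, t != c}.
  exists [set c]; split => //; first exact: lebesgue_measure_set1.
  by move=> z /= /negP; rewrite negbK => /eqP.
apply: filterS2 (ne a) (ne b) => t ta tb; rewrite in_itv /= => /andP[at_ tb'].
by rewrite !lt_neqAle at_ tb' eq_sym ta tb.
Qed.

(** The exceptional null set of the equation depends on the vector. Discarding the countably many
    sets of rational vectors, polarization gives derivability for all arguments, and both sides,
    being continuous in [v], agree for all [v]. *)
Lemma Phi_ae_derive m : (0 < m)%N ->
  {ae lebesgue_measure, forall t : R, t \in `[a, b] ->
    (forall w, size w = m -> derivable (fun z => Phi z (basis_word w)) t 1) /\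
    forall v, is_derive t 1 (fun z => Phi z (nseq m v)) (rhs m v t)}.
Proof.
move=> m0.
have H r := (Phi_sol m0 (ratV r)).2.
have := ae_all_countable H; apply: filterS2 ae_interior => t tI Ht tab.
have {tI}/andP[at_ tb] := tI tab.
have {}Ht r : is_derive t 1 (fun z => Phi z (nseq m (ratV r))) (rhs m (ratV r) t) by exact: Ht.
pose d := Num.min (t - a) (b - t).
have d0 : 0 < d by rewrite lt_min !subr_gt0 at_.
have sPhi' z : `|z - t| < d -> symmetric_multilinear (Phi z).
  rewrite lt_min !ltr_norml => /andP[/andP[h1 h2] /andP[h3 h4]].
  by apply: sPhi; lra.
have rat0 : ratV 0 = 0 :> V by rewrite /ratV map_mx0.
have dw w : size w = m -> derivable (fun z => Phi z (basis_word w)) t 1.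
  move=> wm.
  apply: (@polarization_closure R n R [set z | `|z - t| < d] (fun f => derivable f t 1)
    [set v | exists r, v = ratV r] _ _ _ _ _ _ Phi m).
  - by move=> f g fg; apply: near_eq_derivable; apply/near_approx; exists d.
  - exact: derivable_cst.
  - by move=> f g df dg; exact: derivableD.
  - by move=> c f df; exact: derivableZ.
  - by exists 0.
  - move=> _ _ c [r ->] [r' ->]; exists (r + c%:R *: r').
    by apply/matrixP => i j; rewrite !mxE rmorphD rmorphM /= rmorph_nat.
  - exact: sPhi'.
  - by move=> _ [r ->]; have [] := Ht r.
  - by rewrite size_map.
  - move=> v /mapP[i _ ->]; exists (delta_mx ord0 i).
    by rewrite /ratV map_delta_mx.
split => //.
have dvs vs : size vs = m -> derivable (fun z => Phi z vs) t 1.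
  exact: (derivable_multilinear d0 sPhi' dw).
(* Setting [F'] to 0 on all other lengths makes it a symmetric multilinear family, whence its
   continuity in [v]. *)
pose F' vs := if size vs == m then 'D_1 (fun z => Phi z vs) t else 0.
have sF' : symmetric_multilinear F'.
  split=> [vs ws pvw|vs c v w]; rewrite /F'.
    rewrite (perm_size pvw); case: eqP => // _; apply: near_eq_derive.
    by apply/near_approx; exists d => // z /sPhi'[pz _]; exact: pz.
  rewrite /=; case: eqP => vsm; last by rewrite scaler0 addr0.
  have [_ <-] : is_derive t 1 (fun z => c *: Phi z (v :: vs) + Phi z (w :: vs))
      (c *: 'D_1 (fun z => Phi z (v :: vs)) t + 'D_1 (fun z => Phi z (w :: vs)) t).
    apply: is_deriveD; [apply: is_deriveZ|]; apply: derivableP; exact: dvs.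
  apply: near_eq_derive; apply/near_approx; exists d => // z /sPhi'[_ lz]; exact: lz.
have F'E v : F' (nseq m v) = 'D_1 (fun z => Phi z (nseq m v)) t by rewrite /F' size_nseq eqxx.
move=> v; split; first by apply: dvs; rewrite size_nseq.
rewrite -F'E; apply: (@eq_on_rat R n (fun v => F' (nseq m v)) (fun v => rhs m v t)).
- exact: continuous_multilinear_nseq.
- by apply: rhs_cont => //; exact: ltW.
- by move=> r; rewrite F'E; have [] := Ht r.
Qed.

(** The null set is fixed before the curve [v] is chosen. *)
Lemma Phi_curve_derive m : (0 < m)%N ->
  {ae lebesgue_measure, forall t : R, t \in `[a, b] -> forall (v : R -> V) v',
    is_derive t 1 v v' ->
    is_derive t 1 (fun z => Phi z (nseq m (v z)))
      (rhs m (v t) t + m%:R *: Phi t (v' :: nseq m.-1 (v t)))}.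
Proof.
move=> m0; apply: filterS2 ae_interior (Phi_ae_derive m0) => t tI dPhi tab v v' dv.
have {tI}/andP[at_ tb] := tI tab; have [dw dd] := dPhi tab.
pose d := Num.min (t - a) (b - t).
have d0 : 0 < d by rewrite lt_min !subr_gt0 at_.
have sPhi' z : `|z - t| < d -> symmetric_multilinear (Phi z).
  rewrite lt_min !ltr_norml => /andP[/andP[h1 h2] /andP[h3 h4]].
  by apply: sPhi; lra.
have := is_derive_multilinear_curve d0 sPhi' dw dv.
by have [_ ->] := dd (v t).
Qed.

Lemma Phi_curve_abs_continuous m (v : R -> V) : (0 < m)%N -> abs_continuous a b v ->
  abs_continuous a b (fun t => Phi t (nseq m (v t))).
Proof.
move=> m0 acv.
apply: (@abs_continuous_eq _ _ a b (fun t => Phi t [seq v t | j <- nseq m tt])).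
  by move=> t _ _; rewrite map_nseq.
apply: (@multilinear_closure R n R unit [set t | a <= t <= b] (fun f => abs_continuous a b f)
  (fun f => abs_continuous a b f) _ _ _ _ (nseq m tt) Phi (fun _ => v)).
- by move=> f g fg; apply: abs_continuous_eq => t at_ tb; apply: fg; rewrite /= at_.
- exact: abs_continuous_cst.
- by move=> f g; exact: abs_continuousD.
- by move=> c f; exact: abs_continuousM.
- by move=> t /andP[at_ tb]; exact: sPhi.
- by move=> w; rewrite size_nseq => wm; apply: Phi_abs_continuous; rewrite size_map wm.
- by move=> _ i; exact: (abs_continuous_coord ord0 i acv).
Qed.

Lemma Phi_multibounded m : (0 < m)%N -> multibounded [set t | a <= t <= b] Phi m.
Proof.
move=> m0; apply: multibounded_words; first by move=> t /andP[at_ tb]; exact: sPhi.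
move=> w wm; have [|C C0 HC] := @abs_continuous_bounded R V a b (fun t => Phi t (basis_word w)).
  by apply: Phi_abs_continuous; rewrite size_map wm.
by exists C => t /andP[at_ tb]; exact: HC.
Qed.

End PhiRegularity.

(** * Expansion in adapted coordinates *)

Lemma taylor_sum_multinomial (R : realType) n k (b : 'M[R]_(k, n)) F s :
  symmetric_multilinear F ->
  taylor_sum (k := k) F (jet_poly b s) =
  \sum_(al : multi_index k | (mdeg al <= k)%N)
    s ^+ weight al *: ((multi_fact al)%:R^-1 *: F (insert_powers b al)).
Proof. exact: multinomial_jet. Qed.

(** * The double Taylor sum behind the functions y_i^(m) *)

Section DoubleTaylor.
Context {R : realType} {n k : nat} {T : Type}.
Local Notation V := 'rV[R]_n.
Variables (D : set T) (Phi DX : T -> seq V -> V).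
Hypothesis sPhi : forall t, D t -> symmetric_multilinear (Phi t).
Hypothesis sDX : forall t, D t -> symmetric_multilinear (DX t).
Hypothesis bPhi : forall p, (0 < p)%N -> multibounded D Phi p.
Hypothesis bDX : forall p, multibounded D DX p.

Definition double_taylor (P F : seq V -> V) (v : V) : V :=
  taylor_sum (k := k) (fun vs => P (taylor_sum (k := k) F v :: vs)) v.

(** With [P] the maps Phi, [F] the derivatives of X_i and c = m - 1, this is y_i^(m) as a function
    of the jet [b] instead of its adapted coordinates. *)
Definition double_coef (P F : seq V -> V) (c : nat) (b : 'M[R]_(k, n)) : V :=
  \sum_(ab : multi_index k * multi_index k | (weight ab.1 + weight ab.2 == c)%N)
    ((multi_fact ab.1)%:R^-1 * (multi_fact ab.2)%:R^-1) *:
    P (F (insert_powers b ab.2) :: insert_powers b ab.1).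

Lemma taylor_sum_bounded (F : T -> seq V -> V) (v : R -> T -> V) :
  (forall p, (p <= k)%N -> multibounded D F p) -> unif_O D 1 v ->
  unif_O D 0 (fun s t => taylor_sum (k := k) (F t) (v s t)).
Proof.
move=> bF [Cv Cv0 [d d0 Hv]]; apply: unif_O_sum => p _.
have [C C0 HC] := bF p (ltn_ord p).
exists (C * Cv ^+ p); first by rewrite mulr_ge0 // exprn_ge0.
exists (Num.min d 1) => [|s t]; first by rewrite lt_min d0 ltr01.
rewrite lt_min => /andP[sd s1] Dt; rewrite mulr1 normrZ.
apply: (@le_trans _ _ (1 * `|F t (nseq p (v s t))|)).
  rewrite ler_wpM2r // ger0_norm ?invr_ge0 // invf_le1 ?ltr0n ?fact_gt0 //.
  by rewrite ler1n fact_gt0.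
rewrite mul1r; apply: le_trans (HC t _ Dt (size_nseq _ _)) _.
rewrite ler_wpM2l // big_nseq iter_mulr_1 lerXn2r ?nnegrE //.
apply: le_trans (Hv s t sd Dt) _; rewrite expr1; apply: ler_piMr => //; exact: ltW.
Qed.

Lemma unif_O_jet_poly (B : T -> 'M[R]_(k, n)) :
  (exists2 C : R, 0 <= C & forall t, D t -> `|B t| <= C) ->
  unif_O D 1 (fun s t => jet_poly (B t) s).
Proof.
move=> [C C0 HC]; apply: unif_O_sum => r _; apply: unif_O_pow => //.
exists C => t Dt; apply: le_trans (HC t Dt).
rewrite [leLHS]mx_normrE; apply: bigmax_le => // -[i' j] _ /=; rewrite mxE.
by rewrite [leRHS]mx_normrE; apply/bigmax_geP; right; exists (r, j).
Qed.

Lemma taylor_sumB (P : seq V -> V) (z z' v : V) : symmetric_multilinear P ->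
  taylor_sum (k := k) (fun vs => P (z - z' :: vs)) v =
  taylor_sum (k := k) (fun vs => P (z :: vs)) v - taylor_sum (k := k) (fun vs => P (z' :: vs)) v.
Proof.
move=> sP; rewrite /taylor_sum -sumrB; apply: eq_bigr => p _.
by rewrite multilinearB // scalerBr.
Qed.

Lemma double_taylor_lipschitz (v w : R -> T -> V) m : unif_O D 1 v -> unif_O D 1 w ->
  unif_o D m (fun s t => v s t - w s t) ->
  unif_o D m (fun s t => double_taylor (Phi t) (DX t) (v s t) -
                         double_taylor (Phi t) (DX t) (w s t)).
Proof.
move=> Ov Ow vw.
pose zv s t := taylor_sum (k := k) (DX t) (v s t).
pose zw s t := taylor_sum (k := k) (DX t) (w s t).
have zvw : unif_o D m (fun s t => zv s t - zw s t).
  have := @taylor_sum_lipschitz R n k T D DX v w 0 m sDX (fun p _ => bDX p) _ Ov Ow vw.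
  by rewrite addn0; apply.
have [Cw Cw0 [dw dw0 Hw]] := taylor_sum_bounded (fun p _ => bDX p) Ow.
have h1 : unif_o D m (fun s t => taylor_sum (k := k) (fun vs => Phi t (zv s t - zw s t :: vs)) (v s t)).
  apply: unif_o_sum => p _; apply: unif_oZ.
  have [C C0 HC] := bPhi (ltn0Sn p); have [Cv Cv0 [dv dv0 Hv]] := Ov.
  apply: (unif_o_dominated (C := C * Cv ^+ p)) zvw.
  exists (Num.min dv 1) => [|s t]; first by rewrite lt_min dv0 ltr01.
  rewrite lt_min => /andP[sd s1] Dt; apply: le_trans (HC t _ Dt _) _.
    by rewrite /= size_nseq.
  rewrite big_cons big_nseq iter_mulr_1 mulrCA [X in _ <= X]mulrC ler_wpM2l //.
  rewrite ler_wpM2l // lerXn2r ?nnegrE //.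
  apply: le_trans (Hv s t sd Dt) _; rewrite expr1; apply: ler_piMr => //; exact: ltW.
(* The inner sum [zw s t] also depends on s. Freezing that s as a parameter leaves a family in the
   outer variable alone, to which the Lipschitz lemma applies; the diagonal is restored in [h3]. *)
pose D' := [set st : R * T | `|st.1| < dw /\ D st.2].
have h2 : unif_o D' (m + 0) (fun s' st =>
    taylor_sum (k := k) (fun vs => Phi st.2 (zw st.1 st.2 :: vs)) (v s' st.2) -
    taylor_sum (k := k) (fun vs => Phi st.2 (zw st.1 st.2 :: vs)) (w s' st.2)).
  apply: (@taylor_sum_lipschitz R n k _ D' (fun st vs => Phi st.2 (zw st.1 st.2 :: vs))
     (fun s' st => v s' st.2) (fun s' st => w s' st.2) 0 m).
  - by move=> st [_ Dt]; apply: symmetric_multilinear_cons; exact: sPhi.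
  - move=> p _; have [C C0 HC] := bPhi (ltn0Sn p).
    exists (C * Cw) => [|st vs [sd Dt] vsp]; first exact: mulr_ge0.
    apply: le_trans (HC _ _ Dt _) _; first by rewrite /= vsp.
    rewrite big_cons mulrA ler_wpM2r ?prodr_ge0 // ler_wpM2l //.
    by have := Hw st.1 st.2 sd Dt; rewrite expr0 mulr1.
  - by [].
  - by have [C C0 [d d0 H]] := Ov; exists C => //; exists d => // s' st sd [_ Dt]; exact: H.
  - by have [C C0 [d d0 H]] := Ow; exists C => //; exists d => // s' st sd [_ Dt]; exact: H.
  - by move=> e e0; have [d d0 H] := vw e e0; exists d => // s' st sd [_ Dt]; exact: H.
have h3 : unif_o D m (fun s t =>
    taylor_sum (k := k) (fun vs => Phi t (zw s t :: vs)) (v s t) -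
    taylor_sum (k := k) (fun vs => Phi t (zw s t :: vs)) (w s t)).
  rewrite addn0 in h2.
  move=> e e0; have [d d0 H] := h2 e e0; exists (Num.min d dw); first by rewrite lt_min d0.
  by move=> s t; rewrite lt_min => /andP[sd sdw] Dt; exact: (H s (s, t)).
apply: unif_o_ext (unif_oD h1 h3) => s t Dt.
rewrite (@taylor_sumB (Phi t)); last exact: sPhi.
by rewrite /double_taylor addrA subrK.
Qed.

Lemma double_taylor_jet (B : T -> 'M[R]_(k, n)) :
  (exists2 C : R, 0 <= C & forall t, D t -> `|B t| <= C) ->
  unif_O D k.+1 (fun s t => double_taylor (Phi t) (DX t) (jet_poly (B t) s) -
    \sum_(c < k.+1) s ^+ c *: double_coef (Phi t) (DX t) c (B t)).
Proof.
move=> bB.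
pose G t (ab : multi_index k * multi_index k) : V :=
  ((multi_fact ab.1)%:R^-1 * (multi_fact ab.2)%:R^-1) *:
    Phi t (DX t (insert_powers (B t) ab.2) :: insert_powers (B t) ab.1).
pose wt (ab : multi_index k * multi_index k) := (weight ab.1 + weight ab.2)%N.
pose okd (ab : multi_index k * multi_index k) := ((mdeg ab.1 <= k) && (mdeg ab.2 <= k))%N.
have bG ab : okd ab -> exists C : R, forall t, D t -> `|G t ab| <= C.
  move=> /andP[k1 k2].
  have [C1 H1] := bounded_insert_powers (fun p _ => bDX p) k2 bB.
  (* The inserted value of [DX] becomes a parameter in a bounded set, so that [Phi] with its first
     argument fixed is again a bounded family. *)
  pose D' := [set tz : T * V | D tz.1 /\ `|tz.2| <= `|C1|].
  have bD' p : (p <= k)%N -> multibounded D' (fun tz vs => Phi tz.1 (tz.2 :: vs)) p.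
    move=> _; have [C C0 HC] := bPhi (ltn0Sn p).
    exists (C * `|C1|) => [|tz vs [Dt zC] vsp]; first exact: mulr_ge0.
    apply: le_trans (HC _ _ Dt _) _; first by rewrite /= vsp.
    by rewrite big_cons mulrA ler_wpM2r ?prodr_ge0 // ler_wpM2l.
  have bB' : exists2 C : R, 0 <= C & forall tz, D' tz -> `|B tz.1| <= C.
    by have [C C0 H] := bB; exists C => // tz [Dt _]; exact: H.
  have [C2 H2] := bounded_insert_powers bD' k1 bB'.
  exists (`|(multi_fact ab.1)%:R^-1 * (multi_fact ab.2)%:R^-1| * C2) => t Dt.
  rewrite normrZ ler_wpM2l //; apply: (H2 (t, _)); split => //=.
  by apply: le_trans (H1 t Dt) _; exact: ler_norm.
have Hsum s t : D t -> double_taylor (Phi t) (DX t) (jet_poly (B t) s) =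
    \sum_(ab | okd ab) s ^+ wt ab *: G t ab.
  move=> Dt; have sP := sPhi Dt; have sX := sDX Dt.
  rewrite /double_taylor {2}/taylor_sum multinomial_jet //.
  transitivity (\sum_(be : multi_index k | (mdeg be <= k)%N)
     (s ^+ weight be * (multi_fact be)%:R^-1) *:
     taylor_sum (k := k) (fun vs => Phi t (DX t (insert_powers (B t) be) :: vs)) (jet_poly (B t) s)).
    rewrite /taylor_sum; under [RHS]eq_bigr do rewrite scaler_sumr.
    rewrite [RHS]exchange_big /=; apply: eq_bigr => p _.
    under eq_bigr do rewrite scalerA.
    rewrite multilinear_sum // scaler_sumr; apply: eq_bigr => be _.
    by rewrite multilinearZ // !scalerA; congr (_ *: _); ring.
  transitivity (\sum_(be : multi_index k | (mdeg be <= k)%N)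
     \sum_(al : multi_index k | (mdeg al <= k)%N) s ^+ wt (al, be) *: G t (al, be)).
    apply: eq_bigr => be _; rewrite taylor_sum_multinomial; last exact: symmetric_multilinear_cons.
    rewrite scaler_sumr; apply: eq_bigr => al _; rewrite /G /wt /= !scalerA exprD.
    by congr (_ *: _); ring.
  rewrite exchange_big /= pair_big_dep /=.
  by apply: eq_big => [[al be]|[al be] _].
have H : unif_O D k.+1 (fun s t => \sum_(ab | okd ab && (k < wt ab)%N) s ^+ wt ab *: G t ab).
  by apply: unif_O_sum => ab /andP[ok kw]; apply: unif_O_pow => //; exact: bG.
have [C C0 [d d0 {}H]] := H; exists C => //; exists d => // s t sd Dt.
have := H s t sd Dt; congr (`|_| <= _); rewrite Hsum //.
rewrite [X in _ = X - _](bigID (fun ab => (wt ab <= k)%N)) /=.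
apply/eqP; rewrite eq_sym subr_eq addrC; apply/eqP; congr (_ + _).
  by apply: eq_bigl => ab; rewrite -ltnNge.
rewrite (partition_big (fun ab => inord (wt ab) : 'I_k.+1) xpredT) //=.
apply: eq_bigr => c _; rewrite /double_coef scaler_sumr; apply: eq_big.
  move=> ab; apply/andP/eqP => [[/andP[_ wk] /eqP <-]|wc]; first by rewrite inordK.
  have wk : (wt ab <= k)%N by rewrite /wt wc -ltnS.
  split; last by apply/eqP/val_inj; rewrite /= inordK.
  rewrite wk andbT /okd; apply/andP; split.
    by rewrite (leq_trans (weight_ge_mdeg _)) // (leq_trans _ wk) // leq_addr.
  by rewrite (leq_trans (weight_ge_mdeg _)) // (leq_trans _ wk) // leq_addl.
by move=> ab /andP[/andP[_ wk] /eqP <-]; rewrite inordK.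
Qed.

End DoubleTaylor.

(** Both sides run over the pairs (q, c) with q + c < k; on the left they are grouped by j = q +
    c. *)
Lemma triangular_sum (Z : zmodType) k (f : nat -> nat -> Z) :
  \sum_(j < k) \sum_(q < j.+1) f q (j - q)%N =
  \sum_(q < k) \sum_(c < k | (q + c < k)%N) f q c.
Proof.
transitivity (\sum_(j < k) \sum_(q < k) \sum_(c < k | (q + c == j)%N) f q c).
  apply: eq_bigr => j _.
  rewrite (big_ord_widen k (fun q => f q (j - q)%N) (ltn_ord j)) big_mkcond /=.
  apply: eq_bigr => q _; case: ltnP => qj.
    have cj : (j - q < k)%N by rewrite (leq_ltn_trans (leq_subr _ _)).
    rewrite (big_pred1 (Ordinal cj)) // => c; apply/eqP/eqP => [cE|->].
      by apply/val_inj; rewrite /= -cE addKn.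
    by rewrite /= subnKC.
  rewrite big1 // => c /eqP cj; have : (q <= j)%N by rewrite -cj leq_addr.
  by rewrite leqNgt qj.
rewrite exchange_big /=; apply: eq_bigr => q _.
rewrite (exchange_big_dep (fun c : 'I_k => (q + c < k)%N)) /=; last first.
  by move=> j c _ /eqP ->.
by apply: eq_bigr => c qc; rewrite (big_pred1 (Ordinal qc)).
Qed.

(** * Cancellation of the unperturbed control *)

Section DerivativeAlgebra.
Context {R : realType} {n l k : nat}.
Local Notation V := 'rV[R]_n.
Variables (P : seq V -> V) (DX : 'I_l -> seq V -> V) (v : V).
Variables (u d : 'I_l -> R) (rho : 'I_l -> V).
Hypothesis sP : symmetric_multilinear P.

Let zeta i := taylor_sum (k := k) (DX i) v.

(** The derivative in direction [z], at [v], of the sum of 1/p! P[v, ..., v] over 1 <= p <= k. *)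
Definition low_sum (z : V) : V := \sum_(j < k) (j`!)%:R^-1 *: P (z :: nseq j v).

Definition high_term i q c : V :=
  ((q.+1`!)%:R^-1 * (c`!)%:R^-1) *: P (DX i (nseq q.+1 v) :: nseq c v).

Lemma low_sumD z z' : low_sum (z + z') = low_sum z + low_sum z'.
Proof.
rewrite /low_sum -big_split /=; apply: eq_bigr => j _.
have [_ /(_ (nseq j v) 1 z z')] := sP.
by rewrite !scale1r => ->; rewrite scalerDr.
Qed.

Lemma low_sum_sum (c : 'I_l -> R) (z : 'I_l -> V) :
  low_sum (\sum_i c i *: z i) = \sum_i c i *: low_sum (z i).
Proof.
rewrite /low_sum; under [RHS]eq_bigr do rewrite scaler_sumr.
rewrite exchange_big /=; apply: eq_bigr => j _.
rewrite multilinear_sum // scaler_sumr; apply: eq_bigr => i _.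
by rewrite !scalerA mulrC.
Qed.

Lemma low_sum_taylor i :
  low_sum (zeta i - DX i [::]) = \sum_(q < k) \sum_(c < k) high_term i q c.
Proof.
have -> : zeta i - DX i [::] = \sum_(q < k) (q.+1`!)%:R^-1 *: DX i (nseq q.+1 v).
  by rewrite /zeta /taylor_sum big_ord_recl /= invr1 scale1r addrAC subrr add0r.
rewrite /low_sum exchange_big /=; apply: eq_bigr => c _.
rewrite multilinear_sum // scaler_sumr; apply: eq_bigr => q _.
by rewrite /high_term scalerA mulrC.
Qed.

(* The terms with the unperturbed control u come from the derivative of Phi and
   from that of v, and cancel except for those of order at least k + 1 in v. *)
Lemma derivative_algebra :
  let v' := \sum_i (u i + d i) *: (zeta i + rho i) - \sum_i u i *: DX i [::] in
  \sum_(j < k) (j.+1`!)%:R^-1 *: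
    (- (\sum_i u i *: \sum_(1 <= s < j.+2) 'C(j.+1, s)%:R *:
           P (DX i (nseq s v) :: nseq (j.+1 - s) v))
     + j.+1%:R *: P (v' :: nseq j v)) =
  \sum_i d i *: double_taylor (k := k) P (DX i) v +
  (\sum_i u i *: (\sum_(q < k) \sum_(c < k | (k <= q + c)%N) high_term i q c)
   - \sum_i d i *: ((k`!)%:R^-1 *: P (zeta i :: nseq k v))
   + \sum_i (u i + d i) *: low_sum (rho i)).
Proof.
move=> v'.
(* The zeroth Taylor term of each field cancels against the unperturbed velocity. What then
   multiplies [u i] is a sum of derivatives of positive order, as in the equation of Phi. *)
have v'E : v' = \sum_i u i *: (zeta i - DX i [::]) + \sum_i d i *: zeta i
    + \sum_i (u i + d i) *: rho i.
  rewrite /v' -sumrB -!big_split /=; apply: eq_bigr => i _.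
  move: (zeta i) (DX i [::]) (rho i) => z x r.
  by apply/matrixP => a b; rewrite !mxE; ring.
have low v'' : \sum_(j < k) (j.+1`!)%:R^-1 *: (j.+1%:R *: P (v'' :: nseq j v)) = low_sum v''.
  by apply: eq_bigr => j _; rewrite scalerA factS natrM invfM mulrAC mulVf ?mul1r.
under eq_bigr do rewrite scalerDr.
rewrite big_split /= low v'E !low_sumD !low_sum_sum.
(* [double_taylor] has one term more than [low_sum], the one with [k] copies of [v]; it reappears in
   the remainder with a minus sign. *)
have dt i : d i *: double_taylor (k := k) P (DX i) v =
    d i *: low_sum (zeta i) + d i *: ((k`!)%:R^-1 *: P (zeta i :: nseq k v)).
  by rewrite -scalerDr /double_taylor {1}/taylor_sum big_ord_recr.
rewrite (eq_bigr _ (fun i _ => dt i)) big_split /=.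
have hi : \sum_(j < k) (j.+1`!)%:R^-1 *:
    - (\sum_i u i *: \sum_(1 <= s < j.+2) 'C(j.+1, s)%:R *:
           P (DX i (nseq s v) :: nseq (j.+1 - s) v)) =
    - (\sum_i u i *: \sum_(q < k) \sum_(c < k | (q + c < k)%N) high_term i q c).
  (* The binomial coefficient divided by (j + 1)! splits into the two inverse factorials of
     [high_term]. *)
  have inner i j : (j.+1`!)%:R^-1 *: (\sum_(1 <= s < j.+2) 'C(j.+1, s)%:R *:
           P (DX i (nseq s v) :: nseq (j.+1 - s) v)) =
      \sum_(q < j.+1) high_term i q (j - q).
    rewrite big_add1 /= big_mkord scaler_sumr; apply: eq_bigr => q _.
    rewrite /high_term scalerA subSS; congr (_ *: _).
    have qj : (q.+1 <= j.+1)%N by exact: ltn_ord.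
    have := bin_fact qj; rewrite subSS => /(congr1 (fun x => x%:R : R)).
    rewrite !natrM => <-.
    have nz m : (m`!)%:R != 0 :> R by rewrite pnatr_eq0 -lt0n fact_gt0.
    have bz : 'C(j.+1, q.+1)%:R != 0 :> R by rewrite pnatr_eq0 -lt0n bin_gt0.
    rewrite !invfM mulrAC mulVf // mul1r mulrC //.
  transitivity (\sum_(j < k) - (\sum_i u i *: \sum_(q < j.+1) high_term i q (j - q))).
    apply: eq_bigr => j _; rewrite scalerN scaler_sumr; congr (- _).
    by apply: eq_bigr => i _; rewrite -inner !scalerA mulrC.
  rewrite sumrN exchange_big /=; congr (- _); apply: eq_bigr => i _.
  by rewrite -triangular_sum scaler_sumr.
rewrite hi.
have split_high i : \sum_(q < k) \sum_(c < k) high_term i q c =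
    \sum_(q < k) \sum_(c < k | (q + c < k)%N) high_term i q c +
    \sum_(q < k) \sum_(c < k | (k <= q + c)%N) high_term i q c.
  rewrite -big_split /=; apply: eq_bigr => q _.
  rewrite (bigID (fun c : 'I_k => (q + c < k)%N)) /=; congr (_ + _).
  by apply: eq_bigl => c; rewrite -leqNgt.
under [X in _ + (X + _ + _) = _]eq_bigr do rewrite low_sum_taylor split_high scalerDr.
rewrite big_split /=.
move: (\sum_i u i *: \sum_(q < k) \sum_(c < k | (q + c < k)%N) high_term i q c)
  (\sum_i u i *: \sum_(q < k) \sum_(c < k | (k <= q + c)%N) high_term i q c)
  (\sum_i d i *: low_sum (zeta i)) (\sum_i (u i + d i) *: low_sum (rho i))
  (\sum_i d i *: (k`!%:R^-1 *: P (zeta i :: nseq k v))) => a1 a2 a3 a4 a5.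
apply/matrixP => i j; rewrite !mxE; ring.
Qed.

End DerivativeAlgebra.

Section WeightedProducts.
Context {R : realType} {n : nat} {T : Type}.
Local Notation V := 'rV[R]_n.
Implicit Types (D : set T).

Lemma unif_O_multilinear D (P : T -> seq V -> V) p (z v : R -> T -> V) a :
  multibounded D P p.+1 -> unif_O D a z -> unif_O D 1 v ->
  unif_O D (a + p) (fun s t => P t (z s t :: nseq p (v s t))).
Proof.
move=> [C C0 HC] [Cz Cz0 [dz dz0 Hz]] [Cv Cv0 [dv dv0 Hv]].
exists (C * (Cz * Cv ^+ p)); first by rewrite !mulr_ge0 ?exprn_ge0.
exists (Num.min dz dv) => [|s t]; first by rewrite lt_min dz0.
rewrite lt_min => /andP[sz sv] Dt; apply: le_trans (HC t _ Dt _) _.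
  by rewrite /= size_nseq.
rewrite big_cons big_nseq iter_mulr_1 -!mulrA ler_wpM2l // exprD.
have -> : Cz * (Cv ^+ p * (`|s| ^+ a * `|s| ^+ p)) = (Cz * `|s| ^+ a) * (Cv * `|s|) ^+ p.
  by rewrite exprMn; ring.
apply: ler_pM; rewrite ?exprn_ge0 //; first exact: Hz.
by rewrite lerXn2r ?nnegrE // ?mulr_ge0 //; have := Hv s t sv Dt; rewrite expr1.
Qed.

Lemma unif_O_nseq D (F : T -> seq V -> V) p (v : R -> T -> V) :
  multibounded D F p -> unif_O D 1 v -> unif_O D p (fun s t => F t (nseq p (v s t))).
Proof.
move=> [C C0 HC] [Cv Cv0 [dv dv0 Hv]].
exists (C * Cv ^+ p); first by rewrite mulr_ge0 ?exprn_ge0.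
exists dv => // s t sv Dt; apply: le_trans (HC t _ Dt (size_nseq _ _)) _.
rewrite big_nseq iter_mulr_1 -mulrA ler_wpM2l // -exprMn.
by rewrite lerXn2r ?nnegrE // ?mulr_ge0 //; have := Hv s t sv Dt; rewrite expr1.
Qed.

Lemma unif_OZ D (V' : normedModType R) m (c : R) (h : R -> T -> V') : unif_O D m h ->
  unif_O D m (fun s t => c *: h s t).
Proof.
move=> [C C0 [d d0 H]]; exists (`|c| * C); first exact: mulr_ge0.
by exists d => // s t sd Dt; rewrite normrZ -mulrA ler_wpM2l //; exact: H.
Qed.

End WeightedProducts.

(** * Norms and continuity of matrix functions *)

Section ContinuousMatrices.
Context {R : realType}.
Implicit Types (a b : R).

Lemma mx_norm_coord_le m n (M : 'M[R]_(m, n)) i j : `|M i j| <= `|M|.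
Proof. by rewrite [leRHS]mx_normrE; apply/bigmax_geP; right; exists (i, j). Qed.

Lemma mx_norm_le m n (M : 'M[R]_(m, n)) (C : R) : 0 <= C ->
  (forall i j, `|M i j| <= C) -> `|M| <= C.
Proof. by move=> C0 H; rewrite [leLHS]mx_normrE; apply: bigmax_le => // -[i j] _ /=. Qed.

Lemma mulmx_norm_le m n p (z : 'M[R]_(m, n)) (M : 'M[R]_(n, p)) :
  `|z *m M| <= n%:R * (`|z| * `|M|).
Proof.
apply: mx_norm_le => [|i j]; first by rewrite !mulr_ge0.
rewrite mxE; apply: le_trans (ler_norm_sum _ _ _) _.
have -> : n%:R * (`|z| * `|M|) = \sum_(r < n) (`|z| * `|M|).
  by rewrite sumr_const card_ord mulr_natl.
apply: ler_sum => r _.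
by rewrite normrM ler_pM // mx_norm_coord_le.
Qed.

Lemma cont_on_mx m n a b (f : R -> 'M[R]_(m, n)) :
  (forall i j, cont_on a b (fun t => f t i j)) -> cont_on a b f.
Proof.
move=> H.
have : cont_on a b (fun t => \sum_i \sum_j f t i j *: delta_mx i j : 'M[R]_(m, n)).
  apply: cont_on_sum => i _; apply: cont_on_sum => j _.
  by apply: cont_onZ => //; exact: cont_on_cst.
by apply: cont_on_ext => t _ _; rewrite -matrix_sum_delta.
Qed.

Lemma cont_onM a b (f g : R -> R) : cont_on a b f -> cont_on a b g ->
  cont_on a b (fun t => f t * g t).
Proof. by move=> cf cg; exact: (cont_onZ cf cg). Qed.

Lemma cont_on_prod a b (I : Type) (r : seq I) (f : I -> R -> R) :
  (forall i, cont_on a b (f i)) -> cont_on a b (fun t => \prod_(i <- r) f i t).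
Proof.
move=> cf; elim: r => [|i r IH].
  by apply: (cont_on_ext _ (@cont_on_cst R R a b 1)) => t _ _; rewrite big_nil.
by apply: (cont_on_ext _ (cont_onM (cf i) IH)) => t _ _; rewrite big_cons.
Qed.

Lemma cont_on_det n a b (f : R -> 'M[R]_n) :
  (forall i j, cont_on a b (fun t => f t i j)) -> cont_on a b (fun t => \det (f t)).
Proof.
move=> cf; rewrite /determinant; apply: cont_on_sum => s _; apply: cont_onM.
  exact: cont_on_cst.
by apply: cont_on_prod => i; exact: cf.
Qed.

Lemma cont_onV a b (f : R -> R) : (forall t, a <= t -> t <= b -> f t != 0) ->
  cont_on a b f -> cont_on a b (fun t => (f t)^-1).
Proof.
move=> f0 cf; apply: (cont_on_comp (g := fun y : R => y^-1)) => // t at_ tb.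
by apply: inv_continuous; exact: f0.
Qed.

(** Cramer's rule: cofactors divided by the determinant. *)
Lemma cont_on_invmx n a b (f : R -> 'M[R]_n) :
  (forall i j, cont_on a b (fun t => f t i j)) ->
  (forall t, a <= t -> t <= b -> f t \in unitmx) ->
  forall i j, cont_on a b (fun t => invmx (f t) i j).
Proof.
move=> cf uf i j.
apply: (cont_on_ext (f := fun t => (\det (f t))^-1 * cofactor (f t) j i)).
  by move=> t at_ tb; rewrite /invmx uf // !mxE.
apply: cont_onM.
  apply: cont_onV; last exact: cont_on_det.
  by move=> t at_ tb; have := uf t at_ tb; rewrite unitmxE unitfE.
rewrite /cofactor; apply: cont_onM; first exact: cont_on_cst.
apply: cont_on_det => i' j'.
by apply: (cont_on_ext _ (cf (lift j i') (lift i j'))) => t _ _; rewrite !mxE.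
Qed.

Lemma cont_on_mulmx m n p a b (f : R -> 'M[R]_(m, n)) (g : R -> 'M[R]_(n, p)) :
  (forall i j, cont_on a b (fun t => f t i j)) ->
  (forall i j, cont_on a b (fun t => g t i j)) ->
  forall i j, cont_on a b (fun t => (f t *m g t) i j).
Proof.
move=> cf cg i j.
apply: (cont_on_ext (f := fun t => \sum_r f t i r * g t r j)).
  by move=> t _ _; rewrite mxE.
by apply: cont_on_sum => r _; exact: cont_onM.
Qed.

End ContinuousMatrices.

(** * Polynomials with jet coefficients *)

Section JetPoly.
Context {R : realType} {n k : nat}.
Implicit Types (B : 'M[R]_(k, n)).

Lemma jet_polyB B B' s : jet_poly (B - B') s = jet_poly B s - jet_poly B' s.
Proof.
rewrite /jet_poly -sumrB; apply: eq_bigr => r _.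
by rewrite raddfB scalerBr.
Qed.

Lemma jet_poly0 s : jet_poly (0 : 'M[R]_(k, n)) s = 0.
Proof. by rewrite /jet_poly big1 // => r _; rewrite raddf0 scaler0. Qed.

Lemma jet_poly_mulmx p B (M : 'M[R]_(n, p)) s : jet_poly (B *m M) s = jet_poly B s *m M.
Proof.
rewrite /jet_poly mulmx_suml; apply: eq_bigr => r _.
by rewrite row_mul scalemxAl.
Qed.

Lemma jet_poly_unique B :
  (forall e : R, 0 < e -> exists2 d : R, 0 < d & forall s, `|s| < d ->
     `|jet_poly B s| <= e * `|s| ^+ k) -> B = 0.
Proof.
move=> H; apply/row_matrixP => r; rewrite row0.
(* A jet polynomial has no constant term; adding the coefficient 0 makes [k.+1] of them, which
   matches the error of order [k]. *)
pose c m : 'rV[R]_n := if m is m'.+1 then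
  (if insub m' is Some i then row (i : 'I_k) B else 0) else 0.
have cE (i : 'I_k) : c i.+1 = row i B by rewrite /c insubT // => ik; congr (row _ _); apply/val_inj.
rewrite -cE; apply: (@poly_coef_unique _ _ k.+1) => [e e0|]; last by rewrite ltnS.
have [d d0 Hd] := H e e0; exists d => // s s0 sd.
have := Hd s; rewrite gtr0_norm // => /(_ sd); congr (`|_| <= _).
rewrite big_ord_recl scaler0 add0r; apply: eq_bigr => i _.
by rewrite (_ : lift ord0 i = i.+1 :> nat) // cE.
Qed.

Lemma sum_jet_coefs (c : nat -> 'rV[R]_n) s : c 0 = 0 ->
  \sum_(m < k.+1) s ^+ m *: c m = jet_poly (\matrix_(r < k) c r.+1) s.
Proof.
move=> c0; rewrite big_ord_recl c0 scaler0 add0r; apply: eq_bigr => i _.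
by rewrite rowK (_ : lift ord0 i = i.+1 :> nat).
Qed.

End JetPoly.

(** Cauchy product cut at degree [k]. The first factor starts with s, so the pairs with r + c < k
    make up the jet and all others carry at least [s ^+ k.+1]. *)
Lemma jet_product_tail (R : realType) (Z : lmodType R) k (g : 'I_k -> R) (kap : nat -> Z) (s : R) :
  (\sum_(r < k) s ^+ r.+1 * g r) *: (\sum_(c < k.+1) s ^+ c *: kap c) =
  \sum_(m < k) s ^+ m.+1 *: (\sum_(r < k | (r <= m)%N) g r *: kap (m - r)%N) +
  \sum_(r < k) \sum_(c < k.+1 | (k <= r + c)%N) s ^+ (r + c).+1 *: (g r *: kap c).
Proof.
rewrite scaler_suml.
under [X in _ = X + _]eq_bigr do rewrite scaler_sumr big_mkcond.
rewrite [X in _ = X + _]exchange_big -big_split /=; apply: eq_bigr => r _.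
rewrite scaler_sumr (bigID (fun c : 'I_k.+1 => (k <= r + c)%N)) /= addrC.
have E c : s ^+ r.+1 * g r *: (s ^+ c *: kap c) = s ^+ (r + c).+1 *: (g r *: kap c).
  by rewrite !scalerA -addSn exprD; congr (_ *: _); ring.
congr (_ + _); last by apply: eq_bigr => c _; exact: E.
rewrite -big_mkcond /=.
rewrite -(big_geq_mkord r k xpredT (fun m => s ^+ m.+1 *: (g r *: kap (m - r)%N))).
rewrite -[X in \sum_(X <= _ < _) _]add0n big_addn.
rewrite [RHS](big_nat_widen _ _ k.+1); last by rewrite leqW // leq_subr.
rewrite big_mkord; apply: eq_big => [c|c _]; first by rewrite -ltnNge /= ltn_subRL.
by rewrite E addnK [(c + r)%N]addnC.
Qed.

Lemma norm_lt_min_itv (R : realType) (a b t z : R) :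
  `|z - t| < Num.min (t - a) (b - t) -> a <= z <= b.
Proof.
rewrite lt_min !ltr_norml => /andP[/andP[h1 h2] /andP[h3 h4]].
by apply/andP; split; lra.
Qed.

Lemma abs_continuous_nondecreasing (R : realType) (a b : R) (W w : R -> R) :
  abs_continuous a b W ->
  {ae lebesgue_measure, forall t : R, t \in `[a, b] -> is_derive t 1 W (w t) /\ 0 <= w t} ->
  forall x y, a <= x -> x <= y -> y <= b -> W x <= W y.
Proof.
move=> acW dW x y ax xy yb; rewrite -subr_ge0; apply: le_trans (normr_ge0 (0 - 0 : R)) _.
apply: (@abs_continuous_comparison _ R x y (fun=> 0) W w xy).
- exact: abs_continuous_cst.
- exact: abs_continuousS acW.
- apply: filterS dW => z hz zxy; have zab : z \in `[a, b].
    move: zxy; rewrite !in_itv /= => /andP[xz zy].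
    by rewrite (le_trans ax xz) (le_trans zy yb).
  by have [h1 h2] := hz zab; exists 0; split; rewrite ?normr0 //; exact: is_derive_cst.
Qed.

Lemma jet_variation_le (R : realType) l k (Du : 'I_k -> R -> 'rV[R]_l) (s t w : R) i :
  `|s| <= 1 -> (forall r, `|Du r t ord0 i| <= w) ->
  `|jet_variation Du s t ord0 i| <= k%:R * `|s| * w.
Proof.
move=> s1 Dw; rewrite /jet_variation summxE; apply: le_trans (ler_norm_sum _ _ _) _.
have -> : k%:R * `|s| * w = \sum_(r < k) (`|s| * w).
  by rewrite sumr_const card_ord -mulrA mulr_natl.
apply: ler_sum => r _; rewrite mxE normrM ler_pM //.
by rewrite normrX exprS; apply: ler_piMr => //; apply: exprn_ile1.
Qed.

(** The common radius is the inverse of 1 plus the sum of the inverse radii, the common constant is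
    the sum; this also works for an empty index type. *)
Lemma finite_constants (R : realType) (I : finType) (Q : I -> R -> R -> Prop) :
  (forall i r r' C C', 0 < r' -> r' <= r -> C <= C' -> Q i r C -> Q i r' C') ->
  (forall i, exists2 r : R, 0 < r & exists2 C : R, 0 <= C & Q i r C) ->
  exists2 r : R, 0 < r & exists2 C : R, 0 <= C & forall i, Q i r C.
Proof.
move=> Qm H.
have H' i : exists p : R * R, [/\ 0 < p.1, 0 <= p.2 & Q i p.1 p.2].
  by have [r r0 [C C0 h]] := H i; exists (r, C).
have [f Hf] := choice H'.
pose S := \sum_i (f i).1^-1.
have S0 : 0 <= S by apply: sumr_ge0 => i _; rewrite invr_ge0; have [/ltW] := Hf i.
exists (S + 1)^-1; first by rewrite invr_gt0 ltr_wpDl.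
exists (\sum_i (f i).2); first by apply: sumr_ge0 => i _; have [] := Hf i.
move=> i; have [r0 C0 Qi] := Hf i; apply: Qm Qi; first by rewrite invr_gt0 ltr_wpDl.
  rewrite -[leRHS]invrK lef_pV2 ?posrE ?invr_gt0 // ?ltr_wpDl //.
  rewrite /S (bigD1 i) //= -addrA lerDl addr_ge0 //.
  by apply: sumr_ge0 => j _; rewrite invr_ge0; have [/ltW] := Hf j.
by rewrite (bigD1 i) //= lerDl; apply: sumr_ge0 => j _; have [] := Hf j.
Qed.

(** * Expansion on an interval within one chart *)

Section Piece.
Context {R : realType} {n l k : nat}.
Local Notation V := 'rV[R]_n.
Variables (a b : R) (U : set V) (X : 'I_l -> V -> V) (u : R -> 'rV[R]_l).
Variables (Du : 'I_k -> R -> 'rV[R]_l) (x0 : R -> V) (x : R -> R -> V).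
Variables (Phi : R -> seq V -> V) (W w : R -> R) (dl : R).

Definition rhs m (z : V) t := - \sum_(i < l) u t ord0 i *:
  \sum_(1 <= s < m.+1) 'C(m, s)%:R *:
    Phi t (iter_derive (nseq s z) (X i) (x0 t) :: nseq (m - s) z).

Hypothesis ab : a <= b.
Hypothesis oU : open U.
Hypothesis sX : forall i, smooth_on U (X i).
Hypothesis ac0 : abs_continuous a b x0.
Hypothesis Ux0 : forall t, a <= t -> t <= b -> U (x0 t).
Hypothesis d0 : {ae lebesgue_measure, forall t : R, t \in `[a, b] ->
  is_derive t 1 x0 (\sum_(i < l) u t ord0 i *: X i (x0 t))}.
Hypothesis dl0 : 0 < dl.
Hypothesis xs : forall s, `|s| < dl -> caratheodory_solution a b
  (fun t y => \sum_(i < l) (u t + jet_variation Du s t) ord0 i *: X i y) (x s).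
Hypothesis Ov : unif_O [set t | a <= t <= b] 1 (fun s t => x s t - x0 t).
Hypothesis acW : abs_continuous a b W.
Hypothesis dW : {ae lebesgue_measure, forall t : R, t \in `[a, b] ->
  [/\ is_derive t 1 W (w t), 0 <= w t, forall i, `|u t ord0 i| <= w t &
      forall r i, `|Du r t ord0 i| <= w t]}.
Hypothesis iDu : forall r i, ae_integrable (fun t => Du r t ord0 i) a b.
Hypothesis sPhi : forall t, a <= t -> t <= b -> symmetric_multilinear (Phi t).
Hypothesis Phi_sol : forall m, (0 < m)%N -> forall z,
  caratheodory_solution a b (fun t _ => rhs m z t) (fun t => Phi t (nseq m z)).
Hypothesis injPhi : forall t, a <= t -> t <= b -> forall z, Phi t [:: z] = 0 -> z = 0.

Let D := [set t | a <= t <= b].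
Let DX i t vs := iter_derive vs (X i) (x0 t).
Let v s t := x s t - x0 t.
(* [Phi t] is unspecified on the empty list; [tail_family 0] removes that value
   and [tail_family 1] also the linear part. *)
Definition tail_family (q : nat) t vs := if (q < size vs)%N then Phi t vs else 0.
Let E s t := taylor_sum (k := k) (tail_family 0 t) (v s t).

Let cx0 : cont_on a b x0. Proof. exact: abs_continuous_cont_on. Qed.

Let sDX i t : D t -> symmetric_multilinear (DX i t).
Proof. by move=> /andP[at_ tb]; apply: (iter_derive_symmetric oU (sX i)); exact: Ux0. Qed.

Let bDX i p : multibounded D (DX i) p.
Proof.
have [r r0 [C C0 H]] := tube_bounded p oU (sX i) cx0 Ux0.
exists C => // t vs /andP[at_ tb] vsp.
by have [|_] := H t (x0 t) at_ tb; [rewrite subrr normr0|exact].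
Qed.

Let cDX i vs : cont_on a b (fun t => DX i t vs).
Proof.
apply: (cont_on_comp (g := iter_derive vs (X i)) cx0) => t at_ tb.
by apply: differentiable_continuous; apply: sX; exact: Ux0.
Qed.

Let sPhiD t : D t -> symmetric_multilinear (Phi t).
Proof. by move=> /andP[at_ tb]; exact: sPhi. Qed.

Lemma rhs_continuous m t : (0 < m)%N -> a <= t -> t <= b -> continuous (fun z => rhs m z t).
Proof.
move=> m0 at_ tb z0; rewrite /rhs.
have Dt : D t by rewrite /D /= at_.
have csum (I : Type) (r : seq I) (f : I -> V -> V) : (forall i, {for z0, continuous (f i)}) ->
    {for z0, continuous (fun z => \sum_(i <- r) f i z)}.
  move=> cf; elim: r => [|i r IH].
    by rewrite (_ : (fun z => _) = cst 0); [exact: cst_continuous|apply/funext => z; rewrite big_nil].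
  rewrite (_ : (fun z => _) = (fun z => f i z + \sum_(i <- r) f i z)); first exact: continuous_atD.
  by apply/funext => z; rewrite big_cons.
have cscale (c : R) (f : V -> V) : {for z0, continuous f} ->
    {for z0, continuous (fun z => c *: f z)}.
  by move=> cf; apply: (continuous_atZ (c := fun=> c)) => //; exact: cst_continuous.
rewrite (_ : (fun z => _) = (fun z => (-1) *: \sum_(i < l) u t ord0 i *:
  \sum_(1 <= s < m.+1) 'C(m, s)%:R *:
    Phi t (iter_derive (nseq s z) (X i) (x0 t) :: nseq (m - s) z))); last first.
  by apply/funext => z; rewrite scaleN1r.
apply: (cscale (-1)); apply: (csum _ _ (fun i z => _ *: _)) => i.
apply: (cscale (u t ord0 i)); apply: (csum _ _ (fun s z => _ *: _)) => s.
apply: (cscale 'C(m, s)%:R).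
exact: (@continuous_multilinear R n (Phi t) (fun z => DX i t (nseq s z)) (m - s)
  (sPhiD Dt) (@continuous_multilinear_nseq R n (DX i t) s (sDX i Dt)) z0).
Qed.

Let bPhi p : (0 < p)%N -> multibounded D Phi p.
Proof. by move=> p0; exact: (Phi_multibounded sPhi Phi_sol). Qed.

Lemma tail_family_symmetric q t : D t -> symmetric_multilinear (tail_family q t).
Proof.
move=> Dt; have [pP lP] := sPhiD Dt; rewrite /tail_family; split.
  by move=> vs ws pvw; rewrite (perm_size pvw); case: ifP => // _; exact: pP.
by move=> vs c y z; rewrite /=; case: ifP => _; [exact: lP|rewrite scaler0 addr0].
Qed.

Lemma tail_family_bounded q p : multibounded D (tail_family q) p.
Proof.
case: (posnP p) => [->|p0].
  exists 0 => // t vs Dt /size0nil ->.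
  by rewrite /tail_family ltn0 normr0 mul0r.
have [C C0 HC] := bPhi p0; exists C => // t vs Dt vsp; rewrite /tail_family.
case: ifP => _; first exact: HC.
by rewrite normr0 mulr_ge0 // prodr_ge0.
Qed.

Let EE s t : E s t = \sum_(j < k) (j.+1`!)%:R^-1 *: Phi t (nseq j.+1 (v s t)).
Proof. by rewrite /E /taylor_sum big_ord_recl /tail_family /= scaler0 add0r. Qed.

Let ac_v s : `|s| < dl -> abs_continuous a b (v s).
Proof. by move=> sd; apply: abs_continuousB => //; have [] := xs sd. Qed.

Lemma E_abs_continuous s : `|s| < dl -> abs_continuous a b (E s).
Proof.
move=> sd; apply: (@abs_continuous_eq _ _ a b (fun t => \sum_(j < k) (j.+1`!)%:R^-1 *: Phi t (nseq j.+1 (v s t)))).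
  by move=> t _ _; rewrite EE.
apply: abs_continuous_sum => j _; apply: abs_continuousZ.
by apply: (Phi_curve_abs_continuous sPhi Phi_sol) => //; exact: ac_v.
Qed.

Let unif_O_norm (V' : normedModType R) m (h : R -> R -> V') : unif_O D m h ->
  unif_O D m (fun s t => `|h s t| : R^o).
Proof.
move=> [C C0 [d dd H]]; exists C => //; exists d => // s t sd Dt.
by rewrite normr_id; exact: H.
Qed.

(** Three remainders, all O(s^(k+1)) times [w t]: the uncancelled terms, of degree above [k] in v =
    O(s); the last term of the double Taylor sum, of degree only [k] but multiplied by s o Du; and
    the Taylor remainders of the fields, which both controls multiply. This explains the weights 1,
    [k] and [1 + k] of the three constants. The factor [w t] stays because controls need not be
    bounded. *)
Lemma E_derive : exists2 C : R, 0 <= C & exists2 d : R, 0 < d & d <= dl /\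
  forall s, `|s| < d -> {ae lebesgue_measure, forall t : R, t \in `[a, b] ->
    exists2 e', is_derive t 1 (E s) e' &
      `|e' - \sum_i (jet_variation Du s t) ord0 i *: double_taylor (k := k) (Phi t) (DX i t) (v s t)|
        <= w t * (C * `|s| ^+ k.+1)}.
Proof.
pose zeta i s t := taylor_sum (k := k) (DX i t) (v s t).
pose rho i s t := X i (x s t) - zeta i s t.
have Orho i : unif_O D k.+1 (rho i).
  have [r r0 [C C0 HT]] := taylor_tube k.+1 oU (sX i) cx0 Ux0.
  have [Cv Cv0 [dv dv0 Hv]] := Ov.
  have Cv1 : 0 < Cv + 1 by apply: ltr_wpDl.
  exists (C * Cv ^+ k.+1); first by rewrite mulr_ge0 // exprn_ge0.
  exists (Num.min dv (r / (Cv + 1))) => [|s t]; first by rewrite lt_min dv0 divr_gt0.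
  rewrite lt_min => /andP[sd sr] /andP[at_ tb].
  have vb : `|v s t| <= Cv * `|s| by rewrite -[`|s|]expr1; apply: Hv; rewrite // /D /= at_.
  have vr : `|v s t| < r.
    apply: le_lt_trans vb _; apply: (@le_lt_trans _ _ ((Cv + 1) * `|s|)).
      by rewrite ler_wpM2r // lerDl.
    by rewrite mulrC -ltr_pdivlMr.
  have [_] := HT t (v s t) at_ tb vr.
  have -> : x0 t + v s t = x s t by rewrite addrC subrK.
  move=> h; apply: le_trans h _; rewrite -mulrA ler_wpM2l // -exprMn.
  by rewrite lerXn2r // nnegrE // mulr_ge0.
pose A i s t := \sum_(q < k) \sum_(c < k | (k <= q + c)%N)
  high_term (Phi t) (fun i => DX i t) (v s t) i q c.
pose Bt i s t := (k`!)%:R^-1 *: Phi t (zeta i s t :: nseq k (v s t)).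
pose L i s t := low_sum (k := k) (Phi t) (v s t) (rho i s t).
have OA i : unif_O D k.+1 (A i).
  apply: unif_O_sum => q _; apply: unif_O_sum => c kqc; apply: unif_OZ.
  apply: (@unif_O_weaken _ _ _ _ (q.+1 + c)); first by rewrite addSn ltnS.
  by apply: unif_O_multilinear => //; [exact: bPhi|exact: unif_O_nseq].
have OB i : unif_O D k (Bt i).
  apply: unif_OZ; rewrite -[k in unif_O _ k]add0n; apply: unif_O_multilinear => //.
    exact: bPhi.
  by apply: taylor_sum_bounded => // p _; exact: bDX.
have OL i : unif_O D k.+1 (L i).
  apply: unif_O_sum => j _; apply: unif_OZ.
  apply: (@unif_O_weaken _ _ _ _ (k.+1 + j)); first exact: leq_addr.
  by apply: unif_O_multilinear => //; exact: bPhi.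
have ON (m : nat) (h : 'I_l -> R -> R -> V) : (forall i, unif_O D m (h i)) ->
    unif_O D m (fun s t => (\sum_i `|h i s t|) : R^o).
  by move=> Oh; apply: unif_O_sum => i _; exact: unif_O_norm.
have [CA CA0 [dA dA0 HA]] := ON _ _ OA.
have [CB CB0 [dB dB0 HB]] := ON _ _ OB.
have [CL CL0 [dL dL0 HL]] := ON _ _ OL.
exists (CA + k%:R * CB + (1 + k%:R) * CL).
  by rewrite !addr_ge0 // mulr_ge0 // addr_ge0.
exists (Num.min (Num.min dl 1) (Num.min dA (Num.min dB dL))).
  by rewrite !lt_min dl0 ltr01 dA0 dB0 dL0.
split; first by rewrite !ge_min lexx.
move=> s; rewrite !lt_min => /andP[/andP[sdl s1] /and3P[sA sB sL]].
have [acxs dxs] := xs sdl.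
have Pd := ae_foralln (fun j => Phi_curve_derive sPhi rhs_continuous Phi_sol (ltn0Sn j)).
apply: filterS3 (filterI dxs d0) Pd dW => t [h1 h2] hP hW tab.
have {}h1 := h1 tab; have {}h2 := h2 tab.
have [dWt w0 uw Duw] := hW tab.
have Dt : D t by move: tab; rewrite in_itv.
pose jv i := jet_variation Du s t ord0 i.
have dv := is_deriveB h1 h2.
set v' := (X in is_derive t 1 _ X) in dv.
have dE : is_derive t 1 (E s) (\sum_(j < k) (j.+1`!)%:R^-1 *:
    (rhs j.+1 (v s t) t + j.+1%:R *: Phi t (v' :: nseq j (v s t)))).
  rewrite (_ : E s = fun z => \sum_(j < k) (j.+1`!)%:R^-1 *: Phi z (nseq j.+1 (v s z))); last first.
    by apply/funext => z; exact: EE.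
  apply: is_derive_sum_fun => j; apply: is_deriveZ; exact: (hP j tab _ _ dv).
eexists; first exact: dE.
have v'E : v' = \sum_i (u t ord0 i + jv i) *: (zeta i s t + rho i s t) -
    \sum_i u t ord0 i *: DX i t [::].
  rewrite /v'; congr (_ - _); apply: eq_bigr => i _.
  have -> : zeta i s t + rho i s t = X i (x s t) by rewrite /rho [LHS]addrC subrK.
  by rewrite mxE.
have := @derivative_algebra R n l k (Phi t) (fun i => DX i t) (v s t)
  (fun i => u t ord0 i) jv (fun i => rho i s t) (sPhiD Dt).
rewrite /= -v'E => ->; rewrite [X in X - _]addrC addrK.
have jvw i : `|jv i| <= k%:R * `|s| * w t by apply: jet_variation_le => //; exact: ltW.
have bsum (c : 'I_l -> R) (h : 'I_l -> V) (M : R) : (forall i, `|c i| <= M) ->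
    `|\sum_i c i *: h i| <= M * \sum_i `|h i|.
  move=> cM; apply: le_trans (ler_norm_sum _ _ _) _; rewrite mulr_sumr.
  by apply: ler_sum => i _; rewrite normrZ ler_wpM2r.
have hA := le_trans (ler_norm _) (HA s t sA Dt).
have hB := le_trans (ler_norm _) (HB s t sB Dt).
have hL := le_trans (ler_norm _) (HL s t sL Dt).
apply: le_trans (ler_normD _ _) _.
have -> : w t * ((CA + k%:R * CB + (1 + k%:R) * CL) * `|s| ^+ k.+1) =
    (w t * (CA * `|s| ^+ k.+1) + k%:R * `|s| * w t * (CB * `|s| ^+ k)) +
    (1 + k%:R) * w t * (CL * `|s| ^+ k.+1).
  by rewrite [in LHS]exprS [in RHS]exprS; ring.
apply: lerD.
  apply: le_trans (ler_normB _ _) _; apply: lerD.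
    by apply: le_trans (bsum _ _ _ uw) _; apply: ler_wpM2l.
  apply: le_trans (bsum _ _ _ jvw) _; apply: ler_wpM2l => //.
  by rewrite !mulr_ge0.
have ujw i : `|u t ord0 i + jv i| <= (1 + k%:R) * w t.
  apply: le_trans (ler_normD _ _) _; rewrite mulrDl mul1r; apply: lerD => //.
  apply: le_trans (jvw i) _; apply: ler_wpM2r => //.
  by apply: ler_piMr => //; exact: ltW.
apply: le_trans (bsum _ _ _ ujw) _; apply: ler_wpM2l => //.
by rewrite mulr_ge0 // addr_ge0.
Qed.

Lemma Phi_cont_on vs : (0 < size vs)%N -> cont_on a b (fun t => Phi t vs).
Proof.
by move=> vs0; apply: abs_continuous_cont_on; exact: (Phi_abs_continuous sPhi Phi_sol).
Qed.

Lemma cont_on_multilinear (F : R -> seq V -> V) (J : Type) (js : seq J) (f : J -> R -> V) :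
  (forall t, D t -> symmetric_multilinear (F t)) ->
  (forall vs, size vs = size js -> cont_on a b (fun t => F t vs)) ->
  (forall j, cont_on a b (f j)) -> cont_on a b (fun t => F t [seq f j t | j <- js]).
Proof.
move=> sF cF cf.
apply: (@multilinear_closure R n R J D (fun g => cont_on a b g) (fun g => cont_on a b g)
  _ _ _ _ js F f) => //.
- by move=> g h gh; apply: cont_on_ext => t at_ tb; apply: gh; rewrite /D /= at_.
- exact: cont_on_cst.
- by move=> g h; exact: cont_onD.
- by move=> c g; exact: cont_onZ.
- by move=> wd wds; apply: cF; rewrite size_map.
- by move=> j i; exact: (cont_on_coord ord0 i (cf j)).
Qed.

Lemma cont_on_insert_powers (F : R -> seq V -> V) (z : R -> V) (B : R -> 'M[R]_(k, n)) al :
  (forall t, D t -> symmetric_multilinear (F t)) ->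
  (forall vs, (0 < size vs)%N -> cont_on a b (fun t => F t vs)) ->
  cont_on a b z -> cont_on a b B ->
  cont_on a b (fun t => F t (z t :: insert_powers (B t) al)).
Proof.
move=> sF cF cz cB.
pose js := flatten [seq nseq (al i) i | i <- enum 'I_k].
have jsE t : insert_powers (B t) al = [seq row j (B t) | j <- js].
  rewrite /insert_powers /js map_flatten -[in RHS]map_comp; congr flatten.
  by apply: seq.eq_map => i; rewrite /= map_nseq.
(* [None] labels the extra first argument, so that all arguments form a single labelled list. *)
pose f (j : option 'I_k) t := if j is Some i then row i (B t) else z t.
apply: (@cont_on_ext _ _ a b (fun t => F t [seq f j t | j <- None :: [seq Some j | j <- js]])).
  by move=> t _ _; rewrite /= -map_comp jsE.
apply: cont_on_multilinear => // [vs vss|[i|] //=].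
  by apply: cF; rewrite vss.
apply: cont_on_mx => i' j; apply: (cont_on_ext _ (cont_on_coord i j cB)) => t _ _.
by rewrite mxE.
Qed.

Lemma cont_on_insert_powers0 (F : R -> seq V -> V) (B : R -> 'M[R]_(k, n)) al :
  (forall t, D t -> symmetric_multilinear (F t)) ->
  (forall vs, cont_on a b (fun t => F t vs)) -> cont_on a b B ->
  cont_on a b (fun t => F t (insert_powers (B t) al)).
Proof.
move=> sF cF cB.
pose js := flatten [seq nseq (al i) i | i <- enum 'I_k].
apply: (@cont_on_ext _ _ a b (fun t => F t [seq row j (B t) | j <- js])) => [t _ _|].
  rewrite /insert_powers /js map_flatten -[in LHS]map_comp; congr (F t (flatten _)).
  by apply: seq.eq_map => i; rewrite /= map_nseq.
apply: cont_on_multilinear => // i.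
apply: cont_on_mx => i' j; apply: (cont_on_ext _ (cont_on_coord i j cB)) => t _ _.
by rewrite mxE.
Qed.

Lemma double_coef_cont_on c i (B : R -> 'M[R]_(k, n)) : cont_on a b B ->
  cont_on a b (fun t => double_coef (Phi t) (DX i t) c (B t)).
Proof.
move=> cB; apply: cont_on_sum => p _; apply: cont_onZ; first exact: cont_on_cst.
apply: (@cont_on_insert_powers Phi (fun t => DX i t (insert_powers (B t) p.2)) B p.1) => //.
  exact: Phi_cont_on.
by apply: (@cont_on_insert_powers0 (DX i)) => // t; exact: sDX.
Qed.

(** The q-components of the asserted system, as a function of the jet. Row [c] belongs to q^(c+1),
    where the variation of index [r] meets y^(c+1-r), of weight [c - r]. *)
Definition jet_rhs (B : 'M[R]_(k, n)) t : 'M[R]_(k, n) :=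
  \matrix_(c < k) \sum_(r < k | (r <= c)%N) \sum_(i < l)
    Du r t ord0 i *: double_coef (Phi t) (fun vs => iter_derive vs (X i) (x0 t)) (c - r) B.

Lemma jet_rhs_integrable (B : R -> 'M[R]_(k, n)) c j : cont_on a b B ->
  ae_integrable (fun t => jet_rhs (B t) t c j) a b.
Proof.
move=> cB.
pose h r i t := double_coef (Phi t) (DX i t) (c - r) (B t) ord0 j.
have := @ae_integrable_sum R _ (index_enum 'I_k) (fun r => r <= c)%N
  (fun r t => \sum_(i < l) h r i t * Du r t ord0 i) a b.
move=> H; apply: ae_integrable_eq (H _).
  apply: aeW => t _; rewrite mxE summxE; apply: eq_bigr => r _.
  by rewrite summxE; apply: eq_bigr => i _; rewrite mxE mulrC.
move=> r _; apply: ae_integrable_sum => i _; apply: ae_integrable_mul => //.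
by apply/cont_onP; apply: cont_on_coord; exact: double_coef_cont_on.
Qed.

Let unif_o_norm (V' : normedModType R) m (h : R -> R -> V') : unif_o D m h ->
  unif_o D m (fun s t => `|h s t| : R^o).
Proof.
move=> H; apply: (unif_o_dominated (C := 1) _ H); exists 1 => // s t _ _.
by rewrite normr_id mul1r.
Qed.

Lemma double_coef_bounded (B : R -> 'M[R]_(k, n)) : cont_on a b B ->
  exists2 C : R, 0 <= C & forall t i c, D t -> (c <= k)%N ->
    `|double_coef (Phi t) (DX i t) c (B t)| <= C.
Proof.
move=> cB.
have H (p : 'I_l * 'I_k.+1) : exists C : R, 0 <= C /\ forall t, a <= t -> t <= b ->
    `|double_coef (Phi t) (DX p.1 t) p.2 (B t)| <= C.
  by have [C C0 HC] := cont_on_bounded (double_coef_cont_on p.2 p.1 cB); exists C.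
have [f Hf] := choice H; exists (\sum_p f p).
  by apply: sumr_ge0 => p _; have [] := Hf p.
move=> t i c /andP[at_ tb]; rewrite -ltnS => ck; have [_ h] := Hf (i, Ordinal ck).
apply: le_trans (h t at_ tb) _; rewrite (bigD1 (i, Ordinal ck)) //= lerDl.
by apply: sumr_ge0 => p _; have [] := Hf p.
Qed.

(** The factor s in s o Du raises the accuracy from [m] to [m.+1], up to the order [k] at which the
    jet is cut. The bound is relative to [c], any majorant of the variations at time t, because no
    bound uniform in t exists; [w t] is inserted later. *)
Lemma jet_rhs_derivative_bound m (B : R -> 'M[R]_(k, n)) : (m <= k)%N -> cont_on a b B ->
  unif_o D m (fun s t => v s t - jet_poly (B t) s) ->
  forall e : R, 0 < e -> exists2 d : R, 0 < d & forall s t, `|s| < d -> D t ->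
    forall c : R, (forall r i, `|Du r t ord0 i| <= c) -> 0 <= c ->
    `|\sum_i (jet_variation Du s t) ord0 i *: double_taylor (k := k) (Phi t) (DX i t) (v s t)
      - jet_poly (jet_rhs (B t) t) s| <= c * (e * `|s| ^+ minn m.+1 k).
Proof.
move=> mk cB vB.
have bB : exists2 C : R, 0 <= C & forall t, D t -> `|B t| <= C.
  by have [C C0 HC] := cont_on_bounded cB; exists C => // t /andP[]; exact: HC.
have OJ := unif_O_jet_poly bB.
pose err i s t := double_taylor (k := k) (Phi t) (DX i t) (v s t) -
  \sum_(c < k.+1) s ^+ c *: double_coef (Phi t) (DX i t) c (B t).
have oerr i : unif_o D m (err i).
  have h1 := double_taylor_lipschitz sPhiD (sDX i) bPhi (bDX i) Ov OJ vB.
  have h2 := unif_o_weaken mk (unif_O_o (double_taylor_jet sPhiD (sDX i) bPhi (bDX i) bB)).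
  by apply: unif_o_ext (unif_oD (h1 k) h2) => s t _; rewrite addrA subrK.
have oS : unif_o D m (fun s t => (\sum_i `|err i s t|) : R^o).
  by apply: unif_o_sum => i _; exact: unif_o_norm.
have [C C0 HC] := double_coef_bounded cB.
(* A bound for the number of tail terms times the bound [C] of a coefficient; the extra factor |s|
   of the tail makes it harmless. *)
pose N : R := l%:R * (k%:R * (k.+1%:R * C)).
have N0 : 0 <= N by rewrite !mulr_ge0.
move=> e e0; have e'0 : 0 < e / 2 / (k%:R + 1) by rewrite !divr_gt0 // ltr_wpDl.
have [d dd Hd] := oS _ e'0.
exists (Num.min (Num.min d 1) (e / 2 / (N + 1))).
  by rewrite !lt_min dd ltr01 !divr_gt0 // ltr_wpDl.
move=> s t; rewrite !lt_min => /andP[/andP[sd s1] sN] Dt c Dc c0.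
have s1' := ltW s1.
have jvE i : jet_variation Du s t ord0 i = \sum_(r < k) s ^+ r.+1 * Du r t ord0 i.
  by rewrite /jet_variation summxE; apply: eq_bigr => r _; rewrite mxE.
have -> : \sum_i (jet_variation Du s t) ord0 i *: double_taylor (k := k) (Phi t) (DX i t) (v s t)
      - jet_poly (jet_rhs (B t) t) s = \sum_i jet_variation Du s t ord0 i *: err i s t +
    \sum_i \sum_(r < k) \sum_(c < k.+1 | (k <= r + c)%N) s ^+ (r + c).+1 *:
      (Du r t ord0 i *: double_coef (Phi t) (DX i t) c (B t)).
  have -> : jet_poly (jet_rhs (B t) t) s = \sum_i \sum_(m < k) s ^+ m.+1 *:
      (\sum_(r < k | (r <= m)%N) Du r t ord0 i *: double_coef (Phi t) (DX i t) (m - r) (B t)).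
    rewrite /jet_poly exchange_big /=; apply: eq_bigr => c' _.
    by rewrite rowK exchange_big /= scaler_sumr.
  rewrite -sumrB -big_split /=; apply: eq_bigr => i _.
  have := jet_product_tail (fun r => Du r t ord0 i)
    (fun c => double_coef (Phi t) (DX i t) c (B t)) s.
  by rewrite -jvE /err scalerBr => ->; rewrite opprD -!addrA addNr addr0.
set p := minn m.+1 k.
have sp (q : nat) : (p <= q)%N -> `|s| ^+ q <= `|s| ^+ p by exact: ler_wiXn2l.
have -> : c * (e * `|s| ^+ p) = c * (e / 2 * `|s| ^+ p) + c * (e / 2 * `|s| ^+ p).
  by rewrite -mulrDr -mulrDl -splitr.
apply: le_trans (ler_normD _ _) _; apply: lerD.
  have jvb i : `|jet_variation Du s t ord0 i| <= k%:R * `|s| * c by exact: jet_variation_le.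
  apply: le_trans (ler_norm_sum _ _ _) _.
  apply: (@le_trans _ _ (k%:R * `|s| * c * \sum_i `|err i s t|)).
    by rewrite mulr_sumr; apply: ler_sum => i _; rewrite normrZ ler_wpM2r.
  have {}Hd := le_trans (ler_norm _) (Hd s t sd Dt).
  apply: (@le_trans _ _ (k%:R * `|s| * c * (e / 2 / (k%:R + 1) * `|s| ^+ m))).
    by apply: ler_wpM2l => //; rewrite !mulr_ge0.
  have -> : k%:R * `|s| * c * (e / 2 / (k%:R + 1) * `|s| ^+ m) =
      c * (e / 2 * (k%:R / (k%:R + 1) * `|s| ^+ m.+1)) by rewrite exprS; ring.
  apply: ler_wpM2l => //; apply: ler_wpM2l; first by rewrite divr_ge0 // ltW.
  apply: le_trans (sp m.+1 (geq_minl _ _)).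
  apply: ler_piMl; first exact: exprn_ge0.
  by rewrite ler_pdivrMr ?mul1r ?lerDl // ltr_wpDl.
apply: (@le_trans _ _ (N * (`|s| ^+ k.+1 * c))).
  have bnd (I : finType) (P : pred I) (f : I -> V) (y : R) : 0 <= y ->
      (forall i, P i -> `|f i| <= y) -> `|\sum_(i | P i) f i| <= #|I|%:R * y.
    move=> y0 fy; apply: le_trans (ler_norm_sum _ _ _) _.
    have := ler_sum (index_enum I) fy => h; apply: le_trans h _.
    by rewrite sumr_const -[y *+ _]mulr_natl; apply: ler_wpM2r => //; rewrite ler_nat max_card.
  rewrite /N -!mulrA; set y := C * _.
  have y0 : 0 <= y by rewrite /y !mulr_ge0 // exprn_ge0.
  rewrite -[in l%:R](card_ord l) -[in k%:R](card_ord k) -[in k.+1%:R](card_ord k.+1).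
  apply: (bnd _ _ _ _) => [|i _]; first by rewrite !mulr_ge0.
  apply: (bnd _ _ _ _) => [|r _]; first by rewrite !mulr_ge0.
  apply: (bnd _ _ _ _) => // c' kc; rewrite !normrZ normrX /y mulrA [leLHS]mulrC.
  apply: ler_pM => //.
    by apply: HC => //; rewrite -ltnS.
  by apply: ler_pM => //; apply: ler_wiXn2l.
have -> : N * (`|s| ^+ k.+1 * c) = c * (N * `|s| * `|s| ^+ k) by rewrite exprS; ring.
apply: ler_wpM2l => //; apply: ler_pM => //.
- by rewrite mulr_ge0.
- apply: (@le_trans _ _ ((N + 1) * `|s|)); first by rewrite ler_wpM2r // lerDl.
  by rewrite mulrC -ler_pdivlMr; [exact: ltW|rewrite ltr_wpDl].
- exact: sp (geq_minr _ _).
Qed.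

(** [Q] is the primitive of [jet_rhs (B t) t] starting at [Qa]. The difference of [E] and its
    polynomial has a derivative bounded by a small multiple of [w t], so comparison with a multiple
    of [W] bounds the difference itself. *)
Lemma E_expansion m (B : R -> 'M[R]_(k, n)) (Qa : 'M[R]_(k, n)) :
  (m <= k)%N -> cont_on a b B ->
  unif_o D m (fun s t => v s t - jet_poly (B t) s) ->
  (forall e : R, 0 < e -> exists2 d : R, 0 < d & forall s, `|s| < d ->
     `|E s a - jet_poly Qa s| <= e * `|s| ^+ k) ->
  exists Q : R -> 'M[R]_(k, n), [/\ Q a = Qa, abs_continuous a b Q,
    {ae lebesgue_measure, forall t : R, t \in `[a, b] ->
       is_derive t 1 Q (jet_rhs (B t) t)} &
    unif_o D (minn m.+1 k) (fun s t => E s t - jet_poly (Q t) s)].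
Proof.
move=> mk cB vB initE.
have HK (p : 'I_k * 'I_n) := ae_integrable_primitive (jet_rhs_integrable p.1 p.2 cB).
have [K KP] := choice HK.
pose Q t := Qa + \matrix_(i, j) K (i, j) t.
have acQ : abs_continuous a b Q.
  apply: abs_continuousD; first exact: abs_continuous_cst.
  apply: abs_continuous_mx => i j; have [acK _ _] := KP (i, j).
  by apply: abs_continuous_eq acK => t _ _; rewrite mxE.
have dQ : {ae lebesgue_measure, forall t : R, t \in `[a, b] ->
    is_derive t 1 Q (jet_rhs (B t) t)}.
  have H (p : 'I_k * 'I_n) : {ae lebesgue_measure, forall t : R, t \in `[a, b] ->
      is_derive t 1 (K p) (jet_rhs (B t) t p.1 p.2)} by have [] := KP p.
  apply: filterS (ae_all_countable H) => t Ht tab.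
  apply/is_derive_mxP => i j.
  have := is_deriveD (is_derive_cst (Qa i j : R) t 1) (Ht (i, j) tab); rewrite add0r /=.
  by apply: (is_derive_near_eq ltr01) => z _; rewrite !mxE.
exists Q; split => //.
  rewrite /Q [X in _ + X](_ : _ = 0) ?addr0 //.
  by apply/matrixP => i j; rewrite !mxE; have [] := KP (i, j).
have [CE CE0 [dE dE0 [dEl HE]]] := E_derive.
pose Wb := W b - W a.
have Wmono t : D t -> 0 <= W t - W a /\ W t - W a <= Wb.
  move=> /andP[at_ tb].
  have H x' y : a <= x' -> x' <= y -> y <= b -> W x' <= W y.
    apply: (@abs_continuous_nondecreasing R a b W w acW).
    by apply: filterS dW => z hz zab; have [h1 h2 _ _] := hz zab.
  split; first by rewrite subr_ge0; exact: H.
  by rewrite /Wb lerD2r; exact: H.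
have Wb0 : 0 <= Wb.
  have Db : D b by rewrite /D /= ab lexx.
  by have [h1 h2] := Wmono b Db; exact: le_trans h1 h2.
have dl1 (e : R) : 0 < e -> 0 < e / (Wb + 1) by move=> e0; rewrite divr_gt0 // ltr_wpDl.
move=> e e0.
set p := minn m.+1 k.
(* One third for the initial value and one for each of the two errors in the derivative; dividing
   these two by [Wb + 1] absorbs the total growth of [W]. *)
have e30 : 0 < e / 3 by rewrite divr_gt0.
have [d1 d10 H1] := initE _ e30.
have [d2 d20 H2] := jet_rhs_derivative_bound mk cB vB (dl1 _ e30).
exists (Num.min (Num.min d1 d2) (Num.min (Num.min dE 1) (e / 3 / (Wb + 1) / (CE + 1)))).
  by rewrite !lt_min d10 d20 dE0 ltr01 divr_gt0 ?dl1 // ltr_wpDl.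
move=> s t; rewrite !lt_min => /andP[/andP[s1 s2] /andP[/andP[sE s11] sC]] /andP[at_ tb].
have sl := lt_le_trans sE dEl.
have sk : `|s| ^+ k <= `|s| ^+ p by apply: ler_wiXn2l => //; [exact: ltW|exact: geq_minr].
pose kap := 2 * (e / 3 / (Wb + 1)) * `|s| ^+ p.
have kap0 : 0 <= kap by rewrite !mulr_ge0 ?exprn_ge0 // ?ltW // invr_gt0 ltr_wpDl.
pose f z := E s z - jet_poly (Q z) s.
have acf : abs_continuous a b f.
  apply: abs_continuousB; first exact: E_abs_continuous.
  apply: abs_continuous_sum => r _; apply: abs_continuousZ.
  apply: abs_continuous_mx => i j.
  by apply: abs_continuous_eq (abs_continuous_coord r j acQ) => z _ _; rewrite [RHS]mxE.
have cmp : `|f t - f a| <= kap * W t - kap * W a.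
  apply: (@abs_continuous_comparison _ V a t f (fun z => kap * W z) (fun z => kap * w z)) => //.
  - exact: (abs_continuousS (lexx a) tb acf).
  - exact: (abs_continuousS (lexx a) tb (abs_continuousZ kap acW)).
  apply: filterS3 (HE s sE) dQ dW => z h1 h2 h3 zat.
  have zab : z \in `[a, b].
    by move: zat; rewrite !in_itv /= => /andP[-> zt]; exact: le_trans zt tb.
  have Dz : D z by move: zab; rewrite in_itv.
  have [e' de' e'b] := h1 zab; have {}h2 := h2 zab; have [dWz w0 uw Dw] := h3 zab.
  exists (e' - jet_poly (jet_rhs (B z) z) s); split.
  - apply: is_deriveB => //; apply: is_derive_sum_fun => r; apply: is_deriveZ.
    apply/is_derive_mxP => i j.
    have /is_derive_mxP/(_ r j) := h2.
    rewrite (_ : (fun y => row r (Q y) i j) = (fun y => Q y r j)); first by rewrite [row _ _ _ _]mxE.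
    by apply/funext => y; rewrite mxE.
  - exact: is_deriveZ.
  - have h4 := H2 s z s2 Dz (w z) Dw w0.
    rewrite (_ : kap * w z = w z * (e / 3 / (Wb + 1) * `|s| ^+ p) +
       w z * (e / 3 / (Wb + 1) * `|s| ^+ p)); last by rewrite /kap; ring.
    rewrite -(subrK (\sum_i jet_variation Du s z ord0 i *: double_taylor (k := k) (Phi z) (DX i z) (v s z)) e') -addrA.
    apply: le_trans (ler_normD _ _) _; apply: lerD => //.
    apply: le_trans e'b _; apply: ler_wpM2l => //; rewrite exprS mulrA.
    apply: ler_pM => //; first by rewrite mulr_ge0.
    apply: (@le_trans _ _ ((CE + 1) * `|s|)); first by rewrite ler_wpM2r // lerDl.
    by rewrite mulrC -ler_pdivlMr; [exact: ltW|rewrite ltr_wpDl].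
have fa : `|f a| <= e / 3 * `|s| ^+ p.
  rewrite /f (_ : Q a = Qa); last first.
    rewrite /Q [X in _ + X](_ : _ = 0) ?addr0 //.
    by apply/matrixP => i j; rewrite !mxE; have [] := KP (i, j).
  by apply: le_trans (H1 s s1) _; apply: ler_wpM2l => //; exact: ltW.
rewrite -/(f t) -(subrK (f a) (f t)); apply: le_trans (ler_normD _ _) _.
have -> : e * `|s| ^+ p = 2 * (e / 3) * `|s| ^+ p + e / 3 * `|s| ^+ p by field.
apply: lerD => //; apply: le_trans cmp _.
have Dt : D t by rewrite /D /= at_.
have [W1 W2] := Wmono t Dt.
rewrite -mulrBr; apply: le_trans (ler_wpM2l kap0 W2) _.
rewrite (_ : kap * Wb = 2 * (e / 3) * (Wb / (Wb + 1)) * `|s| ^+ p); last by rewrite /kap; ring.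
apply: ler_wpM2r; first exact: exprn_ge0.
apply: ler_piMr; first by rewrite mulr_ge0 // ltW.
by rewrite ler_pdivrMr ?mul1r ?lerDl // ltr_wpDl.
Qed.

Lemma multiboundedS (D1 D2 : set R) (F : R -> seq V -> V) p : D1 `<=` D2 ->
  multibounded D2 F p -> multibounded D1 F p.
Proof. by move=> D12 [C C0 H]; exists C => // t vs /D12; exact: H. Qed.

(** Weight 0 leaves only the empty list, where every tail family vanishes; for [q = 0] nothing else
    is removed. With [q = 1] only the constant coefficient is asked for. *)
Lemma tail_jet_coef q t c (B : 'M[R]_(k, n)) : (q <= 1)%N ->
  ((c == 0) || (q == 0))%N ->
  jet_coef c (tail_family q t) B = if (0 < c)%N then jet_coef c (Phi t) B else 0.
Proof.
move=> q1 cq; rewrite /jet_coef; case: posnP => [->|c0].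
  apply: big1 => al /eqP al0; rewrite /tail_family size_insert_powers.
  by have := weight_ge_mdeg al; rewrite al0 leqn0 => /eqP ->; rewrite ltn0 scaler0.
have {cq}q0 : q = 0 by move: cq; rewrite gtn_eqF //= => /eqP.
apply: eq_bigr => al /eqP alc; rewrite /tail_family size_insert_powers q0.
case: posnP => // al0; exfalso; move: c0; rewrite -alc.
suff -> : weight al = 0 by [].
apply: big1 => i _; move: al0; rewrite /mdeg => /eqP.
by rewrite sum_nat_eq0 => /forallP/(_ i) /= /eqP ->; rewrite muln0.
Qed.

Lemma taylor_tail_jet (D' : set R) q m (B : R -> 'M[R]_(k, n)) : D' `<=` D -> (q <= 1)%N ->
  (exists2 C : R, 0 <= C & forall t, D' t -> `|B t| <= C) ->
  unif_o D' m (fun s t => v s t - jet_poly (B t) s) -> (m + q <= k)%N ->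
  unif_o D' (m + q) (fun s t => taylor_sum (k := k) (tail_family q t) (v s t) -
    jet_poly (\matrix_(c < k) jet_coef c.+1 (tail_family q t) (B t)) s).
Proof.
move=> DD q1 bB vB mk.
have sF t : D' t -> symmetric_multilinear (tail_family q t).
  by move=> /DD; exact: tail_family_symmetric.
have bF p : (p <= k)%N -> multibounded D' (tail_family q) p.
  by move=> _; apply: (multiboundedS DD); exact: tail_family_bounded.
have F0 t vs : D' t -> (size vs < q.+1)%N -> tail_family q t vs = 0.
  by move=> _; rewrite ltnS /tail_family ltnNge => ->.
have Ov' : unif_O D' 1 v.
  by have [C C0 [d dd H]] := Ov; exists C => //; exists d => // s t sd /DD; exact: H.
have h1 := taylor_sum_lipschitz sF bF F0 Ov' (unif_O_jet_poly bB) vB.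
have h2 := unif_o_weaken mk (unif_O_o (taylor_sum_jet sF bF bB)).
apply: unif_o_ext (unif_oD h1 h2) => s t Dt.
rewrite -(@sum_jet_coefs R n k (fun c => jet_coef c (tail_family q t) (B t))); last exact: tail_jet_coef.
by rewrite addrA subrK.
Qed.

(** The subset [D'] allows two uses: the single time [a], to turn the initial jet of v into that of
    [E], and the whole interval, to identify the final coefficients. *)
Lemma E_jet (D' : set R) (B : R -> 'M[R]_(k, n)) : D' `<=` D ->
  (exists2 C : R, 0 <= C & forall t, D' t -> `|B t| <= C) ->
  unif_o D' k (fun s t => v s t - jet_poly (B t) s) ->
  unif_o D' k (fun s t => E s t - jet_poly (adapted_transform (Phi t) (B t)) s).
Proof.
move=> DD bB vB; have := taylor_tail_jet DD (leq0n 1) bB vB.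
rewrite addn0 leqnn => /(_ isT); apply: unif_o_ext => s t Dt; congr (_ - jet_poly _ s).
by apply/row_matrixP => c; rewrite !rowK tail_jet_coef ?eqxx ?orbT.
Qed.

Let P t : 'M[R]_n := \matrix_(i < n) Phi t [:: delta_mx ord0 i].

Let PE t z : D t -> z *m P t = Phi t [:: z].
Proof.
move=> Dt; rewrite (multilinear_expand _ _ (sPhiD Dt)) mulmx_sum_row.
by apply: eq_bigr => i _; rewrite rowK.
Qed.

Let P_unit t : D t -> P t \in unitmx.
Proof.
move=> Dt; rewrite -row_free_unit; apply: inj_row_free => z.
by rewrite PE // => h; have /andP[at_ tb] := Dt; exact: (injPhi at_ tb h).
Qed.

(* E is Phi^(1)[v] plus terms at least quadratic in v, whose expansions gain one
   order; so an expansion of E to order m + 1 can be solved for v. *)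
Lemma expansion_step m (B : R -> 'M[R]_(k, n)) (Q : R -> 'M[R]_(k, n)) : (m < k)%N ->
  cont_on a b B -> abs_continuous a b Q ->
  unif_o D m (fun s t => v s t - jet_poly (B t) s) ->
  unif_o D m.+1 (fun s t => E s t - jet_poly (Q t) s) ->
  exists2 B' : R -> 'M[R]_(k, n), cont_on a b B' &
    unif_o D m.+1 (fun s t => v s t - jet_poly (B' t) s).
Proof.
move=> mk cB acQ vB EQ.
have bB : exists2 C : R, 0 <= C & forall t, D t -> `|B t| <= C.
  by have [C C0 HC] := cont_on_bounded cB; exists C => // t /andP[]; exact: HC.
pose H t : 'M[R]_(k, n) := \matrix_(c < k) jet_coef c.+1 (tail_family 1 t) (B t).
have oH := taylor_tail_jet (fun t (h : D t) => h) (leqnn 1) bB vB.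
rewrite addn1 in oH; have {}oH := oH mk.
have cP i j : cont_on a b (fun t => P t i j).
  apply: (cont_on_ext _ (cont_on_coord ord0 j (@Phi_cont_on [:: delta_mx ord0 i] isT))) => t _ _.
  by rewrite mxE.
have cPV : cont_on a b (fun t => invmx (P t)).
  apply: cont_on_mx; apply: cont_on_invmx => // t at_ tb.
  by apply: P_unit; rewrite /D /= at_.
have cH : cont_on a b H.
  apply: cont_on_mx => c j.
  apply: (@cont_on_ext _ _ a b (fun t => jet_coef c.+1 (tail_family 1 t) (B t) ord0 j)).
    by move=> t _ _; rewrite mxE.
  apply: cont_on_coord; apply: cont_on_sum => al _; apply: cont_onZ; first exact: cont_on_cst.
  apply: cont_on_insert_powers0 => // [t|vs]; first exact: tail_family_symmetric.
  case: (ltnP 1 (size vs)) => vs1.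
    apply: (cont_on_ext _ (Phi_cont_on (ltnW vs1))) => t _ _.
    by rewrite /tail_family vs1.
  apply: (cont_on_ext _ (@cont_on_cst R V a b 0)) => t _ _.
  by rewrite /tail_family ltnNge vs1.
pose B' t := (Q t - H t) *m invmx (P t).
exists B'.
  apply: cont_on_mx; apply: cont_on_mulmx => i j; last exact: cont_on_coord.
  apply: cont_on_coord; apply: cont_onD; first exact: abs_continuous_cont_on.
  apply: (@cont_on_ext _ _ a b (fun t => (-1) *: H t)) => [t _ _|]; first exact: scaleN1r.
  by apply: cont_onZ => //; exact: cont_on_cst.
have [C C0 HC] := cont_on_bounded cPV.
apply: (unif_o_dominated (C := n%:R * C) _ (unif_oB EQ oH)); exists 1 => // s t _ Dt.
have k0 : (0 < k)%N by exact: leq_ltn_trans mk.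
have Ev : E s t - taylor_sum (k := k) (tail_family 1 t) (v s t) = v s t *m P t.
  rewrite /E /taylor_sum -sumrB PE //.
  rewrite (bigD1 (Ordinal (n := k.+1) (m := 1) k0)) //= big1 ?addr0.
    by rewrite /tail_family /= scaler0 subr0 invr1 scale1r.
  case=> [[|[|p]] pk] //= _; rewrite /tail_family /= ?scaler0 ?subrr //.
have -> : v s t - jet_poly (B' t) s = (E s t - jet_poly (Q t) s -
    (taylor_sum (k := k) (tail_family 1 t) (v s t) - jet_poly (H t) s)) *m invmx (P t).
  have e : - jet_poly (Q t) s + jet_poly (H t) s = - jet_poly (Q t - H t) s.
    by rewrite jet_polyB opprB addrC.
  rewrite opprD opprK addrACA Ev e.
  by rewrite mulmxBl -jet_poly_mulmx mulmxK //; exact: P_unit.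
apply: le_trans (mulmx_norm_le _ _) _; rewrite mulrAC -mulrA; apply: ler_wpM2l => //.
by rewrite mulrC [leRHS]mulrC; apply: ler_wpM2r => //; have /andP[at_ tb] := Dt; exact: HC.
Qed.

(** The invariant couples an expansion of v with the better one of [E] that it produces, since the
    latter is what the next step solves for v. Order 0 needs only v = O(s), with zero coefficients,
    and each stage integrates anew from the same initial jet. *)
Lemma expansion_exists (ba : 'M[R]_(k, n)) (m : nat) : (m <= k)%N ->
  (forall e : R, 0 < e -> exists2 d : R, 0 < d & forall s, `|s| < d ->
     `|v s a - jet_poly ba s| <= e * `|s| ^+ k) ->
  exists B Q : R -> 'M[R]_(k, n), [/\ cont_on a b B,
    unif_o D m (fun s t => v s t - jet_poly (B t) s) &
    [/\ Q a = adapted_transform (Phi a) ba, abs_continuous a b Q,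
    {ae lebesgue_measure, forall t : R, t \in `[a, b] ->
       is_derive t 1 Q (jet_rhs (B t) t)} &
    unif_o D (minn m.+1 k) (fun s t => E s t - jet_poly (Q t) s)]].
Proof.
move=> mk vba.
have initE e : 0 < e -> exists2 d : R, 0 < d & forall s, `|s| < d ->
    `|E s a - jet_poly (adapted_transform (Phi a) ba) s| <= e * `|s| ^+ k.
  move=> e0; have aD : [set a] `<=` D by move=> t ->; rewrite /D /= lexx.
  have bba : exists2 C : R, 0 <= C & forall t, [set a] t -> `|ba| <= C by exists `|ba|.
  have oba : unif_o [set a] k (fun s t => v s t - jet_poly ba s).
    by move=> e1 e10; have [d dd Hd] := vba e1 e10; exists d => // s t sd ->; exact: Hd.
  have [d dd Hd] := E_jet aD bba oba e0.
  by exists d => // s sd; exact: Hd.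
elim: m mk => [|m IH] mk.
  exists (fun=> 0).
  have c0 : cont_on a b (fun=> 0 : 'M[R]_(k, n)) by exact: cont_on_cst.
  have v0 : unif_o D 0 (fun s t => v s t - jet_poly (0 : 'M[R]_(k, n)) s).
    by apply: unif_o_ext (unif_O_o Ov) => s t _; rewrite jet_poly0 subr0.
  by have [Q [h1 h2 h3 h4]] := E_expansion (leq0n k) c0 v0 initE; exists Q.
have [B [Q [cB vB [_ acQ _ EQ]]]] := IH (ltnW mk).
rewrite (minn_idPl mk) in EQ.
have [B' cB' vB'] := expansion_step mk cB acQ vB EQ.
have [Q' [h1 h2 h3 h4]] := E_expansion mk cB' vB' initE.
by exists B', Q'.
Qed.

Theorem piece_expansion (ba : 'M[R]_(k, n)) :
  (forall e : R, 0 < e -> exists2 d : R, 0 < d & forall s, `|s| < d ->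
     `|x s a - x0 a - jet_poly ba s| <= e * `|s| ^+ k) ->
  exists B : R -> 'M[R]_(k, n), [/\ B a = ba,
    unif_o [set t | a <= t <= b] k (fun s t => x s t - x0 t - jet_poly (B t) s),
    abs_continuous a b (fun t => adapted_transform (Phi t) (B t)) &
    {ae lebesgue_measure, forall t : R, t \in `[a, b] ->
       is_derive t 1 (fun t => adapted_transform (Phi t) (B t)) (jet_rhs (B t) t)}].
Proof.
move=> vba; have [B [Q [cB vB [Qa acQ dQ]]]] := expansion_exists (leqnn k) vba.
(* At the last stage v and [E] are both expanded to order [k], so [Q] can be compared with the
   adapted coordinates of [B]. *)
rewrite (minn_idPr (leqnSn k)) => EQ.
have bB : exists2 C : R, 0 <= C & forall t, D t -> `|B t| <= C.
  by have [C C0 HC] := cont_on_bounded cB; exists C => // t /andP[]; exact: HC.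
have EB := E_jet (fun t (h : D t) => h) bB vB.
have QB t : D t -> Q t = adapted_transform (Phi t) (B t).
  move=> Dt; apply/eqP; rewrite -subr_eq0; apply/eqP; apply: jet_poly_unique => e e0.
  have [d dd Hd] := unif_oB EB EQ e0; exists d => // s sd.
  by have := Hd s t sd Dt; rewrite opprB [X in `|X|]addrC addrA subrK jet_polyB.
exists B; split => //.
- apply/eqP; rewrite -subr_eq0; apply/eqP; apply: jet_poly_unique => e e0.
  have e20 : 0 < e / 2 by rewrite divr_gt0.
  have [d1 d10 H1] := vB _ e20; have [d2 d20 H2] := vba _ e20.
  exists (Num.min d1 d2) => [|s]; first by rewrite lt_min d10.
  rewrite lt_min => /andP[s1 s2].
  have Da : D a by rewrite /D /= lexx.
  have -> : jet_poly (B a - ba) s = (x s a - x0 a - jet_poly ba s) - (v s a - jet_poly (B a) s).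
    by rewrite jet_polyB opprB [RHS]addrC addrA subrK.
  apply: le_trans (ler_normB _ _) _; rewrite [e in leRHS]splitr mulrDl.
  by apply: lerD; [exact: H2|exact: H1].
- by apply: abs_continuous_eq acQ => t at_ tb; apply: QB; rewrite /D /= at_.
(* The two functions agree only on [a, b], so the derivative is transferred at interior points. *)
apply: filterS2 (ae_interior a b) dQ => t tI dt tab; have {tI}/andP[at_ tb] := tI tab.
apply: (@is_derive_near_eq _ _ Q _ _ (Num.min (t - a) (b - t))) (dt tab).
  by rewrite lt_min !subr_gt0 at_.
move=> z zt; apply: QB; exact: (norm_lt_min_itv zt).
Qed.
End Piece.

(** * Integrability of the controls *)

Lemma smooth_continuous (R : realType) (V W : normedModType R) (U : set V) (f : V -> W) :
  smooth_on U f -> forall x, U x -> {for x, continuous f}.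
Proof. by move=> sf x Ux; apply: differentiable_continuous; exact: (sf [::] x Ux). Qed.

Lemma within_itv_nbhs (R : realType) (M : topologicalType) (a b : R) (y : R -> M) :
  {within `[a, b], continuous y} -> forall t, a <= t -> t <= b -> forall N, nbhs (y t) N ->
  exists2 d : R, 0 < d & forall z, a <= z -> z <= b -> `|z - t| < d -> N (y z).
Proof.
move=> /subspace_continuousP cy t at_ tb N yN.
have tab : `[a, b]%classic t by rewrite /= in_itv /= at_.
have : \forall z \near t, z \in `[a, b] -> N (y z) by exact: (cy t tab N yN).
move=> /near_approx[d d0 H]; exists d => // z az zb zt.
by apply: H => //; rewrite in_itv /= az.
Qed.

Section Controls.
Context {R : realType} {n l : nat} {M : topologicalType}.
Context {A : smooth_atlas R n M} {X : 'I_l -> vector_field A} {T : R}.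

Lemma chart_within_itv (a b : R) (y : R -> M) (c : chart A) :
  {within `[a, b], continuous y} -> forall t, a <= t -> t <= b -> chart_dom c (y t) ->
  exists2 d : R, 0 < d & forall z, a <= z -> z <= b -> `|z - t| < d -> chart_dom c (y z).
Proof.
move=> cy t at_ tb yt; apply: (within_itv_nbhs cy) => //.
by apply: open_nbhs_nbhs; split => //; exact: chart_dom_open.
Qed.

(* No integrability of the controls is assumed. Since the X_i are independent,
   v is locally a continuous matrix applied to the derivative of the absolutely
   continuous curve q, which is integrable. *)
Lemma control_integrable (v : R -> 'rV[R]_l) (q : R -> M) : 0 <= T ->
  pointwise_independent X -> trajectory X T v q ->
  forall i, ae_integrable (fun t => v t ord0 i) 0 T.
Proof.
move=> T0 indX [cq Hq] i; apply: ae_integrable_local => // t t0 tT.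
have [c ct] := atlas_cover A (q t).
have [d d0 dq] := chart_within_itv cq t0 tT ct.
pose x1 := Num.max 0 (t - d / 2); pose y1 := Num.min T (t + d / 2).
have [x10 x1d y1T y1d] : [/\ 0 <= x1, t - d / 2 <= x1, y1 <= T & y1 <= t + d / 2].
  by rewrite /x1 /y1 !le_max !ge_min !lexx ?orbT.
have [x1t y1t] : x1 <= t /\ t <= y1.
  by rewrite /x1 /y1 ge_max le_min t0 tT /= gerBl lerDl divr_ge0 // ltW.
have dom z : x1 <= z -> z <= y1 -> chart_dom c (q z).
  move=> xz zy; apply: dq; first exact: le_trans xz.
    exact: le_trans zy _.
  rewrite ltr_norml; move: d0 (le_trans x1d xz) (le_trans zy y1d); clear=> d0 h1 h2.
  by apply/andP; split; lra.
pose f := chart_map c \o q.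
have [|acf df] := Hq c x1 y1 x10 y1T.
  by move=> z; rewrite in_itv /= => /andP[xz zy]; exact: dom.
have cf := abs_continuous_cont_on acf.
pose N z : 'M[R]_(l, n) := \matrix_(i < l) X i c (f z).
have cN a' b' : cont_on x1 y1 (fun z => N z a' b').
  apply: (@cont_on_ext _ _ x1 y1 (fun z => X a' c (f z) ord0 b')).
    by move=> z _ _; rewrite mxE.
  apply: cont_on_coord; apply: (cont_on_comp (g := X a' c) cf) => z xz zy.
  by apply: (smooth_continuous (@vf_smooth _ _ _ _ (X a') c)); exists (q z) => //; exact: dom.
have [P0 NP0] : exists P0, N t *m P0 = 1%:M by apply/row_freeP; exact: indX.
(* [P0] is a right inverse of [N] at the single time [t]. Since [G t] is the identity, [G] stays
   invertible nearby, and multiplying [P0] by its inverse gives a right inverse of [N z] that is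
   continuous in z. *)
pose G z := N z *m P0.
have cG a' b' : cont_on x1 y1 (fun z => G z a' b').
  by apply: cont_on_mulmx => // i' j'; exact: cont_on_cst.
have cdet := cont_on_det cG.
have [d2 d20 Hd2] := cdet t x1t y1t 1 ltr01.
pose m := Num.min (d / 2) d2.
have [m1 m2] : m <= d / 2 /\ m <= d2 by rewrite /m !ge_min !lexx ?orbT.
exists m; first by rewrite lt_min divr_gt0.
move=> x y x0 xt ty yT tx yt.
have [x1x yy1] : x1 <= x /\ y <= y1.
  rewrite /x1 /y1 ge_max le_min x0 yT /=; move: m1 tx yt; clear => m1 tx yt.
  by split; lra.
have G_unit z : x <= z -> z <= y -> G z \in unitmx.
  move=> xz zy; have zd : `|z - t| < d2.
    move: m2 (le_lt_trans zy yt) (lt_le_trans tx xz); rewrite ltr_norml; clear => m2 h1 h2.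
    by apply/andP; split; lra.
  have := Hd2 z (le_trans x1x xz) (le_trans zy yy1) zd.
  rewrite {2}/G NP0 det1 unitmxE unitfE; apply: contraTneq => ->.
  by rewrite sub0r normrN normr1 ltxx.
have acf' := abs_continuousS x1x yy1 acf.
have xy := le_trans xt ty.
have iv j : ae_integrable (fun z => (v z *m N z) ord0 j) x y.
  apply: (ae_integrable_derivative xy (abs_continuous_coord ord0 j acf')).
  apply: filterS df => z hz; rewrite in_itv /= => /andP[xz zy].
  have : z \in `[x1, y1] by rewrite in_itv /= (le_trans x1x xz) (le_trans zy yy1).
  move=> /hz/is_derive_mxP/(_ ord0 j); rewrite /f /=.
  rewrite (_ : \sum_(i < l) _ = v z *m N z) // mulmx_sum_row.
  by apply: eq_bigr => i' _; rewrite rowK.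
pose h z : 'M[R]_(n, l) := P0 *m invmx (G z).
have ch a' b' : cont_on x y (fun z => h z a' b').
  apply: cont_on_mulmx => [i' j'|]; first exact: cont_on_cst.
  by apply: cont_on_invmx => // i' j'; exact: (cont_onS x1x yy1 (cG i' j')).
have ih := @ae_integrable_sum R _ (index_enum 'I_n) xpredT
  (fun j z => h z j i * (v z *m N z) ord0 j) x y.
apply: ae_integrable_eq (ih _).
  apply: aeW => z; rewrite in_itv /= => /andP[xz zy].
  have -> : v z = v z *m N z *m h z by rewrite /h mulmxA -[v z *m N z *m P0]mulmxA mulmxK ?G_unit.
  rewrite [RHS]mxE; apply: eq_bigr => j _; rewrite mulrC.
  by rewrite /h !mulmxA -[v z *m N z *m P0]mulmxA mulmxK ?G_unit.
by move=> j _; apply: ae_integrable_mul => //; apply/cont_onP.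
Qed.

End Controls.

Lemma control_weight (R : realType) (a b : R) (I : finType) (f : I -> R -> R) :
  (forall i, ae_integrable (f i) a b) ->
  exists W w : R -> R, [/\ abs_continuous a b W,
    {ae lebesgue_measure, forall t : R, t \in `[a, b] -> is_derive t 1 W (w t)} &
    forall t, 0 <= w t /\ forall i, `|f i t| <= w t].
Proof.
move=> If; pose w t := \sum_i `|f i t|.
have [W [acW _ dW]] : exists K, [/\ abs_continuous a b K, K a = 0 &
    {ae lebesgue_measure, forall t : R, t \in `[a, b] -> is_derive t 1 K (w t)}].
  by apply: ae_integrable_primitive; apply: ae_integrable_sum => i _; exact: ae_integrable_norm.
exists W, w; split => // t; split; first exact: sumr_ge0.
by move=> i; rewrite /w (bigD1 i) //= lerDl sumr_ge0.
Qed.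

(** * Deviation of the perturbed trajectories *)

Lemma closed_ball_rV_compact (R : realType) n (x : 'rV[R]_n) (r : R) :
  compact [set z : 'rV[R]_n | `|z - x| <= r].
Proof.
apply: bounded_closed_compact.
  exists (r + `|x|); split; first exact: num_real.
  move=> e re z /= zx; apply: le_trans (ltW re).
  by rewrite -[z](subrK x); apply: le_trans (ler_normD _ _) _; rewrite lerD2r.
move=> z cz /=; apply/ler_addgt0Pr => e e0.
have [|y [/= yx yz]] := cz [set y | `|y - z| < e].
  by apply: (near_approx z (fun y => `|y - z| < e)).2; exists e.
rewrite -[z](subrK y) -addrA addrC; apply: le_trans (ler_normD _ _) _.
by apply: lerD => //; rewrite distrC ltW.
Qed.

Definition in_tube (R : realType) n (M : topologicalType) (A : smooth_atlas R n M) (c : chart A)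
    (x0 : R -> 'rV[R]_n) (y : R -> M) (g : R -> R) t := chart_dom c (y t) /\ `|chart_map c (y t) - x0 t| <= g t.

Lemma chart_curve_continuous (R : realType) n (M : topologicalType) (A : smooth_atlas R n M) (c : chart A)
    (a b : R) (y : R -> M) t : {within `[a, b], continuous y} -> a <= t -> t <= b ->
  chart_dom c (y t) -> forall e : R, 0 < e -> exists2 d : R, 0 < d &
    forall z, a <= z -> z <= b -> `|z - t| < d -> `|chart_map c (y z) - chart_map c (y t)| < e.
Proof.
move=> cy at_ tb yt e e0; apply: (within_itv_nbhs cy at_ tb (N := [set p | `|chart_map c p - chart_map c (y t)| < e])).
have := chart_map_continuous yt; move=> /cvgrPdist_lt /(_ e e0).
by apply: filterS => z; rewrite distrC.
Qed.

(* The curve y cannot leave the chart domain at t: just before t it lies in the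
   image of a closed ball, which is compact, hence closed in M. *)
Lemma tube_closed (R : realType) n (M : topologicalType) (A : smooth_atlas R n M) (c : chart A)
    (a b r : R) (x0 : R -> 'rV[R]_n) (y : R -> M) (g : R -> R) t : hausdorff_space M -> {within `[a, b], continuous y} ->
  cont_on a b x0 -> cont_on a b g ->
  (forall z, `|z - x0 t| < r -> (chart_map c @` chart_dom c) z) -> g t < r ->
  a < t -> t <= b -> (forall z, a <= z -> z < t -> in_tube c x0 y g z) -> in_tube c x0 y g t.
Proof.
move=> hM cy cx cg tubeU gr at_ tb Hz.
have at' := ltW at_.
have approach (d : R) : 0 < d -> exists z, [/\ a <= z, z < t & `|z - t| < d].
  move=> d0; pose m := Num.min d (t - a).
  have [m0 md ma] : [/\ 0 < m, m <= d & m <= t - a].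
    by rewrite /m lt_min d0 subr_gt0 at_ !ge_min !lexx orbT.
  exists (t - m / 2); move: m0 md ma; clear => m0 md ma; split; [lra|lra|].
  by rewrite ltr_norml; apply/andP; split; lra.
have near_t (e : R) : 0 < e -> exists2 d : R, 0 < d & forall z, a <= z -> z < t -> `|z - t| < d ->
    `|chart_map c (y z) - x0 t| <= g t + e.
  move=> e0; have e20 : 0 < e / 2 by rewrite divr_gt0.
  have [d1 d10 H1] := cx t at' tb _ e20; have [d2 d20 H2] := cg t at' tb _ e20.
  exists (Num.min d1 d2) => [|z az zt]; first by rewrite lt_min d10.
  rewrite lt_min => /andP[z1 z2]; have [_ hz] := Hz z az zt.
  have zb := le_trans (ltW zt) tb.
  have := H1 z az zb z1; have := H2 z az zb z2; rewrite ltr_norml => /andP[_ h2] h1.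
  rewrite -(subrK (x0 z) (chart_map c (y z))) -addrA.
  apply: le_trans (ler_normD _ _) _; move: hz h1 h2; set p := `|_|; set q := `|_|.
  by clear => hz h1 h2; lra.
pose rho := (g t + r) / 2; have [grho rhor] : g t < rho /\ rho < r.
  by rewrite /rho; move: gr; clear => gr; split; lra.
pose S := chart_inv c @` [set z | `|z - x0 t| <= rho].
have cS : closed S.
  suff cinv : {within [set z | `|z - x0 t| <= rho], continuous (chart_inv c)}.
    exact: (compact_closed hM (continuous_compact cinv (@closed_ball_rV_compact _ _ _ _))).
  apply/subspace_continuousP => z zK; apply: cvg_within_filter.
  by apply: chart_inv_continuous; apply: tubeU; exact: le_lt_trans zK rhor.
have St : S (y t).
  apply: cS => N yN; have [d d0 Hd] := within_itv_nbhs cy at' tb yN.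
  have e0 : 0 < rho - g t by rewrite subr_gt0.
  have [d' d'0 Hd'] := near_t _ e0.
  have [|z [az zt zd]] := approach (Num.min d d'); first by rewrite lt_min d0.
  move: zd; rewrite lt_min => /andP[zd zd'].
  exists (y z); split; last by apply: Hd => //; exact: le_trans (ltW zt) tb.
  have [yz _] := Hz z az zt.
  exists (chart_map c (y z)); last exact: chart_mapK.
  by have := Hd' z az zt zd'; rewrite [g t + _]addrC subrK.
have yt : chart_dom c (y t).
  have [z zK <-] := St; have [p pc <-] := tubeU z (le_lt_trans zK rhor).
  by rewrite chart_mapK.
split => //; apply/ler_addgt0Pr => e e0; have e20 : 0 < e / 2 by rewrite divr_gt0.
have [d d0 Hd] := near_t _ e20.
have [d' d'0 Hd'] := chart_curve_continuous cy at' tb yt e20.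
have [|z [az zt zd]] := approach (Num.min d d'); first by rewrite lt_min d0.
move: zd; rewrite lt_min => /andP[zd zd'].
have := Hd z az zt zd; have := Hd' z az (le_trans (ltW zt) tb) zd'; rewrite distrC => h1 h2.
rewrite -(subrK (chart_map c (y z)) (chart_map c (y t))) -addrA.
apply: le_trans (ler_normD _ _) _; move: h1 h2; set p := `|_|; set q := `|_|.
by clear => h1 h2; lra.
Qed.

(** Continuity argument: while the curve lies in the tube, [Hstep] keeps it [eps] away from the
    boundary, so it cannot leave at once, and by [tube_closed] it cannot leave in the limit. *)
Lemma tube_trapping (R : realType) n (M : topologicalType) (A : smooth_atlas R n M) (c : chart A)
    (a b r eps : R) (x0 : R -> 'rV[R]_n) (y : R -> M) (g : R -> R) : a <= b -> hausdorff_space M -> {within `[a, b], continuous y} ->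
  cont_on a b x0 -> cont_on a b g ->
  (forall t z, a <= t -> t <= b -> `|z - x0 t| < r -> (chart_map c @` chart_dom c) z) ->
  (forall t, a <= t -> t <= b -> g t < r) -> 0 < eps ->
  (forall t, a <= t -> t <= b -> (forall z, a <= z -> z <= t -> in_tube c x0 y g z) ->
     `|chart_map c (y t) - x0 t| <= g t - eps) ->
  in_tube c x0 y g a -> forall t, a <= t -> t <= b -> in_tube c x0 y g t.
Proof.
move=> ab hM cy cx cg tubeU gr eps0 Hstep Ha.
pose good t := forall z, a <= z -> z <= t -> in_tube c x0 y g z.
suff : good a -> good b.
  have ga : good a by move=> z az za; rewrite (_ : z = a) //; apply/eqP; rewrite eq_le za.
  by move=> /(_ ga) gb t at_ tb; exact: gb.
apply: (@interval_induction R (fun x x' => good x -> good x')) => //.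
  by move=> x1 x2 x3 _ _ _ _ h12 h23 g1; apply: (h23 (h12 _)).
move=> t at_ tb.
(* If no time shortly before or at [t] is good, the implication holds vacuously near [t]; otherwise
   good times come arbitrarily close and the tube condition holds at all times before [t]. *)
have [[d d0 Hd]|noapproach] := pselect (exists2 d : R, 0 < d &
    forall x, a <= x -> x <= t -> t - d < x -> ~ good x).
  by exists d => // x x' ax xt _ _ tx _ gx; case: (Hd x ax xt tx).
have before z : a <= z -> z < t -> in_tube c x0 y g z.
  move=> az zt; apply: contrapT => nz; apply: noapproach.
  exists (t - z) => [|x ax xt]; first by rewrite subr_gt0.
  by rewrite subKr => zx gx; apply: nz; apply: gx => //; exact: ltW.
have tt : in_tube c x0 y g t.
  have [ta|ta] := eqVneq a t; first by rewrite -ta.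
  apply: tube_closed => //; [by move=> z; exact: tubeU|exact: gr|].
  by rewrite lt_neqAle ta.
have gt : good t.
  move=> z az; rewrite le_eqVlt => /orP[/eqP ->//|zt]; exact: before.
have hs := Hstep t at_ tb gt.
have e30 : 0 < eps / 3 by rewrite divr_gt0.
have [d1 d10 H1] := cx t at_ tb _ e30; have [d2 d20 H2] := cg t at_ tb _ e30.
have [d3 d30 H3] := chart_curve_continuous cy at_ tb tt.1 e30.
have [d4 d40 H4] := chart_within_itv cy at_ tb tt.1.
exists (Num.min (Num.min d1 d2) (Num.min d3 d4)); first by rewrite !lt_min d10 d20 d30 d40.
move=> x x' ax xt tx' x'b _ x'd _ z az zx'.
have [zt|tz] := leP z t; first exact: gt.
have zb := le_trans zx' x'b.
have : `|z - t| < Num.min (Num.min d1 d2) (Num.min d3 d4).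
  by rewrite ger0_norm ?subr_ge0 ?ltW // ltrBlDl; exact: le_lt_trans zx' x'd.
rewrite !lt_min => /andP[/andP[z1 z2] /andP[z3 z4]].
split; first exact: H4.
have h1 := H1 z az zb z1; have h3 := H3 z az zb z3.
have h2 : g t - g z < eps / 3.
  by apply: le_lt_trans (ler_norm _) _; rewrite distrC; exact: H2.
rewrite distrC in h1.
have -> : chart_map c (y z) - x0 z = (chart_map c (y z) - chart_map c (y t)) +
    (chart_map c (y t) - x0 t) + (x0 t - x0 z) by rewrite !subrKA.
apply: le_trans (ler_normD _ _) _.
apply: le_trans (lerD (ler_normD _ _) (lexx _)) _.
move: hs h1 h2 h3; set p := `|_|; set q := `|_|; set p' := `|_|.
by clear => hs h1 h2 h3; lra.
Qed.

(** On the bounded range of [f] the exponential is Lipschitz, by the tangent inequality 1 + z <= exp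
    z. *)
Lemma abs_continuous_expR (R : realType) (a b : R) (f : R -> R) :
  abs_continuous a b f -> abs_continuous a b (fun t => expR (f t)).
Proof.
move=> acf; have [B B0 HB] := abs_continuous_bounded acf.
have lip x y : x <= y -> y <= B -> `|expR y - expR x| <= expR B * `|y - x|.
  move=> xy yB; rewrite !ger0_norm ?subr_ge0 ?ler_expR //.
  apply: (@le_trans _ _ (expR y * (y - x))); last first.
    by apply: ler_wpM2r; rewrite ?subr_ge0 ?ler_expR.
  have exy : expR y * expR (x - y) = expR x by rewrite -expRD addrCA subrr addr0.
  have := expR_ge1Dx (x - y); rewrite -(ler_pM2l (expR_gt0 y)) exy mulrDr mulr1 => h.
  by rewrite lerBlDr -lerBlDl; apply: le_trans h; rewrite -[y - x]opprB mulrN opprK.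
apply: (abs_continuous_lipschitz (C := expR B) acf) => x y ax xy yb.
have [_ h1] : - B <= f x /\ f x <= B.
  by apply/andP; rewrite -ler_norml; apply: HB => //; exact: le_trans yb.
have [_ h2] : - B <= f y /\ f y <= B.
  by apply/andP; rewrite -ler_norml; apply: HB => //; exact: le_trans xy.
by have [fxy|/ltW fxy] := leP (f x) (f y); [|rewrite distrC [`|f y - _|]distrC]; exact: lip.
Qed.

(** Gronwall's inequality for curves not yet known to stay in the chart. An exponential barrier in
    [W] plays the role of the tube radius: the differential inequality is available only inside the
    tube, and it shows that the tube is not left. *)
Lemma deviation_bound (R : realType) (n l k : nat) (M : topologicalType)
    (A : smooth_atlas R n M) (X : 'I_l -> vector_field A) (c : chart A) (a b : R)
    (u : R -> 'rV[R]_l) (Du : 'I_k -> R -> 'rV[R]_l) (x0 : R -> 'rV[R]_n)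
    (y : R -> R -> M) (W w : R -> R) :
  hausdorff_space M -> a <= b -> abs_continuous a b x0 ->
  (forall t, a <= t -> t <= b -> (chart_map c @` chart_dom c) (x0 t)) ->
  {ae lebesgue_measure, forall t : R, t \in `[a, b] ->
     is_derive t 1 x0 (\sum_(i < l) u t ord0 i *: X i c (x0 t))} ->
  abs_continuous a b W ->
  {ae lebesgue_measure, forall t : R, t \in `[a, b] ->
    [/\ is_derive t 1 W (w t), 0 <= w t, forall i, `|u t ord0 i| <= w t &
        forall r i, `|Du r t ord0 i| <= w t]} ->
  (forall s, {within `[a, b], continuous (y s)}) ->
  (forall s t1, t1 <= b -> (forall t, t \in `[a, t1] -> chart_dom c (y s t)) ->
     caratheodory_solution a t1
       (fun t x => \sum_(i < l) (u t + jet_variation Du s t) ord0 i *: X i c x)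
       (chart_map c \o y s)) ->
  (exists2 C : R, 0 <= C & exists2 d : R, 0 < d & forall s, `|s| < d ->
     chart_dom c (y s a) /\ `|chart_map c (y s a) - x0 a| <= C * `|s|) ->
  exists2 d : R, 0 < d & exists2 C : R, 0 <= C & forall s t, `|s| < d -> a <= t -> t <= b ->
    chart_dom c (y s t) /\ `|chart_map c (y s t) - x0 t| <= C * `|s|.
Proof.
move=> hM ab ac0 Ux0 d0 acW dW cy ys [Ca Ca0 [da da0 Ha]].
set U := _ @` _ in Ux0; have oU : open U by exact: chart_map_open.
have cx0 := abs_continuous_cont_on ac0.
(* The index [None] carries the inclusion in [U] alone, so the radius exists even when there are no
   vector fields. *)
have [r r0 [C C0 HC]] : exists2 r : R, 0 < r & exists2 C : R, 0 <= C &
    forall i : option 'I_l, forall t v, a <= t -> t <= b -> `|v| < r -> U (x0 t + v) /\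
      if i is Some i then `|X i c (x0 t + v) - X i c (x0 t)| <= C * `|v| /\
        `|X i c (x0 t + v)| <= C else True.
  apply: (finite_constants (Q := fun (i : option 'I_l) r C => forall t v, a <= t -> t <= b ->
    `|v| < r -> U (x0 t + v) /\
      if i is Some i then `|X i c (x0 t + v) - X i c (x0 t)| <= C * `|v| /\
        `|X i c (x0 t + v)| <= C else True)).
    move=> i r r' C C' r'0 rr CC H t v at_ tb vr.
    have [h1 h2] := H t v at_ tb (lt_le_trans vr rr); split => //; case: i h2 {H} => // i [h2 h3].
    by split; [apply: le_trans h2 _; apply: ler_wpM2r|exact: le_trans CC].
  case=> [i|].
    have [r1 r10 [C1 C10 H1]] := taylor_tube 1 oU (@vf_smooth _ _ _ _ (X i) c) cx0 Ux0.
    have [r2 r20 [C2 C20 H2]] := tube_bounded 0 oU (@vf_smooth _ _ _ _ (X i) c) cx0 Ux0.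
    exists (Num.min r1 r2); first by rewrite lt_min r10.
    exists (C1 + C2); first exact: addr_ge0.
    move=> t v at_ tb; rewrite lt_min => /andP[v1 v2].
    have [h1 h2] := H1 t v at_ tb v1.
    have [|_ h3] := H2 t (x0 t + v) at_ tb; first by rewrite addrAC subrr add0r.
    split => //; split.
      move: h2; rewrite big_ord1 /= invr1 scale1r expr1 => h2.
      by apply: le_trans h2 _; apply: ler_wpM2r => //; rewrite lerDl.
    by have := h3 [::] erefl; rewrite big_nil mulr1 => h; apply: le_trans h _; rewrite lerDr.
  (* Only the radius is wanted, so any smooth map on [U] will do; the transition from the chart to
     itself is at hand. *)
  have sf := @transition_smooth _ _ _ A c c; rewrite setIid in sf.
  have [r1 r10 [C1 C10 H1]] := tube_bounded 0 oU sf cx0 Ux0.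
  exists r1 => //; exists 0 => // t v at_ tb vr; split => //.
  by have [|h _] := H1 t (x0 t + v) at_ tb; first by rewrite addrAC subrr add0r.
have Wmono x y' : a <= x -> x <= y' -> y' <= b -> W x <= W y'.
  apply: (@abs_continuous_nondecreasing R a b W w acW).
  by apply: filterS dW => t h tab; have [h1 h2 _ _] := h tab.
(* [l] fields, each with Lipschitz constant and bound [C]; the 1 comes from u and the [k] from the
   variations, all measured by [w]. *)
pose L := l%:R * C * (1 + k%:R).
have L0 : 0 <= L by rewrite !mulr_ge0 // addr_ge0.
pose g t := expR (L * (W t - W a)).
have acg : abs_continuous a b g.
  apply: abs_continuous_expR; apply: (abs_continuousZ L).
  by apply: abs_continuousB => //; exact: abs_continuous_cst.
have ga : g a = 1 by rewrite /g subrr mulr0 expR0.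
have gE t : a <= t -> t <= b -> g t <= g b.
  by move=> at_ tb; rewrite ler_expR; apply: ler_wpM2l => //; rewrite lerD2r; exact: Wmono.
have gb0 : 0 < g b by exact: expR_gt0.
have dg (t : R) : is_derive t 1 W (w t) -> is_derive t 1 g (L * w t * g t).
  move=> dWt; have h := is_deriveZ L (is_deriveB dWt (is_derive_cst (W a) t 1)).
  rewrite subr0 in h; have := @is_derive1_comp R expR (fun z => L * (W z - W a)) t _ _ (is_derive_expR _) h.
  by move=> h'; apply: (is_derive_eq h'); rewrite mulrC.
pose K := (Ca + 1) * g b.
have K0 : 0 <= K by rewrite mulr_ge0 ?addr_ge0 // ltW.
exists (Num.min (Num.min da 1) (r / (K + 1))).
  by rewrite !lt_min da0 ltr01 divr_gt0 // ltr_wpDl.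
exists K => // s t; rewrite !lt_min => /andP[/andP[sda s1] sr] at_ tb.
have Ksr : K * `|s| < r.
  apply: le_lt_trans (_ : (K + 1) * `|s| < r); first by rewrite ler_wpM2r // lerDl.
  by rewrite mulrC -ltr_pdivlMr // ltr_wpDl.
have [ya va] := Ha s sda.
have claim eta : (Ca + 1) * `|s| < eta -> eta * g b < r ->
    chart_dom c (y s t) /\ `|chart_map c (y s t) - x0 t| <= eta * g t - `|s|.
  move=> eta1 eta2.
  have eta0 : 0 <= eta by apply: le_trans (ltW eta1); rewrite mulr_ge0 // addr_ge0.
  (* Subtracting |s| closes the estimate: if |v| <= G, the velocity bound L w (|v| + |s|) is at most
     the derivative of [eta * g]. *)
  pose G z := eta * g z - `|s|.
  have Gr z : a <= z -> z <= b -> G z < r.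
    move=> az zb; apply: le_lt_trans eta2; rewrite lerBlDr.
    by apply: le_trans (ler_wpM2l eta0 (gE z az zb)) _; rewrite lerDl.
  apply: (@tube_trapping R n M A c a b r (eta - (Ca + 1) * `|s|) x0 (y s) G) => //.
  - apply: abs_continuous_cont_on; apply: abs_continuousB; last exact: abs_continuous_cst.
    exact: (abs_continuousZ eta acg).
  - move=> z z' az zb zz'; have [h _] := HC None z (z' - x0 z) az zb zz'.
    by move: h; rewrite addrC subrK.
  - by rewrite subr_gt0.
  - move=> t1 at1 t1b good.
    have [acy dy] : caratheodory_solution a t1
       (fun t x => \sum_(i < l) (u t + jet_variation Du s t) ord0 i *: X i c x)
       (chart_map c \o y s).
      apply: ys => // z; rewrite in_itv /= => /andP[az zt1].
      by have [] := good z az zt1.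
    pose v z := chart_map c (y s z) - x0 z.
    have h : `|v t1 - v a| <= eta * g t1 - eta * g a.
      apply: (@abs_continuous_comparison _ _ a t1 v (fun z => eta * g z)
        (fun z => eta * (L * w z * g z))) => //.
      - apply: abs_continuousB => //; exact: (abs_continuousS (lexx a) t1b ac0).
      - exact: (abs_continuousS (lexx a) t1b (abs_continuousZ eta acg)).
      apply: filterS3 dy d0 dW => z h1 h2 h3 zat.
      have zab : z \in `[a, b].
        by move: zat; rewrite !in_itv /= => /andP[-> zt]; exact: le_trans zt t1b.
      have {}h1 := h1 zat; have {}h2 := h2 zab; have [dWz w0 uw Dw] := h3 zab.
      have /andP[az zb] : a <= z <= b by move: zab; rewrite in_itv.
      have zt1 : z <= t1 by move: zat; rewrite in_itv /= => /andP[].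
      have [yz vz] := good z az zt1.
      have vr : `|v z| < r by apply: le_lt_trans vz _; exact: Gr.
      have HX i : `|X i c (x0 z + v z) - X i c (x0 z)| <= C * `|v z| /\
          `|X i c (x0 z + v z)| <= C by have [] := HC (Some i) z (v z) az zb vr.
      have xE : x0 z + v z = chart_map c (y s z) by rewrite /v addrC subrK.
      rewrite xE in HX.
      exists (\sum_(i < l) (u z + jet_variation Du s z) ord0 i *: X i c (chart_map c (y s z)) -
        \sum_(i < l) u z ord0 i *: X i c (x0 z)); split.
      - exact: is_deriveB.
      - exact: (is_deriveZ eta (dg z dWz)).
      have -> : \sum_(i < l) (u z + jet_variation Du s z) ord0 i *: X i c (chart_map c (y s z)) -
        \sum_(i < l) u z ord0 i *: X i c (x0 z) =
        \sum_(i < l) (u z ord0 i *: (X i c (chart_map c (y s z)) - X i c (x0 z)) +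
          jet_variation Du s z ord0 i *: X i c (chart_map c (y s z))).
        rewrite -sumrB; apply: eq_bigr => i _.
        by rewrite mxE scalerDl scalerBr addrAC.
      apply: le_trans (ler_norm_sum _ _ _) _.
      apply: (@le_trans _ _ (\sum_(i < l) (w z * (C * `|v z|) + k%:R * `|s| * w z * C))).
        apply: ler_sum => i _; have [X1 X2] := HX i.
        apply: le_trans (ler_normD _ _) _; rewrite !normrZ; apply: lerD; apply: ler_pM => //.
        by apply: jet_variation_le => //; exact: ltW.
      rewrite sumr_const card_ord -[leLHS]mulr_natl.
      apply: (@le_trans _ _ (L * w z * (`|v z| + `|s|))).
        rewrite (_ : L * w z * (`|v z| + `|s|) = l%:R * (w z * (C * `|v z|) + k%:R * `|s| * w z * C) +
          l%:R * C * w z * (`|s| + k%:R * `|v z|)); last by rewrite /L; ring.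
        by rewrite lerDl !mulr_ge0 // addr_ge0 // mulr_ge0.
      rewrite [leRHS]mulrCA; apply: ler_wpM2l; first by rewrite mulr_ge0.
      by rewrite -lerBrDr.
    rewrite ga mulr1 in h.
    rewrite -/(v t1) -(subrK (v a) (v t1)) /G; apply: le_trans (ler_normD _ _) _.
    apply: le_trans (lerD h va) _.
    by rewrite mulrDl mul1r; lra.
  - split => //; rewrite /G ga mulr1; apply: le_trans va _; rewrite lerBrDr -[X in _ + X]mul1r -mulrDl.
    exact: ltW.
(* The strict inequality for [eta] provides the margin needed for trapping; letting [eta] decrease
   to [(Ca + 1) * |s|] recovers the bound [K * |s|]. *)
have pick (e : R) : 0 < e -> exists eta, [/\ (Ca + 1) * `|s| < eta, eta * g b < r & eta * g b <= K * `|s| + e].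
  move=> e0; pose m := Num.min e (r - K * `|s|).
  have [m0 me mr] : [/\ 0 < m, m <= e & m <= r - K * `|s|].
    by rewrite /m lt_min e0 subr_gt0 Ksr !ge_min !lexx orbT.
  exists ((Ca + 1) * `|s| + m / 2 / g b).
  have E : ((Ca + 1) * `|s| + m / 2 / g b) * g b = K * `|s| + m / 2.
    by rewrite mulrDl divfK ?gt_eqF // /K mulrAC.
  rewrite E; split; first by rewrite ltrDl !divr_gt0.
    by clear -m0 mr; lra.
  by clear -m0 me; lra.
have [eta [e1 e2 e3]] := pick 1 ltr01; split; first exact: (claim eta e1 e2).1.
apply/ler_addgt0Pr => e e0; have [eta' [h1 h2 h3]] := pick e e0.
apply: le_trans (claim eta' h1 h2).2 _; apply: le_trans h3.
rewrite lerBlDr; apply: (@le_trans _ _ (eta' * g b)); last by rewrite lerDl.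
apply: ler_wpM2l; last exact: gE.
by apply: le_trans (ltW h1); rewrite mulr_ge0 // addr_ge0.
Qed.

(** Backward uniqueness for a linear differential inequality: on an interval where [L] times the
    growth of [W] is at most 1/2, a zero at the right end forces the maximum of |f| to be at most
    half of itself. *)
Lemma linear_gronwall (R : realType) (V : normedModType R) (a b L : R) (f : R -> V) (W w : R -> R) :
  a <= b -> 0 <= L -> abs_continuous a b f -> abs_continuous a b W ->
  {ae lebesgue_measure, forall t : R, t \in `[a, b] -> exists f',
    [/\ is_derive t 1 f f', is_derive t 1 W (w t), 0 <= w t & `|f'| <= L * w t * `|f t|]} ->
  f b = 0 -> f a = 0.
Proof.
move=> ab L0 acf acW Hd.
have Wmono x y : a <= x -> x <= y -> y <= b -> W x <= W y.
  apply: (@abs_continuous_nondecreasing R a b W w acW).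
  by apply: filterS Hd => t h tab; have [f' [_ h1 h2 _]] := h tab.
apply: (@interval_induction R (fun x y => f y = 0 -> f x = 0)) => //.
  by move=> x y z _ _ _ _ h1 h2 fz; apply: (h1 (h2 _)).
(* [W] varies by at most [e] on either side of [t], and (L + 1)(e + e) = 1/2. *)
move=> t at_ tb; pose e : R := (4 * (L + 1))^-1.
have e0 : 0 < e by rewrite invr_gt0 mulr_gt0 // ltr_wpDl.
have [d d0 H] := abs_continuous_cont_on acW at_ tb e0.
exists d => // x y ax xt ty yb tx yt fy.
have xy := le_trans xt ty.
have WLe : L * (W y - W x) <= 1 / 2.
  have hx := H x ax (le_trans xt tb); have hy := H y (le_trans at_ ty) yb.
  have /ltW hx' : W t - W x < e.
    apply: le_lt_trans (ler_norm _) _; rewrite distrC; apply: hx.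
    by rewrite ler0_norm ?subr_le0 // opprB ltrBlDl -ltrBlDr.
  have /ltW hy' : W y - W t < e.
    apply: le_lt_trans (ler_norm _) _; apply: hy.
    by rewrite ger0_norm ?subr_ge0 // ltrBlDl.
  apply: (@le_trans _ _ ((L + 1) * (e + e))).
    apply: ler_pM => //; first by rewrite subr_ge0; exact: Wmono.
      by rewrite lerDl.
    by rewrite -(subrK (W t) (W y)) -addrA; apply: lerD.
  by rewrite /e; have L1 : L + 1 != 0; [rewrite gt_eqF // ltr_wpDl|rewrite le_eqVlt; apply/orP; left; apply/eqP; field].
have acf' := abs_continuousS ax yb acf.
have cnf : {within `[x, y], continuous (fun z => `|f z|)}.
  apply/cont_onP; apply: abs_continuous_cont_on; apply: (abs_continuous_lipschitz (C := 1) acf').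
  by move=> z z' _ _ _; rewrite mul1r; exact: ler_dist_dist.
have [c cxy Hc] := EVT_max xy cnf.
have /andP[xc cy] : x <= c <= y by move: cxy; rewrite in_itv.
have h : `|f y - f c| <= (L * `|f c|) * W y - (L * `|f c|) * W c.
  apply: (@abs_continuous_comparison _ V c y f (fun z => (L * `|f c|) * W z)
    (fun z => (L * `|f c|) * w z)) => //.
  - exact: (abs_continuousS (le_trans ax xc) yb acf).
  - exact: (abs_continuousS (le_trans ax xc) yb (abs_continuousZ (L * `|f c|) acW)).
  apply: filterS Hd => z hz zcy.
  have /andP[cz zy] : c <= z <= y by move: zcy; rewrite in_itv.
  have zab : z \in `[a, b] by rewrite in_itv /= (le_trans ax (le_trans xc cz)) (le_trans zy yb).
  have [f' [h1 h2 h3 h4]] := hz zab; exists f'; split => //; first exact: is_deriveZ.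
  apply: le_trans h4 _; rewrite mulrAC; apply: ler_wpM2r => //; apply: ler_wpM2l => //.
  by apply: Hc; rewrite in_itv /= (le_trans xc cz).
rewrite fy sub0r normrN -mulrBr in h.
have Wcy : W y - W c <= W y - W x by rewrite lerD2l lerN2; apply: Wmono => //; exact: le_trans cy yb.
have : `|f c| <= `|f c| * (1 / 2).
  apply: le_trans h _; rewrite [L * _]mulrC -mulrA; apply: ler_wpM2l => //.
  by apply: le_trans WLe; apply: ler_wpM2l.
have nx : `|f x| <= `|f c| by apply: Hc; rewrite in_itv /= lexx xy.
move=> h'; apply/eqP; rewrite -normr_le0; apply: le_trans nx _.
by move: h'; set p := `|_|; clear => h'; lra.
Qed.

(* If y annihilates the transposed matrix of Phi^(1) at t, then y applied to it
   solves a linear equation with zero final value, so it vanishes at a too. *)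
Lemma Phi_injective (R : realType) (n l : nat) (a b : R) (U : set 'rV[R]_n)
    (X : 'I_l -> 'rV[R]_n -> 'rV[R]_n) (u : R -> 'rV[R]_l) (x0 : R -> 'rV[R]_n)
    (Phi : R -> seq 'rV[R]_n -> 'rV[R]_n) (W w : R -> R) :
  open U -> (forall i, smooth_on U (X i)) -> cont_on a b x0 ->
  (forall t, a <= t -> t <= b -> U (x0 t)) -> abs_continuous a b W ->
  {ae lebesgue_measure, forall t : R, t \in `[a, b] ->
    [/\ is_derive t 1 W (w t), 0 <= w t & forall i, `|u t ord0 i| <= w t]} ->
  (forall t, a <= t -> t <= b -> symmetric_multilinear (Phi t)) ->
  (forall z, caratheodory_solution a b (fun t _ => rhs X u x0 Phi 1 z t) (fun t => Phi t [:: z])) ->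
  (forall z, Phi a [:: z] = 0 -> z = 0) ->
  forall t, a <= t -> t <= b -> forall z, Phi t [:: z] = 0 -> z = 0.
Proof.
move=> oU sX cx0 Ux0 acW dW sPhi Phi_sol inja t1 at1 t1b.
pose P t : 'M[R]_n := \matrix_(i < n) Phi t [:: delta_mx ord0 i].
have PE t z : a <= t -> t <= b -> z *m P t = Phi t [:: z].
  move=> at_ tb; rewrite (multilinear_expand _ _ (sPhi t at_ tb)) mulmx_sum_row.
  by apply: eq_bigr => i _; rewrite rowK.
have aa := lexx a; have ab := le_trans at1 t1b.
suff Pu : P t1 \in unitmx.
  by move=> z; rewrite -PE // => h; rewrite -(mulmxK Pu z) h mul0mx.
have Pa : P a \in unitmx.
  by rewrite -row_free_unit; apply: inj_row_free => z; rewrite PE // => /inja.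
rewrite -unitmx_tr -row_free_unit; apply: inj_row_free => y yP.
pose f t := y *m (P t)^T.
suff fa : f a = 0 by rewrite -(mulmxK (_ : (P a)^T \in unitmx) y) ?unitmx_tr // -/(f a) fa mul0mx.
have fE t i : f t ord0 i = \sum_j y ord0 j * Phi t [:: delta_mx ord0 i] ord0 j.
  by rewrite mxE; apply: eq_bigr => j _; rewrite !mxE.
have [r r0 [C C0 HC]] : exists2 r : R, 0 < r & exists2 C : R, 0 <= C & forall i t j, a <= t -> t <= b ->
    `|iter_derive [:: delta_mx ord0 j] (X i) (x0 t)| <= C.
  apply: (finite_constants (Q := fun i (_ : R) C => forall t j, a <= t -> t <= b ->
    `|iter_derive [:: delta_mx ord0 j] (X i) (x0 t)| <= C)).
    by move=> i _ _ C C' _ _ CC H t j at_ tb; apply: le_trans CC; exact: H.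
  move=> i; have [r r0 [C C0 HC]] := tube_bounded 1 oU (sX i) cx0 Ux0.
  exists r => //; exists C => // t j at_ tb.
  have [|_ /(_ [:: delta_mx ord0 j] erefl)] := HC t (x0 t) at_ tb; first by rewrite subrr normr0.
  rewrite big_seq1 => h; apply: le_trans h _; apply: ler_piMr => //.
  by apply: mx_norm_le => // i' j'; rewrite mxE; case: (_ && _); rewrite ?normr1 ?normr0.
have acf : abs_continuous a b f.
  apply: abs_continuous_mx => i' i; rewrite (ord1 i').
  apply: (@abs_continuous_eq _ _ a b (fun t => \sum_j y ord0 j * Phi t [:: delta_mx ord0 i] ord0 j)).
    by move=> t _ _; rewrite fE.
  apply: abs_continuous_sum => j _; apply: (abs_continuousZ (y ord0 j)).
  by apply: (abs_continuous_coord ord0 j); have [] := Phi_sol (delta_mx ord0 i).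
have dPhi : {ae lebesgue_measure, forall t : R, forall i, t \in `[a, b] ->
    is_derive t 1 (fun t => Phi t [:: delta_mx ord0 i]) (rhs X u x0 Phi 1 (delta_mx ord0 i) t)}.
  by apply: ae_all_countable => i; have [] := Phi_sol (delta_mx ord0 i).
apply: (@linear_gronwall R _ a t1 (l%:R * (n%:R * C)) f W w) => //.
- by rewrite !mulr_ge0.
- exact: (abs_continuousS aa t1b acf).
- exact: (abs_continuousS aa t1b acW).
apply: filterS2 dPhi dW => t h1 h2 tat.
have /andP[at_ tt1] : a <= t <= t1 by move: tat; rewrite in_itv.
have tb := le_trans tt1 t1b.
have tab : t \in `[a, b] by rewrite in_itv /= at_ tb.
have [dWt w0 uw] := h2 tab.
pose Dx i j := iter_derive [:: delta_mx ord0 j] (X i) (x0 t).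
exists (\row_i (- \sum_(h < l) u t ord0 h * (Dx h i *m (f t)^T) ord0 ord0)); split => //.
  apply/is_derive_mxP => i' i; rewrite (ord1 i') mxE.
  rewrite (_ : (fun z => f z ord0 i) = (fun z => \sum_j y ord0 j * Phi z [:: delta_mx ord0 i] ord0 j)); last first.
    by apply/funext => z; rewrite fE.
  have := h1 i tab; move=> /is_derive_mxP hd.
  have hs := @is_derive_sum_fun R R 'I_n (index_enum 'I_n) (fun j z => y ord0 j * Phi z [:: delta_mx ord0 i] ord0 j)
    t _ (fun j => is_deriveZ (y ord0 j) (hd ord0 j)).
  apply: (is_derive_eq hs).
  have rE : rhs X u x0 Phi 1 (delta_mx ord0 i) t = - \sum_(h < l) u t ord0 h *: Phi t [:: Dx h i].
    by congr (- _); apply: eq_bigr => h _; rewrite big_nat1 binn scale1r.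
  have fT h : (Dx h i *m (f t)^T) ord0 ord0 = \sum_j Phi t [:: Dx h i] ord0 j * y ord0 j.
    by rewrite /f trmx_mul trmxK mulmxA PE // mxE; apply: eq_bigr => j _; rewrite mxE.
  transitivity (- \sum_(h < l) \sum_j u t ord0 h * (Phi t [:: Dx h i] ord0 j * y ord0 j)); last first.
    by congr (- _); apply: eq_bigr => h _; rewrite fT mulr_sumr.
  rewrite rE [in RHS]exchange_big /= -[RHS]sumrN; apply: eq_bigr => j _.
  rewrite mxE summxE [_ *: _]mulrN mulr_sumr; congr (- _); apply: eq_bigr => h _.
  by rewrite mxE; ring.
apply: mx_norm_le => [|i' i]; first by rewrite !mulr_ge0.
rewrite mxE normrN; apply: le_trans (ler_norm_sum _ _ _) _.
apply: (@le_trans _ _ (\sum_(h < l) (w t * (n%:R * C * `|f t|)))).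
  apply: ler_sum => h _; rewrite normrM; apply: ler_pM => //.
  apply: le_trans (mx_norm_coord_le _ _ _) _; apply: le_trans (mulmx_norm_le _ _) _.
  rewrite -mulrA; apply: ler_wpM2l => //; apply: ler_pM => //; first exact: HC.
  by apply: mx_norm_le => // i2 j2; rewrite mxE; exact: mx_norm_coord_le.
by rewrite sumr_const card_ord -[leLHS]mulr_natl; rewrite le_eqVlt; apply/orP; left; apply/eqP; ring.
Qed.

(** * Jets and changes of charts *)

Section JetCoefficients.
Context {R : realType} {n k : nat}.
Local Notation V := 'rV[R]_n.

Lemma weight_eq0 (al : multi_index k) : weight al = 0%N -> al = [ffun=> ord0].
Proof. by move=> w0; apply: mdeg0_eq; apply/eqP; rewrite -leqn0 -w0 weight_ge_mdeg. Qed.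

Lemma mdeg_gt0 (al : multi_index k) : (0 < weight al)%N -> (0 < mdeg al)%N.
Proof.
rewrite !lt0n; apply: contraNN => /eqP /mdeg0_eq ->.
by rewrite /weight big1 // => i _; rewrite ffunE muln0.
Qed.

Lemma jet_coef0 (F : seq V -> V) (b : 'M[R]_(k, n)) : jet_coef 0 F b = F [::].
Proof.
rewrite /jet_coef (big_pred1 [ffun=> ord0 : 'I_k.+1]) => [|al] /=; last first.
  apply/eqP/eqP => [|->]; first exact: weight_eq0.
  by rewrite /weight big1 // => i _; rewrite ffunE muln0.
have -> : insert_powers b [ffun=> ord0 : 'I_k.+1] = [::].
  by apply: size0nil; rewrite size_insert_powers /mdeg big1 // => i _; rewrite ffunE.
by rewrite /multi_fact big1 ?invr1 ?scale1r // => i _; rewrite ffunE.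
Qed.

Lemma jet_coef_zero c (F : seq V -> V) : symmetric_multilinear F -> (0 < c)%N ->
  jet_coef c F (0 : 'M[R]_(k, n)) = 0.
Proof.
move=> sF c0; apply: big1 => al /eqP alc.
have al0 : (0 < mdeg al)%N by apply: mdeg_gt0; rewrite alc.
have : all (pred1 0) (insert_powers (0 : 'M[R]_(k, n)) al).
  by apply/allP => z /flattenP[s /mapP[i _ ->]] /nseqP[-> _]; rewrite /= row0.
rewrite -(size_insert_powers (0 : 'M[R]_(k, n)) al) in al0.
case: (insert_powers _ _) al0 => //= z zs _ /andP[/eqP -> _].
by have := @multilinearZ R n F 0 0 zs sF; rewrite !scale0r => ->; rewrite scaler0.
Qed.

Lemma adapted_transform_zero (F : seq V -> V) : symmetric_multilinear F ->
  adapted_transform F (0 : 'M[R]_(k, n)) = 0.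
Proof.
move=> sF; apply/row_matrixP => m; rewrite rowK row0. exact: (jet_coef_zero sF (ltn0Sn m)).
Qed.

(** The transform is triangular: its row [m] is F[b^(m+1)] plus terms in earlier rows of [b], so
    rows are recovered by strong induction. *)
Lemma adapted_transform_inj (F : seq V -> V) : symmetric_multilinear F ->
  (forall z, F [:: z] = 0 -> z = 0) -> injective (@adapted_transform R n k F).
Proof.
move=> sF injF b b' bb'; apply/row_matrixP => m.
have [p mp] := ubnP (m : nat); elim: p m mp => // p IH m mp.
(* The multi-index with a single entry 1 at [m], which contributes the linear term in row [m]. *)
pose dm : multi_index k := [ffun i => inord (i == m)].
have dmE i : dm i = (i == m) :> nat by rewrite ffunE inordK // ltnS; case: eqP => // _; apply: leq_ltn_trans (ltn_ord m).
have wdm : weight dm = m.+1.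
  rewrite /weight (bigD1 m) //= dmE eqxx muln1 big1 ?addn0 // => i im.
  by rewrite dmE (negPf im) muln0.
have idm (B : 'M[R]_(k, n)) : insert_powers B dm = [:: row m B].
  have : (insert_powers B dm) = flatten [seq if i == m then [:: row m B] else [::] | i <- enum 'I_k].
    congr flatten; apply: eq_map => i; rewrite dmE.
    by case: eqP => [->|].
  move=> ->; elim: (enum 'I_k) (enum_uniq 'I_k) (mem_enum 'I_k m) => //= i r IHr /andP[ir ur].
  rewrite inE; case: (eqVneq m i) => [mi _|_ /= mr]; last exact: IHr.
  rewrite (_ : flatten _ = [::]) //; apply/nilP.
  rewrite /nilp size_flatten sumnE /shape -map_comp big_map big_seq big1 // => j jr.
  by rewrite /=; case: eqP => // jm; move: ir; rewrite -mi -jm jr.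
have := congr1 (row m) bb'; rewrite !rowK (bigD1 dm) ?wdm // [in RHS](bigD1 dm) ?wdm //= !idm.
have -> : (multi_fact dm)%:R^-1 = 1 :> R.
  by rewrite /multi_fact big1 ?invr1 // => i _; rewrite dmE; case: (i == m).
rewrite !scale1r (eq_bigr (fun al : multi_index k => (multi_fact al)%:R^-1 *: F (insert_powers b' al))).
  move=> /addIr /eqP; rewrite -subr_eq0 -multilinearB // => /eqP /injF /eqP.
  by rewrite subr_eq0 => /eqP.
(* A nonzero entry at an index at or beyond [m] already uses up the weight [m.+1], so [al] would be
   [dm]; all other multi-indices see only earlier rows. *)
move=> al /andP[/eqP alm aldm]; congr (_ *: F (flatten _)); apply: eq_map => i.
have wle (j : 'I_k) : (j.+1 * al j <= m.+1)%N by rewrite -alm /weight (bigD1 j) //= leq_addr.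
have [im|mi] := ltnP i m; first by rewrite IH // (leq_trans im).
suff -> : al i = 0%N :> nat by [].
apply/eqP; apply: contraNT aldm => ali.
have im : i = m.
  apply/val_inj/eqP; rewrite eqn_leq mi andbT -ltnS; apply: leq_trans (wle i).
  by rewrite leq_pmulr // lt0n.
have alm1 : al m = 1%N :> nat.
  apply/eqP; rewrite eqn_leq lt0n -{2}im ali andbT.
  by have := wle m; rewrite -{2}[m.+1]muln1 leq_pmul2l.
apply/eqP/ffunP => j; apply/val_inj; rewrite [RHS]dmE.
have [->|jm] := eqVneq j m; first exact: alm1.
have := alm; rewrite /weight (bigD1 m) //= alm1 muln1 => /eqP.
rewrite -{2}[m.+1]addn0 eqn_add2l sum_nat_eq0 => /forallP/(_ j).
by rewrite jm muln_eq0 /= => /eqP.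
Qed.

End JetCoefficients.

Section Jets.
Context {R : realType} {n k : nat} {M : topologicalType} {A : smooth_atlas R n M}.
Implicit Types (c d : chart A) (g : R -> M) (b : 'M[R]_(k, n)).

Lemma jet_ofP c g b : jet_of c g b <-> [/\ chart_dom c (g 0), {for 0, continuous g} &
  forall e : R, 0 < e -> exists2 r : R, 0 < r & forall s, `|s| < r ->
    `|chart_map c (g s) - chart_map c (g 0) - jet_poly b s| <= e * `|s| ^+ k].
Proof.
split=> [[h1 h2 h3]|[h1 h2 h3]]; split => //.
  move=> e e0; have := h3; move=> /eqoP /(_ e e0) /near_approx[r r0 H]; exists r => // s sr.
  by have := H s; rewrite subr0 normrX; exact.
apply/eqoP => e e0; have [r r0 H] := h3 e e0.
suff : \forall s \near (0 : R),
    `|chart_map c (g s) - chart_map c (g 0) - jet_poly b s| <= e * `|s ^+ k| by [].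
by apply/near_approx; exists r => // s; rewrite subr0 normrX; exact: H.
Qed.

Lemma jet_unique c g b b' : jet_of c g b -> jet_of c g b' -> b = b'.
Proof.
move=> /jet_ofP[_ _ h] /jet_ofP[_ _ h']; apply/eqP; rewrite -subr_eq0; apply/eqP.
apply: jet_poly_unique => e e0; have e20 : 0 < e / 2 by rewrite divr_gt0.
have [r r0 H] := h _ e20; have [r' r'0 H'] := h' _ e20.
exists (Num.min r r') => [|s]; first by rewrite lt_min r0.
rewrite lt_min => /andP[sr sr'].
have -> : jet_poly (b - b') s = (chart_map c (g s) - chart_map c (g 0) - jet_poly b' s) -
    (chart_map c (g s) - chart_map c (g 0) - jet_poly b s).
  by rewrite jet_polyB opprB [RHS]addrC addrA subrK.
apply: le_trans (ler_normB _ _) _; rewrite [e in leRHS]splitr mulrDl.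
by apply: lerD; [exact: H'|exact: H].
Qed.

Lemma jet_poly_bounded b : unif_O [set: unit] 1 (fun s _ => jet_poly b s).
Proof. by apply: (@unif_O_jet_poly R n k unit setT (fun=> b)); exists `|b|. Qed.

Lemma jet_of_unif_O c g b : (0 < k)%N -> jet_of c g b ->
  unif_O [set: unit] 1 (fun s _ => chart_map c (g s) - chart_map c (g 0)).
Proof.
move=> k0 /jet_ofP[_ _ H]; have [C C0 [r r0 HJ]] := jet_poly_bounded b.
have [r' r'0 H'] := H 1 ltr01.
exists (C + 1); first exact: addr_ge0.
exists (Num.min (Num.min r r') 1) => [|s []]; first by rewrite !lt_min r0 r'0 ltr01.
rewrite !lt_min => /andP[/andP[sr sr'] s1] _.
rewrite -(subrK (jet_poly b s) (_ - _)); apply: le_trans (ler_normD _ _) _.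
rewrite addrC mulrDl; apply: lerD; first exact: (HJ s tt sr I).
apply: le_trans (H' s sr') _; rewrite !mul1r; apply: ler_wiXn2l => //; exact: ltW.
Qed.

Lemma chart_overlap_open c d : open (chart_map c @` (chart_dom c `&` chart_dom d)).
Proof.
rewrite openE => _ [p [pc pd] <-].
have Uc : (chart_map c @` chart_dom c) (chart_map c p) by exists p.
have h1 : \forall z \near chart_map c p, (chart_map c @` chart_dom c) z.
  by apply: open_nbhs_nbhs; split => //; exact: chart_map_open.
have h2 : \forall z \near chart_map c p, chart_dom d (chart_inv c z).
  apply: (chart_inv_continuous Uc); rewrite chart_mapK //.
  by apply: open_nbhs_nbhs; split => //; exact: chart_dom_open.
apply: filterS2 h1 h2 => z [p' pc' <-]; rewrite chart_mapK // => pd'.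
by exists p'.
Qed.

Lemma jet_change c d g b : jet_of c g b -> chart_dom d (g 0) ->
  jet_of d g (\matrix_(r < k) jet_coef r.+1
    (fun vs => iter_derive vs (chart_map d \o chart_inv c) (chart_map c (g 0))) b).
Proof.
move=> gb gd; have [gc cg Hg] := (jet_ofP _ _ _).1 gb; apply/jet_ofP; split => //.
set b' := \matrix_(r < k) _; set theta := chart_map d \o chart_inv c.
set x0 := chart_map c (g 0).
(* A 0-jet expresses only continuity and does not give v = O(s), on which the general argument
   rests. *)
case: (posnP k) => [k0|k0].
  have bj s : jet_poly b' s = 0.
    by apply: big1 => r _; have := ltn_ord r; rewrite [X in (_ < X)%N]k0.
  move=> e e0; have cd := chart_map_continuous gd.
  have : \forall s \near (0 : R), `|chart_map d (g s) - chart_map d (g 0)| < e.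
    have h : \forall p \near g 0, `|chart_map d p - chart_map d (g 0)| < e.
      have := cd; move=> /cvgrPdist_lt /(_ e e0); apply: filterS => p.
      by rewrite distrC.
    exact: (cg _ h).
  move=> /near_approx[r r0 H]; exists r => // s sr; rewrite bj subr0 k0 expr0 mulr1.
  by apply: ltW; apply: H; rewrite subr0.
pose U := chart_map c @` (chart_dom c `&` chart_dom d).
have oU : open U by exact: chart_overlap_open.
have Ux0 : U x0 by exists (g 0).
have sth : smooth_on U theta by exact: transition_smooth.
pose F (_ : unit) vs := iter_derive vs theta x0.
pose v s (_ : unit) := chart_map c (g s) - x0.
have sF t : [set: unit] t -> symmetric_multilinear (F t).
  by move=> _; exact: (iter_derive_symmetric oU sth).
have cx : cont_on (0 : R) 0 (fun=> x0) by exact: cont_on_cst.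
have bF p : (p <= k)%N -> multibounded [set: unit] F p.
  move=> _; have [r r0 [C C0 H]] := tube_bounded p oU sth cx (fun _ _ _ => Ux0).
  exists C => // t vs _ vsp; have [|_] := H 0 x0 (lexx _) (lexx _); first by rewrite subrr normr0.
  exact.
have Ov : unif_O [set: unit] 1 v by exact: jet_of_unif_O gb.
have vb : unif_o [set: unit] k (fun s t => v s t - jet_poly b s).
  by move=> e e0; have [r r0 H] := Hg e e0; exists r => // s t sr _; exact: H.
have F0 t vs : [set: unit] t -> (size vs < 0)%N -> F t vs = 0 by [].
have h1 := taylor_sum_lipschitz sF bF F0 Ov (jet_poly_bounded b) vb.
rewrite /= addn0 in h1.
have bb : exists2 C : R, 0 <= C & forall t, [set: unit] t -> `|b| <= C by exists `|b|.
have h2 := unif_O_o (taylor_sum_jet sF bF bb).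
have [r r0 [C C0 HT]] := taylor_tube k.+1 oU sth cx (fun _ _ _ => Ux0).
have h3 : unif_O [set: unit] k.+1 (fun s t => theta (x0 + v s t) - taylor_sum (k := k) (F t) (v s t)).
  have [Cv Cv0 [rv rv0 Hv]] := Ov.
  exists (C * Cv ^+ k.+1); first by rewrite mulr_ge0 // exprn_ge0.
  exists (Num.min rv (r / (Cv + 1))); first by rewrite lt_min rv0 divr_gt0 // ltr_wpDl.
  move=> s t; rewrite lt_min => /andP[srv sr] _; have := Hv s t srv I; rewrite expr1 => vs.
  have vr : `|v s t| < r.
    apply: le_lt_trans vs _; apply: (@le_lt_trans _ _ ((Cv + 1) * `|s|)).
      by rewrite ler_wpM2r // lerDl.
    by rewrite mulrC -ltr_pdivlMr // ltr_wpDl.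
  have [_ h] := HT 0 (v s t) (lexx _) (lexx _) vr; apply: le_trans h _.
  rewrite -mulrA -exprMn; apply: ler_wpM2l => //.
  by rewrite lerXn2r // nnegrE // mulr_ge0.
(* Three errors: truncating Taylor's formula, replacing the curve by its jet, and dropping the
   weights above [k]. *)
have := unif_oD (unif_oD (unif_O_o h3) h1) h2 => H e e0.
have [r1 r10 H1] := H e e0.
have /near_approx[r2 r20 H2] : \forall s \near (0 : R), chart_dom c (g s).
  by apply: cg; apply: open_nbhs_nbhs; split => //; exact: chart_dom_open.
exists (Num.min r1 r2) => [|s]; first by rewrite lt_min r10.
rewrite lt_min => /andP[s1 s2]; have := H1 s tt s1 I.
have gsc : chart_dom c (g s) by apply: H2; rewrite subr0.
have -> : theta (x0 + v s tt) = chart_map d (g s).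
  by rewrite /v addrC subrK /theta /= chart_mapK.
rewrite !addrA !subrK big_ord_recl /= expr0 scale1r jet_coef0.
have -> : F tt [::] = chart_map d (g 0) by rewrite /F /= /theta /= chart_mapK.
rewrite opprD addrA (_ : \sum_(i < k) _ = jet_poly b' s) //.
by apply: eq_bigr => i _; rewrite rowK.
Qed.

End Jets.

Lemma perturbed_control (R : realType) l k T (Omega : set (R -> 'rV[R]_l)) u
    (Du : 'I_k -> R -> 'rV[R]_l) s : control_subspace T Omega -> Omega u ->
  (forall r, Omega (Du r)) -> Omega (fun t => u t + jet_variation Du s t).
Proof.
move=> [_ O0 OZ] Ou ODu.
suff H (rs : seq 'I_k) : Omega (fun t => u t + \sum_(r <- rs) s ^+ r.+1 *: Du r t).
  exact: H.
elim: rs => [|r rs IH].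
  by rewrite (_ : (fun t => _) = u) //; apply/funext => t; rewrite big_nil addr0.
rewrite (_ : (fun t => _) = (fun t => s ^+ r.+1 *: Du r t +
    (u t + \sum_(r <- rs) s ^+ r.+1 *: Du r t))); first exact: OZ.
by apply/funext => t; rewrite big_cons addrCA.
Qed.

Lemma ae_integrableS (R : realType) (v : R -> R) (a b a' b' : R) : a <= a' -> b' <= b ->
  ae_integrable v a b -> ae_integrable v a' b'.
Proof.
move=> aa bb [F iF vF]; exists F => //; apply: filterS vF => t h.
rewrite in_itv /= => /andP[at_ tb]; apply: h.
by rewrite in_itv /= (le_trans aa at_) (le_trans tb bb).
Qed.

Lemma linfunE_linear (R : fieldType) (aT rT : vectType R) (f : aT -> rT) :
  linear f -> linfun f =1 f.
Proof.
move=> lf; pose fL : {linear aT -> rT} := HB.pack f (GRing.isLinear.Build R aT rT _ f lf).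
exact: (lfunE fL).
Qed.

(** Each coordinate functional is in the span of the components of [F], all of which vanish at
    [z]. *)
Lemma basis_functionals_separate (R : realType) n (F : 'rV[R]_n -> 'rV[R]_n) : linear F ->
  basis_of {: 'Hom('rV[R]_n, R^o)}
    [seq linfun (fun v : 'rV[R]_n => F v ord0 a : R^o) | a <- enum 'I_n] ->
  forall z, F z = 0 -> z = 0.
Proof.
move=> lF bF z Fz; apply/rowP => a; rewrite mxE.
have lc (G : 'rV[R]_n -> 'rV[R]_n) i : linear G -> linear (fun v => G v ord0 i : R^o).
  by move=> lG c v w; rewrite lG !mxE.
pose f := linfun (fun v : 'rV[R]_n => v ord0 a : R^o).
have fE : f z = z ord0 a.
  by rewrite /f linfunE_linear // => c v w; rewrite !mxE.
rewrite -fE; set X := (X in basis_of _ X) in bF.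
have fX : f \in <<X>>%VS by rewrite (span_basis bF) memvf.
have /(@coord_span _ _ _ (in_tuple X)) -> : f \in <<in_tuple X>>%VS by [].
rewrite sum_lfunE big1 // => i _; rewrite scale_lfunE.
have /mapP[a' _ ->] : (in_tuple X)`_i \in X by rewrite mem_nth.
by rewrite linfunE_linear ?Fz ?mxE ?scaler0 //; exact: lc.
Qed.

Section ChartCurves.
Context {R : realType} {n : nat} {M : topologicalType} {A : smooth_atlas R n M}.

Lemma curve_continuous0 (c : chart A) (g : R -> M) :
  (exists2 d : R, 0 < d & forall s, `|s| < d -> chart_dom c (g s)) ->
  (forall e : R, 0 < e -> exists2 d : R, 0 < d & forall s, `|s| < d ->
     `|chart_map c (g s) - chart_map c (g 0)| < e) ->
  {for 0, continuous g}.
Proof.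
move=> [d d0 dg] H N gN.
have g0 : chart_dom c (g 0) by apply: dg; rewrite normr0.
have : \forall z \near chart_map c (g 0), N (chart_inv c z).
  have /(@chart_inv_continuous _ _ _ A c) : (chart_map c @` chart_dom c) (chart_map c (g 0)).
    by exists (g 0).
  by apply; rewrite chart_mapK.
move=> /near_approx[e e0 He]; have [d' d'0 H'] := H e e0.
suff : \forall s \near (0 : R), N (g s) by [].
apply/near_approx; exists (Num.min d d') => [|s]; first by rewrite lt_min d0.
rewrite subr0 lt_min => /andP[sd sd'].
by rewrite -(chart_mapK (dg s sd)); apply: He; exact: H'.
Qed.

Lemma adapted_transform_line (F : seq 'rV[R]_n -> 'rV[R]_n) (z : 'M[R]_(1, n)) :
  F [:: z] = 0 -> adapted_transform F z = 0.
Proof.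
move=> Fz; apply/row_matrixP => m; rewrite rowK row0; apply: big1 => al.
rewrite (ord1 m) /weight big_ord1 mul1n => /eqP al1.
rewrite /insert_powers (_ : enum 'I_1 = [:: ord0]); last first.
  by apply: (inj_map val_inj); rewrite val_enum_ord.
rewrite /= cats0 al1 /= (_ : row ord0 z = z) ?Fz ?scaler0 //.
by apply/rowP => j; rewrite mxE.
Qed.

(* A z killed by G is the 1-jet in d of a line; its 1-jet in c is killed by F,
   hence zero, and changing back to d shows that z is zero. *)
Lemma switch_injective (c d : chart A) (p : M) (F G : seq 'rV[R]_n -> 'rV[R]_n) :
  chart_dom c p -> chart_dom d p -> symmetric_multilinear F ->
  (forall (g : R -> M) (b b' : 'M[R]_(1, n)), g 0 = p -> jet_of c g b -> jet_of d g b' ->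
     adapted_transform F b = adapted_transform G b') ->
  (forall z, F [:: z] = 0 -> z = 0) -> forall z, G [:: z] = 0 -> z = 0.
Proof.
move=> cp dp sF FG injF z Gz.
pose g (s : R) := chart_inv d (chart_map d p + s *: z).
have g0 : g 0 = p by rewrite /g scale0r addr0 chart_mapK.
have Ud : (chart_map d @` chart_dom d) (chart_map d p) by exists p.
have [r r0 Hr] := open_approx (@chart_map_open _ _ _ A d) Ud.
have small (e : R) : 0 < e -> exists2 d' : R, 0 < d' & forall s, `|s| < d' -> `|s *: z| < e.
  move=> e0; have z1 : 0 < `|z| + 1 by apply: ltr_wpDl.
  exists (e / (`|z| + 1)) => [|s se]; first by rewrite divr_gt0.
  rewrite normrZ; apply: (@le_lt_trans _ _ (`|s| * (`|z| + 1))).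
    by rewrite ler_wpM2l // lerDl.
  by rewrite -ltr_pdivlMr.
have [d' d'0 Hd'] := small r r0.
have gs s : `|s| < d' -> chart_dom d (g s) /\ chart_map d (g s) = chart_map d p + s *: z.
  move=> sd; have [|p' dp' E] := Hr (chart_map d p + s *: z).
    by rewrite addrAC subrr add0r; exact: Hd'.
  by rewrite /g -E chart_mapK.
have gz : jet_of d g (z : 'M[R]_(1, n)).
  apply/jet_ofP; rewrite g0; split => //.
    apply: (@curve_continuous0 d); first by exists d' => // s /gs[].
    move=> e e0; have [d2 d20 H2] := small e e0.
    exists (Num.min d' d2) => [|s]; first by rewrite lt_min d'0.
    rewrite lt_min g0 => /andP[/gs[_ ->] s2].
    by rewrite addrAC subrr add0r; exact: H2.
  move=> e e0; exists d' => // s sd; have [_ ->] := gs s sd.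
  rewrite /jet_poly big_ord1 expr1 (_ : row ord0 z = z); last by apply/rowP => j; rewrite mxE.
  rewrite [_ + s *: z]addrC addrK subrr normr0; by apply: mulr_ge0; [exact: ltW|exact: normr_ge0].
have cg0 : chart_dom c (g 0) by rewrite g0.
have gb := jet_change gz cg0; set b := \matrix_(r < 1) _ in gb.
have b0 : b = 0.
  apply: (adapted_transform_inj sF injF).
  by rewrite (FG g _ _ g0 gb gz) (adapted_transform_line Gz) adapted_transform_zero.
have dg0 : chart_dom d (g 0) by rewrite g0.
have := jet_change gb dg0; rewrite b0 => gz'.
rewrite (jet_unique gz gz'); apply/row_matrixP => m; rewrite rowK row0.
apply: jet_coef_zero => //; rewrite g0; apply: (iter_derive_symmetric (@chart_overlap_open _ _ _ A c d)).
  exact: transition_smooth.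
by exists p.
Qed.

End ChartCurves.

(** * Gluing the pieces *)

Section JetTrajectory.
Context {R : realType} {n l k : nat} {M : topologicalType}.
Context {A : smooth_atlas R n M} {X : 'I_l -> vector_field A} {T : R}.
Variables (q0 : M) (Omega : set (R -> 'rV[R]_l)) (End : R -> (R -> 'rV[R]_l) -> M).
Variables (u : R -> 'rV[R]_l) (q : R -> M) (C : adapted_coordinates X T u q).
Variable Du : 'I_k -> R -> 'rV[R]_l.
Hypothesis hM : hausdorff_space M.
Hypothesis indX : pointwise_independent X.
Hypothesis T0 : 0 < T.
Hypothesis OS : control_subspace T Omega.
Hypothesis EndP : endpoint_map X T q0 Omega End.
Hypothesis Ou : Omega u.
Hypothesis uq : trajectory X T u q.
Hypothesis q_0 : q 0 = q0.
Hypothesis ODu : forall r, Omega (Du r).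

Definition perturbed_end t s := End t (fun t' => u t' + jet_variation Du s t').

Definition chart_jet_rhs j (b : 'M[R]_(k, n)) t : 'M[R]_(k, n) :=
  jet_rhs (fun i => X i (kappa C j)) Du (fun t => chart_map (kappa C j) (q t)) (Phi C j) b t.

Lemma tau_le i j : (i <= j)%N -> (j <= steps C)%N -> tau C i <= tau C j.
Proof.
elim: j => [|j IH]; first by rewrite leqn0 => /eqP ->.
rewrite leq_eqVlt => /orP[/eqP -> //|ij] js.
by apply: le_trans (IH ij (ltnW js)) (ltW (tau_lt _)).
Qed.

Lemma tau_itv j : (j < steps C)%N -> [/\ 0 <= tau C j, tau C j < tau C j.+1 & tau C j.+1 <= T].
Proof.
move=> js; split; first by have := @tau_le 0 j isT (ltnW js); rewrite tau_first.
  exact: tau_lt.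
by have := @tau_le j.+1 (steps C) js (leqnn _); rewrite tau_last.
Qed.

Lemma perturbed_trajectory s :
  trajectory X T (fun t' => u t' + jet_variation Du s t') (perturbed_end ^~ s).
Proof. exact: (EndP (perturbed_control s OS Ou ODu)).2. Qed.

Lemma omega_integrable v i : Omega v -> ae_integrable (fun t => v t ord0 i) 0 T.
Proof. by move=> /EndP[_ vE]; exact: (control_integrable (ltW T0) indX vE i). Qed.

Lemma weight_exists : exists W w : R -> R, abs_continuous 0 T W /\
  {ae lebesgue_measure, forall t : R, t \in `[0, T] ->
    [/\ is_derive t 1 W (w t), 0 <= w t, forall i, `|u t ord0 i| <= w t &
        forall r i, `|Du r t ord0 i| <= w t]}.
Proof.
pose f (p : 'I_l + 'I_k * 'I_l) t := match p with
  | inl i => u t ord0 i | inr ri => Du ri.1 t ord0 ri.2 end.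
have [|W [w [acW dW Hw]]] := @control_weight R 0 T _ f.
  by case=> [i|[r i]]; exact: omega_integrable.
exists W, w; split => //; apply: filterS dW => t h tT; have [w0 Hf] := Hw t.
split; [exact: h|exact: w0|by move=> i; exact: (Hf (inl i))|].
by move=> r i; exact: (Hf (inr (r, i))).
Qed.

(** What one subinterval hands on to the next. The middle clause is uniqueness of the unperturbed
    trajectory, which is not assumed: [q] and [End] are related only by having the same control and
    initial point. *)
Definition jet_state j t (b : 'M[R]_(k, n)) := [/\ jet_of (kappa C j) (perturbed_end t) b,
  perturbed_end t 0 = q t & forall z, Phi C j t [:: z] = 0 -> z = 0].

Lemma piece_step j b0 : (j < steps C)%N -> jet_state j (tau C j) b0 ->
  exists B : R -> 'M[R]_(k, n), [/\ B (tau C j) = b0,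
    abs_continuous (tau C j) (tau C j.+1) (fun t => adapted_transform (Phi C j t) (B t)),
    {ae lebesgue_measure, forall t : R, t \in `[tau C j, tau C j.+1] ->
       is_derive t 1 (fun t => adapted_transform (Phi C j t) (B t)) (chart_jet_rhs j (B t) t)} &
    forall t, tau C j <= t -> t <= tau C j.+1 -> jet_state j t (B t)].
Proof.
move=> js [jb0 qa inja].
have [a0 ab bT] := tau_itv js.
set a := tau C j in jb0 qa inja a0 ab *; set b := tau C j.+1 in ab bT *.
pose c := kappa C j; pose U := chart_map c @` chart_dom c.
pose x0 t := chart_map c (q t); pose Xc i := X i c.
have abW := ltW ab.
have oU : open U by exact: chart_map_open.
have sX i : smooth_on U (Xc i) by exact: vf_smooth.
have qc t : a <= t -> t <= b -> chart_dom c (q t).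
  by move=> at_ tb; apply: kappa_dom => //; rewrite in_itv /= at_.
have Ux0 t : a <= t -> t <= b -> U (x0 t) by move=> at_ tb; exists (q t) => //; exact: qc.
have [acx0 dx0] : caratheodory_solution a b (fun t x => \sum_(i < l) u t ord0 i *: Xc i x) x0.
  by apply: uq.2 => // t; rewrite in_itv /= => /andP[]; exact: qc.
have [W [w [acW dW]]] := weight_exists.
have {}acW := abs_continuousS a0 bT acW.
have sub t : t \in `[a, b] -> t \in `[0, T].
  by rewrite !in_itv /= => /andP[at_ tb]; rewrite (le_trans a0 at_) (le_trans tb bT).
have {}dW : {ae lebesgue_measure, forall t : R, t \in `[a, b] ->
    [/\ is_derive t 1 W (w t), 0 <= w t, forall i, `|u t ord0 i| <= w t &
        forall r i, `|Du r t ord0 i| <= w t]}.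
  by apply: filterS dW => t h /sub; exact: h.
pose y s t := perturbed_end t s.
have cy s : {within `[a, b], continuous (y s)}.
  apply: (continuous_subspaceW _ (perturbed_trajectory s).1) => t /=.
  exact: sub.
have ys s t1 : t1 <= b -> (forall t, t \in `[a, t1] -> chart_dom c (y s t)) ->
     caratheodory_solution a t1
       (fun t x => \sum_(i < l) (u t + jet_variation Du s t) ord0 i *: X i c x)
       (chart_map c \o y s).
  by move=> t1b; apply: (perturbed_trajectory s).2 => //; exact: le_trans bT.
have [jc jcont Hj] := (jet_ofP _ _ _).1 jb0.
have near_dom : exists2 d : R, 0 < d & forall s, `|s| < d -> chart_dom c (y s a).
  have /near_approx[d d0 H] : \forall s \near (0 : R), chart_dom c (perturbed_end a s).
    by apply: jcont; apply: open_nbhs_nbhs; split => //; exact: chart_dom_open.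
  by exists d => // s sd; apply: H; rewrite subr0.
have init : exists2 C : R, 0 <= C & exists2 d : R, 0 < d & forall s, `|s| < d ->
     chart_dom c (y s a) /\ `|chart_map c (y s a) - x0 a| <= C * `|s|.
  have [d d0 Hd] := near_dom.
  (* For [k = 0] there are no variations, so the perturbed curve starts at [q a] itself. *)
  case: (posnP k) => [k0|k0].
    exists 0 => //; exists d => // s sd; split; first exact: Hd.
    rewrite (_ : y s a = q a) ?subrr ?normr0 ?mul0r // -qa; congr (End a _).
    apply/funext => t; congr (_ + _); rewrite /jet_variation !big1 // => r _.
      by have := ltn_ord r; rewrite [X in (_ < X)%N]k0.
    by have := ltn_ord r; rewrite [X in (_ < X)%N]k0.
  have [C0 C00 [d' d'0 H]] := jet_of_unif_O k0 jb0.
  exists C0 => //; exists (Num.min d d') => [|s]; first by rewrite lt_min d0.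
  rewrite lt_min => /andP[sd sd']; split; first exact: Hd.
  by have := H s tt sd' I; rewrite qa expr1.
have [d d0 [K K0 HK]] := deviation_bound hM abW acx0 Ux0 dx0 acW dW cy ys init.
have xs s : `|s| < d -> caratheodory_solution a b
    (fun t y => \sum_(i < l) (u t + jet_variation Du s t) ord0 i *: Xc i y)
    (fun t => chart_map c (y s t)).
  move=> sd; apply: ys => // t; rewrite in_itv /= => /andP[at_ tb].
  by have [] := HK s t sd at_ tb.
have Ov : unif_O [set t | a <= t <= b] 1 (fun s t => chart_map c (y s t) - x0 t).
  exists K => //; exists d => // s t sd /andP[at_ tb].
  by rewrite expr1; have [] := HK s t sd at_ tb.
have iDu r i : ae_integrable (fun t => Du r t ord0 i) a b.
  by apply: (ae_integrableS a0 bT); exact: omega_integrable.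
have sPhi t : a <= t -> t <= b -> symmetric_multilinear (Phi C j t).
  by move=> at_ tb; apply: Phi_multilinear => //; rewrite in_itv /= at_.
have Phi_sol m : (0 < m)%N -> forall z, caratheodory_solution a b
    (fun t _ => rhs Xc u x0 (Phi C j) m z t) (fun t => Phi C j t (nseq m z)).
  by move=> m0 z; exact: (@Phi_ode _ _ _ _ _ _ _ _ _ C j js m m0 z).
have dW' : {ae lebesgue_measure, forall t : R, t \in `[a, b] ->
    [/\ is_derive t 1 W (w t), 0 <= w t & forall i, `|u t ord0 i| <= w t]}.
  by apply: filterS dW => t h tab; have [h1 h2 h3 _] := h tab.
have injP := Phi_injective oU sX (abs_continuous_cont_on acx0) Ux0 acW dW' sPhi
  (Phi_sol 1 isT) inja.
have qa0 : chart_map c (y 0 a) = x0 a by rewrite /y qa.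
have init' e : 0 < e -> exists2 d : R, 0 < d & forall s, `|s| < d ->
     `|chart_map c (y s a) - x0 a - jet_poly b0 s| <= e * `|s| ^+ k.
  by move=> e0; have := Hj e e0; rewrite qa.
have [B [Ba vB acB dB]] := piece_expansion abW oU sX acx0 Ux0 dx0 d0 xs Ov acW dW iDu
  sPhi Phi_sol injP init'.
exists B; split => // t at_ tb.
have y0 : perturbed_end t 0 = q t.
  (* The deviation bound at s = 0 gives the uniqueness clause of [jet_state]. *)
  have nd : `|0 : R| < d by rewrite normr0.
  have [h1 h2] := HK 0 t nd at_ tb.
  rewrite normr0 mulr0 normr_le0 subr_eq0 in h2.
  by rewrite -[LHS](chart_mapK h1) (eqP h2) /x0 chart_mapK //; exact: qc.
split => //; last exact: injP.
apply/jet_ofP; rewrite y0; split; first exact: qc.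
  apply: (@curve_continuous0 _ _ _ _ c).
    by exists d => // s sd; have [] := HK s t sd at_ tb.
  move=> e e0; have K1 : 0 < K + 1 by apply: ltr_wpDl.
  exists (Num.min d (e / (K + 1))) => [|s]; first by rewrite lt_min d0 divr_gt0.
  rewrite lt_min y0 => /andP[sd se]; have [_ h] := HK s t sd at_ tb.
  apply: le_lt_trans h _; apply: (@le_lt_trans _ _ ((K + 1) * `|s|)).
    by rewrite ler_wpM2r // lerDl.
  by rewrite mulrC -ltr_pdivlMr.
move=> e e0; have [r r0 H] := vB e e0; exists r => // s sr.
by apply: H; rewrite /= ?at_.
Qed.

(** A switching time belongs to the subinterval that ends there, hence the strict inequality on the
    left for all pieces but the first. *)
Lemma piece_eq j t : (j < steps C)%N -> (j = 0%N \/ tau C j < t) -> t <= tau C j.+1 -> piece C t = j.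
Proof.
move=> js jt tj; rewrite /piece; set a := fun i => t <= tau C i.+1.
have sz : (j < size (iota 0 (steps C)))%N by rewrite size_iota.
have ha : has a (iota 0 (steps C)).
  by apply/(has_nthP 0%N); exists j; rewrite // nth_iota.
apply/eqP; rewrite eqn_leq; apply/andP; split; rewrite leqNgt; apply/negP => h.
  by have := before_find 0%N h; rewrite nth_iota // add0n /a tj.
have := nth_find 0%N ha; rewrite nth_iota ?add0n; last exact: ltn_trans js.
case: jt => [j0|jt]; first by move: h; rewrite j0.
by move=> h'; have := lt_le_trans jt (le_trans h' (tau_le h (ltnW js))); rewrite ltxx.
Qed.

Lemma extended_systemE j t (b : 'M[R]_(k, n)) : (j < steps C)%N -> piece C t = j ->
  symmetric_multilinear (Phi C j t) -> (forall z, Phi C j t [:: z] = 0 -> z = 0) ->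
  extended_system C Du t (t, adapted_transform (Phi C j t) b) = (1, chart_jet_rhs j b t).
Proof.
move=> js pt sPhi injPhi.
(* [Psi_inv] is a choice among preimages; injectivity of the transform identifies the chosen one. *)
have Pinv : Psi_inv C t (adapted_transform (Phi C j t) b) = b.
  rewrite /Psi_inv /Psi /Phi_at pt; apply: (adapted_transform_inj sPhi injPhi).
  exact: (@xgetPex _ 0 [set b' | adapted_transform (Phi C j t) b' = _] (ex_intro _ b erefl)).
have yE i m : y_field C i m t (adapted_transform (Phi C j t) b) =
    double_coef (Phi C j t)
      (fun vs => iter_derive vs (X i (kappa C j)) (chart_map (kappa C j) (q t))) m.-1 b.
  by rewrite /y_field Pinv /Phi_at /chart_at pt.
pose G (r : 'I_k) i : 'M[R]_(k, n) := \matrix_(c < k) if (c < r)%N then 0 else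
  y_field C i (c.+1 - r) t (adapted_transform (Phi C j t) b).
(* The number of leading zeros of Z^(k-r) is k - (k - r) = r. *)
have ZE (r : 'I_k) i : Z_field C i (k - r) (t, adapted_transform (Phi C j t) b) = (0, G r i).
  by rewrite /Z_field subKn //; exact: ltnW.
have sumE (I : finType) (f : I -> R * 'M[R]_(k, n)) :
    \sum_i f i = (\sum_i (f i).1, \sum_i (f i).2).
  by elim/big_rec3: _ => // i x y z _ ->.
rewrite /extended_system sumE; congr (_, _).
  rewrite big1 ?addr0 // => r _; rewrite sumE big1 // => i _.
  by rewrite ZE /= scaler0.
rewrite [LHS]add0r; apply/row_matrixP => c; rewrite rowK raddf_sum /= (bigID (fun r : 'I_k => (r <= c)%N)) /=.
rewrite [X in _ + X]big1 ?addr0 => [|r]; last first.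
  rewrite -ltnNge => cr; rewrite sumE raddf_sum big1 // => i _.
  by rewrite ZE /= linearZ /= rowK cr scaler0.
apply: eq_bigr => r rc; rewrite sumE raddf_sum; apply: eq_bigr => i _.
by rewrite ZE /= linearZ /= rowK ltnNge rc /= yE subSn.
Qed.

Lemma switch_state j b : (j.+1 < steps C)%N -> jet_state j (tau C j.+1) b ->
  exists2 b', jet_state j.+1 (tau C j.+1) b' &
    adapted_transform (Phi C j (tau C j.+1)) b = adapted_transform (Phi C j.+1 (tau C j.+1)) b'.
Proof.
move=> js1 [jb qt injj]; have js := ltnW js1.
have [a0 ab bT] := tau_itv js; have [_ bc _] := tau_itv js1.
have q1 : chart_dom (kappa C j) (q (tau C j.+1)).
  by apply: kappa_dom => //; rewrite in_itv /= lexx ltW.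
have q2 : chart_dom (kappa C j.+1) (q (tau C j.+1)).
  by apply: kappa_dom => //; rewrite in_itv /= lexx ltW.
have jb' := jet_change jb (_ : chart_dom (kappa C j.+1) _).
have {jb'} := jb' (eq_ind_r (chart_dom (kappa C j.+1)) q2 qt) => jb'.
eexists; last exact: (Phi_switch js1 qt jb jb').
split => //; apply: (switch_injective q1 q2 _ (fun g b1 b2 g0 => Phi_switch js1 g0) injj).
by apply: Phi_multilinear => //; rewrite in_itv /= lexx ltW.
Qed.

Lemma initial_state : (0 < steps C)%N -> jet_state 0 0 0.
Proof.
move=> s0; have [_ t1 _] := tau_itv s0; rewrite tau_first in t1.
have in0 : 0 \in `[tau C 0, tau C 1] by rewrite tau_first in_itv /= lexx ltW.
have E0 s : perturbed_end 0 s = q0 by exact: (EndP (perturbed_control s OS Ou ODu)).1.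
split; last 1 first.
- apply: basis_functionals_separate (Phi_basis C).
  by have [_] := Phi_multilinear s0 in0; apply.
- apply/jet_ofP; rewrite E0; split.
  + by rewrite -q_0; exact: kappa_dom.
  + rewrite (_ : perturbed_end 0 = cst q0); first exact: cst_continuous.
    by apply/funext => s; exact: E0.
  + move=> e e0; exists 1 => // s _; rewrite E0 subrr jet_poly0 subr0 normr0.
    by apply: mulr_ge0; [exact: ltW|exact: exprn_ge0].
by rewrite E0 q_0.
Qed.

Definition jet_solution (b : R) (Q : R -> 'M[R]_(k, n)) := [/\ Q 0 = 0, abs_continuous 0 b Q,
  {ae lebesgue_measure, forall t : R, t \in `[0, b] ->
     exists2 d, is_derive t 1 Q d & extended_system C Du t (t, Q t) = (1, d)} &
  forall t, 0 <= t -> t <= b -> exists2 b, jet_of (chart_at C t) (perturbed_end t) b &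
    Q t = Psi C t b].

(** Induction over the switching times. The state for the next piece is already expressed in the
    next chart, which is why it is promised only for [j < steps C]. *)
Lemma jet_solution_exists j : (0 < steps C)%N -> (j <= steps C)%N ->
  exists2 Q, jet_solution (tau C j) Q & (j < steps C)%N ->
    exists2 b, jet_state j (tau C j) b & Q (tau C j) = adapted_transform (Phi C j (tau C j)) b.
Proof.
move=> s0; elim: j => [_|j IH js].
  have st := initial_state s0.
  have [_ t1 _] := tau_itv s0; rewrite tau_first in t1.
  have sP : symmetric_multilinear (Phi C 0 0).
    by apply: Phi_multilinear => //; rewrite tau_first in_itv /= lexx ltW.
  exists (fun=> 0); last first.
    by move=> _; exists 0; rewrite tau_first // adapted_transform_zero.
  rewrite tau_first; split => //; first exact: abs_continuous_cst.
    (* The interval [0, 0] has empty interior, so the equation holds there vacuously almost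
       everywhere. *)
    apply: filterS (ae_interior 0 0) => t h /h /andP[h1 h2].
    by have := lt_trans h1 h2; rewrite ltxx.
  move=> t h1 h2; have {h1 h2}-> : t = 0 by apply/eqP; rewrite eq_le h1 h2.
  have p0 : piece C 0 = 0%N by apply: piece_eq => //; [left|exact: ltW].
  exists 0; rewrite /Psi /Phi_at /chart_at p0; first by have [] := st.
  by rewrite adapted_transform_zero.
have [Q [Q0 acQ dQ jQ] /(_ js)[b0 st Qb]] := IH (ltnW js).
have [a0 ab bT] := tau_itv js.
have [B [Ba acB dB jB]] := piece_step js st.
set a := tau C j in st Qb a0 ab acQ dQ jQ Ba acB dB jB; set b := tau C j.+1 in ab bT acB dB jB *.
(* Both formulas agree at [a], because [Q a] is by induction the transform of the initial jet [b0]
   in the new chart. *)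
pose Q' t := if t <= a then Q t else adapted_transform (Phi C j t) (B t).
have Q'l t : t <= a -> Q' t = Q t by rewrite /Q' => ->.
have Q'r t : a <= t -> Q' t = adapted_transform (Phi C j t) (B t).
  by rewrite /Q'; case: ltgtP => // <- _; rewrite Qb Ba.
exists Q'; last first.
  move=> js1; have [b' st' E] := switch_state js1 (jB b (ltW ab) (lexx b)).
  by exists b' => //; rewrite Q'r ?(ltW ab).
split.
- by rewrite Q'l.
- apply: (abs_continuous_glue a0 (ltW ab)).
    by apply: abs_continuous_eq acQ => t _ ta; rewrite Q'l.
  by apply: abs_continuous_eq acB => t at_ _; rewrite Q'r.
(* Discarding the endpoints lets each derivative be computed on one side of the gluing point
   only. *)
- have nl := ae_interior 0 a; have nr := ae_interior a b.
  apply: filterS2 (filterI nl nr) (filterI dQ dB) => t [tl tr] [hl hr].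
  rewrite in_itv /= => /andP[t0 tb].
  have [ta|ta] := leP t a.
    have tI : t \in `[0, a] by rewrite in_itv /= t0.
    have /andP[_ ta'] := tl tI; have [d dQt Ed] := hl tI; exists d; last by rewrite Q'l.
    apply: (is_derive_near_eq (r := a - t) _ _ dQt); first by rewrite subr_gt0.
    move=> z zt; rewrite Q'l //; move: zt; rewrite ltr_norml => /andP[_].
    by rewrite ltrD2r => /ltW.
  have tI : t \in `[a, b] by rewrite in_itv /= tb ltW.
  have pt : piece C t = j by apply: piece_eq => //; right.
  exists (chart_jet_rhs j (B t) t).
    apply: (is_derive_near_eq (r := t - a) _ _ (hr tI)); first by rewrite subr_gt0.
    move=> z zt; rewrite Q'r //; move: zt; rewrite ltr_norml => /andP[+ _].
    by rewrite opprB ltrD2r => /ltW.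
  rewrite (Q'r _ (ltW ta)); apply: extended_systemE => //.
    exact: Phi_multilinear.
  by have [] := jB t (ltW ta) tb.
move=> t t0 tb; have [ta|ta] := leP t a.
  by rewrite Q'l //; exact: jQ.
have pt : piece C t = j by apply: piece_eq => //; right.
exists (B t); rewrite /Psi /Phi_at /chart_at pt; last by rewrite Q'r // ltW.
by have [] := jB t (ltW ta) tb.
Qed.

End JetTrajectory.

(** * The trajectory in the extended space *)

Lemma abs_continuous_pair (R : realType) (V1 V2 : normedModType R) (a b : R) (f : R -> V1) (g : R -> V2) :
  abs_continuous a b f -> abs_continuous a b g -> abs_continuous a b (fun t => (f t, g t)).
Proof.
move=> acf acg; apply: (abs_continuous_dominated (C := 1) acf acg) => x y _ _ _.
by rewrite mul1r prod_normE /= ge_max lerDl lerDr !normr_ge0.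
Qed.

Lemma is_derive_pair (R : realType) (V1 V2 : normedModType R) (t : R) (f : R -> V1) (g : R -> V2) f' g' :
  is_derive t 1 f f' -> is_derive t 1 g g' -> is_derive t 1 (fun t => (f t, g t)) (f', g').
Proof.
move=> /is_derive_approx Hf /is_derive_approx Hg; apply: approx_is_derive => e e0.
have [r r0 {}Hf] := Hf e e0; have [r' r'0 {}Hg] := Hg e e0.
exists (Num.min r r') => [|z]; first by rewrite lt_min r0.
rewrite lt_min => /andP[zr zr']; rewrite prod_normE /= ge_max.
by apply/andP; split; [exact: Hf|exact: Hg].
Qed.

Theorem theorem5p3 (R : realType) (n l : nat) (M : topologicalType)
    (A : smooth_atlas R n M) (X : 'I_l -> vector_field A) (T : R) (q0 : M)
    (Omega : set (R -> 'rV[R]_l)) (End : R -> (R -> 'rV[R]_l) -> M)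
    (u : R -> 'rV[R]_l) (q : R -> M) (C : adapted_coordinates X T u q)
    (k : nat) (Du : 'I_k -> R -> 'rV[R]_l) :
  hausdorff_space M -> @second_countable M ->
  pointwise_independent X -> 0 < T ->
  control_subspace T Omega -> endpoint_map X T q0 Omega End ->
  Omega u -> trajectory X T u q -> q 0 = q0 ->
  (forall r, Omega (Du r)) ->
  exists Q : R -> 'M[R]_(k, n),
    (forall t, t \in `[0, T] -> exists2 b : 'M[R]_(k, n),
       jet_of (chart_at C t)
         (fun s : R => End t (fun t' => u t' + jet_variation Du s t')) b &
       Q t = Psi C t b) /\
    let p := fun t : R => (t, Q t) in
    p 0 = (0, 0) /\
    caratheodory_solution 0 T (extended_system C Du) p.
Proof.
move=> hM _ indX T0 OS EndP Ou uq q_0 ODu.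
have s0 : (0 < steps C)%N.
  rewrite lt0n; apply/eqP => s0; have := tau_last C.
  by rewrite s0 tau_first => T0'; rewrite -T0' ltxx in T0.
have [Q [Q0 acQ dQ jQ] _] :=
  jet_solution_exists hM indX T0 OS EndP Ou uq q_0 ODu s0 (leqnn (steps C)).
rewrite tau_last in acQ dQ jQ.
exists Q; split.
  by move=> t; rewrite in_itv /= => /andP[t0 tT]; exact: jQ.
split; first by rewrite Q0.
split; first exact: abs_continuous_pair (abs_continuous_id 0 T) acQ.
apply: filterS dQ => t h /h[d dQt ->].
exact: is_derive_pair (is_derive_id t 1) dQt.
Qed.
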